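(* Let $d\ge 1$, $\alpha\in(0,2)$, and let $W$ be a Borel measurable function on $\mathbb{R}^d\times\mathbb{R}^d$ defined by $$W(x,y)=(U_1(x)+U_1(y))\mathbf 1_{\{|x-y|<1\}}+(U_2(x)+U_2(y))\mathbf 1_{\{|x-y|\ge 1\}},$$ where $U_1,U_2$ are nonnegative locally bounded functions on $\mathbb{R}^d$ such that for some $c_1>0$ and $q\in[0,\alpha)$, $$U_2(x)\le c_1(1+|x|)^q,\qquad x\in\mathbb{R}^d.$$ Let $(P_t)_{t\ge0}$ be the Markovian semigroup on $L^2(\mathbb{R}^d;dx)$ associated with the regular Dirichlet form $(\mathcal E,\mathcal F)$ determined by $W$ and $\alpha$ (defined in the context). Then: (i) if $\inf_{x\in\mathbb{R}^d}U_1(x)>0$ and $\liminf_{|x|\to\infty}\frac{U_1(x)}{|x|^2}=\infty$, then $(P_t)_{t\ge0}$ is compact on $L^2(\mathbb{R}^d;dx)$; (ii) if $\limsup_{|x|\to\infty}\frac{U_1(x)}{|x|^2}<\infty$, then $(P_t)_{t\ge0}$ is not compact on $L^2(\mathbb{R}^d;dx)$.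
   Context: For a nonnegative symmetric Borel function $W$ on $\mathbb{R}^d\times\mathbb{R}^d$ such that $x\mapsto\int_{\mathbb{R}^d}(1\wedge|x-y|^2)\frac{W(x,y)}{|x-y|^{d+\alpha}}\,dy$ belongs to $L^1_{\rm loc}(\mathbb{R}^d;dx)$ (this is implied by the hypotheses on $U_1,U_2$ in the claim), define $$\mathcal E(f,g)=\iint_{\mathbb{R}^d\times\mathbb{R}^d}(f(x)-f(y))(g(x)-g(y))\frac{W(x,y)}{|x-y|^{d+\alpha}}\,dx\,dy,$$ $$\mathcal D(\mathcal E)=\{f\in L^2(\mathbb{R}^d;dx):\mathcal E(f,f)<\infty\},\qquad \|f\|_{\mathcal E_1}=\big(\mathcal E(f,f)+\|f\|_{L^2(\mathbb{R}^d;dx)}^2\big)^{1/2}.$$ Then $C_c^\infty(\mathbb{R}^d)$ (smooth compactly supported functions) is contained in $\mathcal D(\mathcal E)$. Let $\mathcal F$ be the closure of $C_c^\infty(\mathbb{R}^d)$ in $\mathcal D(\mathcal E)$ with respect to $\|\cdot\|_{\mathcal E_1}$. Then $(\mathcal E,\mathcal F)$ is a regular Dirichlet form on $L^2(\mathbb{R}^d;dx)$, and $(P_t)_{t\ge0}$ denotes the associated strongly continuous symmetric Markovian semigroup, i.e. $P_t=e^{-tL}$, where $L$ is the nonnegative self-adjoint operator on $L^2(\mathbb{R}^d;dx)$ associated with the closed form $(\mathcal E,\mathcal F)$. The semigroup is called compact if $P_t$ is a compact operator on $L^2(\mathbb{R}^d;dx)$ for every $t>0$ (equivalently, for some $t>0$).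 *)

(* Defs.v *)
From HB Require Import structures.
From mathcomp Require Import all_boot all_order all_algebra.
From mathcomp Require Import all_classical all_reals all_analysis.
From mathcomp Require Import measurable_realfun.

Set Implicit Arguments.
Unset Strict Implicit.
Unset Printing Implicit Defensive.

Import Order.TTheory GRing.Theory Num.Theory.
Import numFieldNormedType.Exports.

Local Open Scope classical_set_scope.
Local Open Scope ring_scope.

Definition borel_rV_display : measure_display.
Proof. exact: default_measure_display. Qed.

Section borel_rV.
Context (R : realType) (d : nat).

HB.instance Definition _ := @isMeasurable.Build
  borel_rV_display 'rV[R]_d <<s (@open 'rV[R]_d) >>
  (@sigma_algebra0 _ setT _) (@sigma_algebraC _ _) (@sigma_algebra_bigcup _ setT _).

Lemma open_measurable_rV (A : set 'rV[R]_d) : open A -> measurable A.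
Proof. exact: sub_sigma_algebra. Qed.

Lemma measurable_coord_rV (i : 'I_d) :
  measurable_fun [set: 'rV[R]_d] (fun v : 'rV[R]_d => v ord0 i).
Proof.
apply: (measurability _ (RGenOpens.measurableE R)) => _ [_ [a [b ->]] <-].
rewrite setTI; apply: open_measurable_rV.
have /continuousP := @coord_continuous R 1 d ord0 i.
by apply; exact: interval_open.
Qed.

Lemma open_bigcup_ball_rV (A : set 'rV[R]_d) : open A ->
  A = \bigcup_(k in [set k : 'rV[rat]_d * rat |
        0 < (ratr k.2 : R) /\ ball (map_mx ratr k.1 : 'rV[R]_d) (ratr k.2) `<=` A])
      ball (map_mx ratr k.1 : 'rV[R]_d) (ratr k.2).
Proof.
move=> oA; apply/seteqP; split=> [v Av|v [k [_ kA]]]; last exact: kA.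
move: oA; rewrite openE => /(_ _ Av)/nbhs_ballP[e /= e0 eA].
have e2 : 0 < e / 2 by rewrite divr_gt0.
have [r /itvP rP] := rat_in_itvoo e2.
have r0 : 0 < (ratr r : R) by rewrite rP.
have /choice[q qP] (i : 'I_d) : exists r' : rat, ball (v ord0 i) (ratr r) (ratr r').
  have vr : v ord0 i < v ord0 i + ratr r by rewrite ltrDl.
  have [r' /itvP r'P] := rat_in_itvoo vr.
  exists r'; rewrite /ball /= distrC ltr_distl r'P andbT.
  by rewrite (@le_lt_trans _ _ (v ord0 i)) ?r'P// lerBlDr lerDl ltW.
have vq : ball v (ratr r) (map_mx ratr (\row_i q i) : 'rV[R]_d).
  by split=> // i j; rewrite !mxE ord1; exact: qP.
exists (\row_i q i, r); last exact: ball_sym.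
split=> //= w /(ball_triangle vq) vw; apply: eA.
by apply: le_ball vw; rewrite [leRHS]splitr lerD// ltW ?rP.
Qed.

Lemma measurable_fun_rV d' (T : measurableType d') (f : T -> 'rV[R]_d) :
  (forall i, measurable_fun [set: T] (fun t => f t ord0 i)) ->
  measurable_fun [set: T] f.
Proof.
move=> mf; apply: (measurability (@open 'rV[R]_d)) => // _ [A oA <-].
rewrite setTI (open_bigcup_ball_rV oA) preimage_bigcup bigcup_mkcond.
apply: countable_bigcupT_measurable => [|[q r]]; first exact: countableP.
case: ifPn => // /set_mem[/= r0 _].
rewrite (_ : _ @^-1` _ = \bigcap_(i in [set: 'I_d])
    ((fun t => f t ord0 i) @^-1` ball (ratr (q ord0 i) : R) (ratr r))).
  apply: fin_bigcap_measurable => // i _; rewrite -[X in measurable X]setTI.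
  by apply: mf => //; apply: open_measurable; exact: ball_open.
apply/seteqP; split => [t /= [_ ft] i _|t ft]; first by have := ft ord0 i; rewrite mxE.
by split=> // i j; rewrite mxE ord1; exact: ft.
Qed.
End borel_rV.

Section lebesgue_rV.
Context (R : realType).

Definition cons_rV d (p : R * 'rV[R]_d) : 'rV[R]_d.+1 :=
  \row_i oapp (fun j => p.2 ord0 j) p.1 (unlift ord0 i).

Definition uncons_rV d (v : 'rV[R]_d.+1) : R * 'rV[R]_d :=
  (v ord0 ord0, \row_j v ord0 (lift ord0 j)).

Lemma cons_rVK d : cancel (@cons_rV d) (@uncons_rV d).
Proof.
move=> [t v]; rewrite /uncons_rV mxE unlift_none; congr pair.
by apply/rowP => j; rewrite !mxE liftK.
Qed.

Lemma uncons_rVK d : cancel (@uncons_rV d) (@cons_rV d).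
Proof.
by move=> v; apply/rowP => i; rewrite mxE; case: unliftP => [j ->|->] /=; rewrite ?mxE.
Qed.

Lemma measurable_cons_rV d :
  measurable_fun [set: measurableTypeR R * 'rV[R]_d] (@cons_rV d).
Proof.
apply: measurable_fun_rV => i; case: (unliftP ord0 i) => [j ->|->].
  rewrite (_ : (fun _ => _) = (fun v : 'rV[R]_d => v ord0 j) \o snd).
    by apply: measurableT_comp => //; exact: measurable_coord_rV.
  by apply/funext => p; rewrite mxE liftK.
rewrite (_ : (fun _ => _) = fst) //.
by apply/funext => p; rewrite mxE unlift_none.
Qed.

Lemma measurable_uncons_rV d :
  measurable_fun [set: 'rV[R]_d.+1] (@uncons_rV d : _ -> measurableTypeR R * 'rV[R]_d).
Proof.
apply: measurable_fun_pair; first exact: measurable_coord_rV.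
apply: measurable_fun_rV => i.
under eq_fun do rewrite mxE.
exact: measurable_coord_rV.
Qed.

Section step.
Context (d : nat) (mu : {sigma_finite_measure set 'rV[R]_d -> \bar R}).

Definition lebesgue_rV_step : set 'rV[R]_d.+1 -> \bar R :=
  pushforward (@lebesgue_measure R \x mu)%E (@cons_rV d).

Let preM (A : set 'rV[R]_d.+1) : measurable A ->
  measurable (@cons_rV d @^-1` A : set (measurableTypeR R * 'rV[R]_d)).
Proof. by move=> mA; rewrite -[X in measurable X]setTI; exact: measurable_cons_rV. Qed.

Let step0 : lebesgue_rV_step set0 = 0%E.
Proof. by rewrite /lebesgue_rV_step /pushforward preimage_set0 measure0. Qed.

Let step_ge0 A : (0 <= lebesgue_rV_step A)%E.
Proof. by rewrite /lebesgue_rV_step /pushforward; apply: measure_ge0. Qed.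

Let step_sigma_additive : semi_sigma_additive lebesgue_rV_step.
Proof.
move=> F mF tF mUF; rewrite /lebesgue_rV_step /pushforward preimage_bigcup.
apply: measure_semi_sigma_additive => [n||]; first exact: preM.
- apply/trivIsetP => i j _ _ ij; rewrite -preimage_setI.
  by move/trivIsetP : tF => ->//; rewrite preimage_set0.
- by rewrite -preimage_bigcup; exact: preM.
Qed.

HB.instance Definition _ := isMeasure.Build _ _ _ lebesgue_rV_step
  step0 step_ge0 step_sigma_additive.

Let step_sigma_finite : sigma_finite setT lebesgue_rV_step.
Proof.
have /sigma_finiteP[F [TF ndF Foo]] := sigma_finiteT (@lebesgue_measure R).
have /sigma_finiteP[G [TG ndG Goo]] := sigma_finiteT mu.
exists (fun n => @uncons_rV d @^-1` (F n `*` G n)).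
  rewrite -preimage_bigcup; apply/esym/seteqP; split=> // v _ /=.
  have [n _ Fn] : (\bigcup_n F n) (uncons_rV v).1 by rewrite -TF.
  have [k _ Gk] : (\bigcup_n G n) (uncons_rV v).2 by rewrite -TG.
  exists (maxn n k) => //; split.
  - by move: Fn; exact/subsetPset/ndF/leq_maxl.
  - by move: Gk; exact/subsetPset/ndG/leq_maxr.
move=> n; have [mF Fn] := Foo n; have [mG Gn] := Goo n; split.
  rewrite -[X in measurable X]setTI; apply: measurable_uncons_rV => //.
  exact: measurableX.
rewrite /lebesgue_rV_step /pushforward (_ : _ @^-1` _ = F n `*` G n).
  by rewrite product_measure1E// lte_mul_pinfty// ge0_fin_numE.
by apply/seteqP; split=> p; rewrite /preimage /mkset cons_rVK.
Qed.

HB.instance Definition _ := Measure_isSigmaFinite.Build _ _ _ lebesgue_rV_step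
  step_sigma_finite.

End step.

Definition origin_rV0 : {sigma_finite_measure set 'rV[R]_0 -> \bar R} :=
  dirac (0 : 'rV[R]_0).

(* Built coordinate by coordinate; [lebesgue_rV_box] gives the volume of boxes,
   which characterizes Lebesgue measure. *)
Fixpoint lebesgue_rV d : {sigma_finite_measure set 'rV[R]_d -> \bar R} :=
  match d with
  | 0 => origin_rV0
  | d.+1 => lebesgue_rV_step (lebesgue_rV d)
  end.

Lemma lebesgue_rV_box d (a b : 'rV[R]_d) : (forall i, a ord0 i <= b ord0 i) ->
  lebesgue_rV d [set x | forall i, x ord0 i \in `[a ord0 i, b ord0 i]] =
  (\prod_i (b ord0 i - a ord0 i))%:E.
Proof.
elim: d a b => [|d IHd] a b ab.
  rewrite big_ord0 /= diracE mem_set// => -[] //.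
pose a' := (uncons_rV a).2; pose b' := (uncons_rV b).2.
have cons_box : @cons_rV d @^-1` [set x | forall i, x ord0 i \in `[a ord0 i, b ord0 i]] =
    `[a ord0 ord0, b ord0 ord0]%classic `*`
    [set x : 'rV[R]_d | forall i, x ord0 i \in `[a' ord0 i, b' ord0 i]].
  apply/seteqP; split=> [[t v] /= xab|[t v] /= [tab vab] i].
    split=> [|i]; first by have := xab ord0; rewrite mxE unlift_none.
    by have := xab (lift ord0 i); rewrite !mxE liftK.
  by case: (unliftP ord0 i) => [j ->|->];
    [have := vab j; rewrite !mxE liftK|rewrite mxE unlift_none].
transitivity ((@lebesgue_measure R \x lebesgue_rV d)%E
    (`[a ord0 ord0, b ord0 ord0]%classic `*`
     [set x : 'rV[R]_d | forall i, x ord0 i \in `[a' ord0 i, b' ord0 i]])).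
  by rewrite -cons_box.
rewrite product_measure1E//; last first.
  rewrite (_ : [set x | _] = \bigcap_(i in [set: 'I_d])
      ((fun x : 'rV[R]_d => x ord0 i) @^-1` `[a' ord0 i, b' ord0 i])).
    apply: fin_bigcap_measurable => // i _; rewrite -[X in measurable X]setTI.
    exact: measurable_coord_rV.
  by apply/seteqP; split=> [x xab i _|x xab i]; exact: xab.
rewrite IHd => [|i]; last by rewrite !mxE.
rewrite /= lebesgue_measure_itv /= lte_fin big_ord_recl EFinM.
congr (_ * _)%E; last by congr _%:E; apply: eq_bigr => i _; rewrite !mxE.
have [//|ba] := ltP.
have -> : a ord0 ord0 = b ord0 ord0 by apply/eqP; rewrite eq_le ab ba.
by rewrite subrr.
Qed.

End lebesgue_rV.

Section euclidean.
Context (R : realType) (d : nat).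
Implicit Types (x : 'rV[R]_d) (f : 'rV[R]_d -> R).

(* The library norm on 'rV[R]_d is the sup norm. *)
Definition enorm x : R := Num.sqrt (\sum_i x ord0 i ^+ 2).

Definition enorm_infty : set_system 'rV[R]_d :=
  filter_from [set: R] (fun M => [set x | M < enorm x]).

Definition locally_bounded f := forall x, bounded_near f (nbhs x).

Fixpoint Ck (k : nat) f : Prop :=
  continuous f /\
  if k is k'.+1 then
    forall i : 'I_d, (forall x, derivable f x (delta_mx ord0 i)) /\
      Ck k' (fun x => 'D_(delta_mx ord0 i) f x)
  else True.

Definition Cc_infty f :=
  (forall k, Ck k f) /\ compact (closure [set x | f x != 0]).

End euclidean.

(* Elements of L2 are square integrable functions, not classes: equality in
   L^2(R^d) is a.e. equality. The linearity and contractivity required of a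
   semigroup below make each P t compatible with it. *)
Notation L2 R d := (LfunType (lebesgue_rV R d) (lee1n 2)).

Section L2.
Context (R : realType) (d : nat).
Local Notation leb := (lebesgue_rV R d).
Implicit Types (f g : L2 R d) (T : L2 R d -> L2 R d).

Definition inner f g : R := \int[leb]_x (f x * g x).

Definition L2norm f : R := fine ('N[leb]_2%:E[EFin \o f])%E.

Definition L2_bounded (u : nat -> L2 R d) := exists M, forall n, L2norm (u n) <= M.

Definition L2_cvg (u : nat -> L2 R d) g := L2norm (u n - g) @[n --> \oo] --> (0 : R).

Definition compact_operator T :=
  forall u, L2_bounded u ->
    exists s : nat -> nat, increasing_seq s /\
      exists g, L2_cvg (fun n => T (u (s n))) g.

End L2.

Definition two_scale_weight (R : realType) (d : nat) (U1 U2 : 'rV[R]_d -> R)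
    (z : 'rV[R]_d * 'rV[R]_d) : R :=
  if enorm (z.1 - z.2) < 1 then U1 z.1 + U1 z.2 else U2 z.1 + U2 z.2.

Section dirichlet_form.
Context (R : realType) (d : nat) (alpha : R).
Variable W : 'rV[R]_d * 'rV[R]_d -> R.
Local Notation leb := (lebesgue_rV R d).

Definition energy (f g : 'rV[R]_d -> R) : \bar R :=
  (\int[leb \x leb]_z
     ((f z.1 - f z.2) * (g z.1 - g z.2) *
      (W z / enorm (z.1 - z.2) `^ (d%:R + alpha)))%:E)%E.

Definition form_domain : set (L2 R d) := [set f | (energy f f < +oo)%E].

Definition E1norm (f : L2 R d) : \bar R :=
  ((energy f f + ('N[leb]_2%:E[EFin \o f]) ^+ 2) `^ 2^-1)%E.

Definition form_closure : set (L2 R d) :=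
  [set f | form_domain f /\
    forall e : R, 0 < e ->
      exists phi : L2 R d, Cc_infty phi /\ (E1norm (f - phi)%R < e%:E)%E].

(* [form_operator f h] means that f is in the domain of L and L f = h, where L
   is the nonnegative self-adjoint operator of the closed form
   [(energy, form_closure)]. *)
Definition form_operator (f h : L2 R d) :=
  form_closure f /\
  forall g, form_closure g -> energy f g = (inner h g)%:E.

(* A is a relation, the graph of the (unbounded) generator of P. *)
Definition is_generator (P : R -> L2 R d -> L2 R d) (A : L2 R d -> L2 R d -> Prop) :=
  forall f h, A f h <-> L2norm (t^-1 *: (P t f - f) - h) @[t --> 0^'+] --> (0 : R).

Record markovian_semigroup (P : R -> L2 R d -> L2 R d) : Prop := MarkovianSemigroup {
  msg_linear : forall (t a : R) (f g : L2 R d), 0 <= t ->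
    P t (a *: f + g) = a *: P t f + P t g %[ae leb] ;
  msg_contraction : forall (t : R) (f : L2 R d), 0 <= t -> L2norm (P t f) <= L2norm f ;
  msg_symmetric : forall (t : R) (f g : L2 R d), 0 <= t -> inner (P t f) g = inner f (P t g) ;
  msg0 : forall f : L2 R d, P 0 f = f %[ae leb] ;
  msgD : forall (s t : R) (f : L2 R d), 0 <= s -> 0 <= t -> P (s + t) f = P s (P t f) %[ae leb] ;
  msg_continuous : forall f : L2 R d, L2norm (P t f - f) @[t --> 0^'+] --> (0 : R) ;
  msg_markovian : forall (t : R) (f : L2 R d), 0 <= t ->
    {ae leb, forall x, 0 <= f x <= 1} -> {ae leb, forall x, 0 <= P t f x <= 1} }.

(* P t = exp(- t L): the strongly continuous contraction semigroup whose
   generator is - L, which determines P for t >= 0 up to a.e. equality. *)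
Definition semigroup_of_form (P : R -> L2 R d -> L2 R d) :=
  markovian_semigroup P /\ is_generator P (fun f h => form_operator f (- h)).

Definition compact_semigroup (P : R -> L2 R d -> L2 R d) :=
  forall t, 0 < t -> compact_operator (P t).

End dirichlet_form.

(* Main.v *)
Require Import Defs.
From mathcomp Require Import all_boot all_order all_algebra.
From mathcomp Require Import all_classical all_reals all_analysis.
From mathcomp Require Import measurable_realfun ring lra.

Import Order.TTheory GRing.Theory Num.Theory.
Import numFieldNormedType.Exports.

Local Open Scope classical_set_scope.
Local Open Scope ring_scope.

Set Implicit Arguments.
Unset Strict Implicit.
Unset Printing Implicit Defensive.

(** The long jumps are harmless in both directions: compactness is decided by
    whether the weight of the short jumps outgrows [|x|^2].

    The semigroup is tied to its form by the functions [t |-> <P t f, f>], which are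
    decreasing and convex. Hence [P t f] is in the domain of the generator and its
    energy is at most [<f, f> / (2 t)] ([smoothing_energy]), and
    [|P t f - f|^2 <= t E(f, f)] for [f] in the domain of the form
    ([form_displacement_sqr]). Monotonicity and midpoint convexity take the place of
    the spectral theorem.

    For the compactness, smoothing reduces the claim to the precompactness of sets
    that are bounded in energy and in mean square. Their elements may be taken of
    bounded support, by the definition of the form domain as a closure. Far away,
    the form is tested against the increments of the convex profile
    [max (x_i^2 - r^2) 0] over pairs of close points: averages of the profile exceed
    its values, its increments are dominated by the square root of the weight, and
    the Cauchy-Schwarz inequality bounds the mass where [|x_i|] is large by a small
    multiple of the energy and the mean square ([tail_estimate]). In a large cube,
    the positive lower bound of [U1] gives a Poincare inequality on each cell of a
    fine grid ([local_estimate]). What remains are the averages over finitely many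
    cells ([energy_compactness]), and a sequence along which these functionals
    converge is Cauchy ([cauchy_subsequence]).

    If [U1] grows at most quadratically, then the energy of
    [lam^(- d / 2) f(x / lam)] stays bounded as [lam] grows, for [f] a bump supported
    away from the hyperplanes [x_i = 0]: for short jumps, the squared gradient gains
    [lam^(- 2)] against a weight of order [lam^2], and for long ones,
    [|z|^(q - d - alpha)] is integrable at infinity as [q < alpha] ([bump_energy]).
    The bumps at the scales [4^n] have disjoint supports and norms bounded below.
    For small [t] the semigroup hardly moves them, by the displacement bound, so
    that their images have no Cauchy subsequence
    ([orthogonal_bounded_energy_not_compact]). *)

(** * The inner product of square integrable functions *)

Section L2_geometry.
Context (R : realType) (d : nat).
Local Notation leb := (lebesgue_rV R d).
Implicit Types (f g h : L2 R d).

Lemma measurable_L2 f : measurable_fun [set: 'rV[R]_d] f.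
Proof. exact: measurable_funPT. Qed.

Lemma L2_mul_integrable f g : leb.-integrable setT (EFin \o (f \* g)).
Proof. by apply/Lfun1_integrable; apply: Lfun2_mul_Lfun1; exact: LfunP. Qed.

Lemma innerE f g : (inner f g)%:E = (\int[leb]_x (f x * g x)%:E)%E.
Proof.
by rewrite /inner /Rintegral fineK//; apply: integrable_fin_num => //; exact: L2_mul_integrable.
Qed.

Lemma innerC f g : inner f g = inner g f.
Proof. by apply: eq_Rintegral => x _; rewrite mulrC. Qed.

Lemma innerDl f g h : inner (f + g) h = inner f h + inner g h.
Proof.
rewrite /inner -RintegralD//;
  [|exact: (L2_mul_integrable f h)|exact: (L2_mul_integrable g h)].
by apply: eq_Rintegral => x _; rewrite mulrDl.
Qed.

Lemma innerZl a f h : inner (a *: f) h = a * inner f h.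
Proof.
rewrite /inner -RintegralZl//; last exact: (L2_mul_integrable f h).
by apply: eq_Rintegral => x _; rewrite mulrA.
Qed.

Lemma innerNl f h : inner (- f) h = - inner f h.
Proof. by rewrite -scaleN1r innerZl mulN1r. Qed.

Lemma innerBl f g h : inner (f - g) h = inner f h - inner g h.
Proof. by rewrite innerDl innerNl. Qed.

Lemma innerDr f g h : inner h (f + g) = inner h f + inner h g.
Proof. by rewrite innerC innerDl !(innerC h). Qed.

Lemma innerBr f g h : inner h (f - g) = inner h f - inner h g.
Proof. by rewrite innerC innerBl !(innerC h). Qed.

Lemma innerNr f h : inner h (- f) = - inner h f.
Proof. by rewrite innerC innerNl innerC. Qed.

Lemma innerZr a f h : inner h (a *: f) = a * inner h f.
Proof. by rewrite innerC innerZl innerC. Qed.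

Lemma inner_ge0 f : 0 <= inner f f.
Proof. by apply: Rintegral_ge0 => x _; rewrite -expr2 sqr_ge0. Qed.

Lemma L2norm_ge0 f : 0 <= L2norm f.
Proof. by apply: fine_ge0; exact: Lnorm_ge0. Qed.

Lemma L2norm_EFin f : ('N[leb]_2%:E[EFin \o f])%E = (L2norm f)%:E.
Proof. by rewrite /L2norm (finite_norm_fine f). Qed.

Lemma L2norm_sqr f : L2norm f ^+ 2 = inner f f.
Proof.
apply/EFin_inj; rewrite innerE.
have := @poweR_Lnorm _ _ _ leb (EFin \o f) 2 (ltac:(by rewrite pnatr_eq0)).
rewrite L2norm_EFin poweR_EFin powR_mulrn ?L2norm_ge0// => ->.
by apply: eq_integral => x _ /=; rewrite powR_mulrn// -normrX ger0_norm ?sqr_ge0.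
Qed.

Lemma inner_cauchy_schwarz f g : `|inner f g| <= L2norm f * L2norm g.
Proof.
rewrite -(@ler_pXn2r _ 2) ?nnegrE ?mulr_ge0 ?L2norm_ge0// exprMn !L2norm_sqr.
rewrite real_normK ?num_real//.
have := inner_ge0 f; rewrite le_eqVlt => /predU1P[f0|f0].
  (* a null vector is orthogonal to everything *)
  have q t : 0 <= inner g g + 2 * t * inner f g.
    have := inner_ge0 (g + t *: f).
    rewrite innerDl !innerDr !innerZl !innerZr (innerC g f) -f0; nra.
  rewrite -f0 mul0r; have [->|fg0] := eqVneq (inner f g) 0; first by rewrite expr0n.
  have := q (- (inner g g + 1) / (2 * inner f g)).
  have -> : 2 * (- (inner g g + 1) / (2 * inner f g)) * inner f g = - (inner g g + 1) by field.
  by have := inner_ge0 g; lra.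
have := inner_ge0 (inner f f *: g - inner f g *: f).
rewrite innerBl !innerBr !innerZl !innerZr (innerC g f) => H.
have {}H : 0 <= inner f f * (inner f f * inner g g - inner f g ^+ 2) by nra.
by move: H; rewrite pmulr_rge0// subr_ge0.
Qed.

Lemma L2normD f g : L2norm (f + g) <= L2norm f + L2norm g.
Proof. exact: ler_LnormD. Qed.

Lemma L2normN f : L2norm (- f) = L2norm f.
Proof.
apply/eqP; rewrite -(@eqrXn2 _ 2) ?L2norm_ge0//.
by rewrite !L2norm_sqr innerNl innerNr opprK.
Qed.

Lemma L2normB f g : L2norm (f - g) <= L2norm f + L2norm g.
Proof. by rewrite -(L2normN g); exact: L2normD. Qed.

Lemma L2norm_distC f g : L2norm (f - g) = L2norm (g - f).
Proof. by rewrite -L2normN opprB. Qed.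

Lemma ae_eq_inner f g h : f = g %[ae leb] -> inner f h = inner g h.
Proof.
move=> fg; apply/EFin_inj; rewrite !innerE; apply: ae_eq_integral => //.
- by apply/measurable_EFinP; apply: measurable_funM; exact: measurable_L2.
- by apply/measurable_EFinP; apply: measurable_funM; exact: measurable_L2.
- by apply: filterS fg => x /= fgx _; rewrite fgx.
Qed.

End L2_geometry.

(** * Completeness of the mean square norm *)

Section L2_completeness.
Context (R : realType) (d : nat).
Local Notation leb := (lebesgue_rV R d).
Implicit Types (f g h : L2 R d).

Lemma square_integrable_Lfun (f : 'rV[R]_d -> R) : measurable_fun setT f ->
  (\int[leb]_x (f x ^+ 2)%:E < +oo)%E -> f \in Lfun leb 2%:E.
Proof.
move=> mf f2; rewrite inE; apply/andP; split; rewrite inE//= /finite_norm.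
rewrite unlock /Lnorm poweR_lty//.
by under eq_integral => x _ do rewrite /= powR_mulrn// -normrX ger0_norm ?sqr_ge0//.
Qed.

Lemma limn_einf_le (u : (\bar R)^nat) (c : \bar R) N :
  (forall n, (N <= n)%N -> (u n <= c)%E) -> (limn_einf u <= c)%E.
Proof.
move=> uc; rewrite limn_einf_lim; apply: lime_le; first exact: is_cvg_einfs.
apply: nearW => n; apply: (@le_trans _ _ (u (maxn n N))); last exact/uc/leq_maxr.
by apply: ereal_inf_lbound; exists (maxn n N) => //=; exact: leq_maxl.
Qed.

(** The weighted series of squared increments is integrable; by AM-GM it
    dominates the series of increments up to a geometric one. *)
Lemma fast_cauchy_ae_cvg (u : nat -> L2 R d) :
  (forall n, L2norm (u n.+1 - u n) <= 2^-1 ^+ n.+1) ->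
  {ae leb, forall x, cvgn (fun n => u n x)}.
Proof.
move=> du; pose w n x := 2 ^+ n * (u n.+1 x - u n x) ^+ 2.
have w0 n x : 0 <= w n x by rewrite /w mulr_ge0 ?sqr_ge0 ?exprn_ge0.
have mw n : measurable_fun setT (fun x => (w n x)%:E).
  apply/measurable_EFinP; apply: measurable_funM => //; apply: measurable_funX.
  by apply: measurable_funB; exact: measurable_L2.
pose H x := (\sum_(0 <= n <oo) (w n x)%:E)%E.
have intw n : (\int[leb]_x (w n x)%:E <= (2^-1 ^+ n.+1)%:E)%E.
  under eq_integral do rewrite EFinM.
  rewrite ge0_integralZl//; last 2 first.
  - apply/measurable_EFinP; apply: measurable_funX.
    by apply: measurable_funB; exact: measurable_L2.
  - by move=> x _; rewrite lee_fin sqr_ge0.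
  under eq_integral do rewrite expr2.
  rewrite -(innerE (u n.+1 - u n) (u n.+1 - u n)) -L2norm_sqr -EFinM lee_fin.
  apply: (@le_trans _ _ (2 ^+ n * (2^-1 ^+ n.+1) ^+ 2)).
    by rewrite ler_wpM2l ?exprn_ge0// lerXn2r// nnegrE ?L2norm_ge0 ?exprn_ge0 ?invr_ge0.
  rewrite (_ : 2 ^+ n * _ = 2^-1 * 2^-1 ^+ n.+1); last first.
    have : 2 ^+ n * 2^-1 ^+ n = 1 :> R by rewrite -exprMn divff ?expr1n.
    rewrite (exprS _ n); move: (2 ^+ n) (2^-1 ^+ n) => a b E.
    by transitivity (2^-1 * (2^-1 * b) * (a * b)); [ring|rewrite E mulr1].
  by rewrite ler_piMl ?exprn_ge0 ?invr_ge0// invf_le1// ler1n.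
have H0 x : (0 <= H x)%E by apply: nneseries_ge0 => n _ _; rewrite lee_fin.
have Hint : leb.-integrable setT H.
  apply/integrableP; split; first by apply: ge0_emeasurable_sum => n x *; rewrite ?lee_fin.
  under eq_integral => x _ do rewrite gee0_abs//.
  rewrite integral_nneseries//; last by move=> n x _; rewrite lee_fin.
  apply: (@le_lt_trans _ _ (\sum_(0 <= n <oo) (2^-1 ^+ n.+1)%:E)%E).
    apply: lee_nneseries => [n _ _|n _]; last exact: intw.
    by apply: integral_ge0 => x _; rewrite lee_fin.
  have := @cvg_geometric_eseries_half R 1 0.
  under [X in eseries X]eq_fun do rewrite addn1 div1r natrX -exprVn.
  by move/cvg_lim => ->//; rewrite ltry.
have := integrable_ae (@measurableT _ _) Hint; apply: filterS => x /(_ I) Hx.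
have cw : cvgn (series (fun n => w n x)).
  by apply: nnseries_is_cvg => [i|]; [exact: w0|move: Hx; rewrite ge0_fin_numE//].
have cg : cvgn (series (geometric 1 (2^-1 : R))).
  by apply: is_cvg_geometric_series; rewrite ger0_norm ?invr_ge0// invf_lt1// ltr1n.
have cd : cvgn (series (fun n => `|u n.+1 x - u n x|)).
  apply: (@series_le_cvg _ _ (fun n => geometric 1 (2^-1 : R) n + w n x)) => //.
  - by move=> n; rewrite addr_ge0 ?w0// /geometric/= mul1r exprn_ge0 ?invr_ge0.
  - move=> n; rewrite /= mul1r /w -real_normK ?num_real//.
    set t := `|_|; have t0 : 0 <= t by exact: normr_ge0.
    have E : 2 ^+ n * 2^-1 ^+ n = 1 :> R by rewrite -exprMn divff ?expr1n.
    have p0 : 0 < 2 ^+ n :> R by rewrite exprn_gt0.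
    have q0 : 0 < 2^-1 ^+ n :> R by rewrite exprn_gt0.
    move: E p0 q0; set a := 2 ^+ n; set b := 2^-1 ^+ n => E p0 q0.
    have : 0 <= b * (1 - a * t + (a * t) ^+ 2) by rewrite mulr_ge0 ?ltW//; nra.
    have -> : b * (1 - a * t + (a * t) ^+ 2) = b - (a * b) * t + (a * b) * (a * t ^+ 2) by ring.
    by rewrite E; lra.
  - rewrite (_ : series _ = series (geometric 1 (2^-1 : R)) \+ series (fun n => w n x)).
      exact: is_cvgD.
    by apply/funext => n; rewrite /series/= big_split.
have : cvgn (series (telescope (fun n => u n x))) by exact: normed_cvg.
move=> ct; rewrite (_ : (fun n => u n x) = cst (u 0%N x) \+ series (telescope (fun n => u n x))).
  by apply: is_cvgD => //; exact: is_cvg_cst.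
by apply/funext => n; rewrite /= {1}(eq_sum_telescope (fun n => u n x) n).
Qed.

Definition L2_cauchy (u : nat -> L2 R d) :=
  forall e, 0 < e -> exists N, forall m n, (N <= m)%N -> (N <= n)%N -> L2norm (u m - u n) < e.

(** Riesz-Fischer: a fast subsequence converges almost everywhere, and Fatou's
    lemma turns its pointwise limit into a limit in mean square. *)
Theorem L2_complete (u : nat -> L2 R d) : L2_cauchy u -> exists g, L2_cvg u g.
Proof.
move=> cu.
have /choice[N NP] (k : nat) : exists N, forall m n, (N <= m)%N -> (N <= n)%N ->
    L2norm (u m - u n) < 2^-1 ^+ k.+1 by apply: cu; rewrite exprn_gt0.
pose s k := (k + \sum_(i < k.+1) N i)%N.
have sS k : (s k <= s k.+1)%N by rewrite /s leq_add// [leqRHS]big_ord_recr /= leq_addr.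
have Ns k : (N k <= s k)%N by rewrite /s big_ord_recr /= addnA leq_addl.
pose v k := u (s k).
have cv : {ae leb, forall x, cvgn (fun n => v n x)}.
  apply: fast_cauchy_ae_cvg => k; apply/ltW/NP => //.
  by rewrite (leq_trans (Ns k)).
pose g x := fine (limn_esup (fun n => (v n x)%:E)).
have mg : measurable_fun setT g.
  apply: (measurableT_comp (fine_measurable _)) => //.
  apply: measurable_fun_limn_esup => n; apply/measurable_EFinP; exact: measurable_L2.
have vg : {ae leb, forall x, v n x @[n --> \oo] --> g x}.
  apply: filterS cv => x cx.
  rewrite /g; have [_ ->] := cvg_limn_einf_sup
    (cvg_EFin (F := \oo) (f := fun n => (v n x)%:E) (nearW _ (fun n => erefl)) cx).
  exact: cx.
have fat (m : nat) (e : R) (M : nat) : (forall k, (M <= k)%N -> L2norm (u m - v k) <= e) ->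
    (\int[leb]_x ((u m x - g x) ^+ 2)%:E <= (e ^+ 2)%:E)%E.
  move=> me; apply: (@le_trans _ _ (\int[leb]_x limn_einf (fun k => ((u m x - v k x) ^+ 2)%:E))%E).
    rewrite le_eqVlt; apply/orP; left; apply/eqP; apply: ae_eq_integral => //.
    - apply/measurable_EFinP; apply: measurable_funX; apply: measurable_funB => //.
    - rewrite (_ : (fun x => _) = -%E \o
          (fun x => limn_esup (fun k => - ((u m x - v k x) ^+ 2)%:E)%E)); last first.
        by apply/funext => x /=; rewrite -limn_einfN; congr limn_einf; apply/funext => k; rewrite /= opprK.
      apply: measurableT_comp => //; apply: measurable_fun_limn_esup => k.
      apply: measurableT_comp => //; apply/measurable_EFinP.
      by apply: measurable_funX; apply: measurable_funB; exact: measurable_L2.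
    - apply: filterS vg => x gx _; apply/esym.
      have : ((u m x - v n x) ^+ 2)%:E @[n --> \oo] --> ((u m x - g x) ^+ 2)%:E.
        apply: cvg_EFin; first exact: nearW.
        by rewrite expr2; apply: cvgM; apply: cvgB => //; exact: cvg_cst.
      by move=> /cvg_limn_einf_sup[->].
  apply: (le_trans (fatou _ _ _ _)) => //.
  - move=> k; apply/measurable_EFinP; apply: measurable_funX.
    by apply: measurable_funB; exact: measurable_L2.
  - by move=> k x _; rewrite lee_fin sqr_ge0.
  apply: (@limn_einf_le _ _ M) => k Mk.
  under eq_integral do rewrite expr2.
  rewrite -(innerE (u m - v k) (u m - v k)) -L2norm_sqr lee_fin lerXn2r ?nnegrE ?L2norm_ge0 ?me//.
  by rewrite (le_trans (L2norm_ge0 _) (me _ Mk)).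
have gL : g \in Lfun leb 2%:E.
  have D : (fun x => u (s 0%N) x - g x) \in Lfun leb 2%:E.
    apply: square_integrable_Lfun; first by apply: measurable_funB => //; exact: measurable_L2.
    apply: (le_lt_trans (fat _ (2^-1 ^+ 1) 0%N _)); last exact: ltry.
    move=> k _; apply/ltW/NP => //.
    by rewrite (leq_trans (Ns 0%N))// /s add0n big_ord1 big_ord_recl addnCA leq_addr.
  have -> : g = (u (s 0%N) : _ -> _) \- (fun x => u (s 0%N) x - g x).
    by apply/funext => x /=; rewrite subKr.
  rewrite -[X in X \- _](Lfun_valP (lee1n 2) (LfunP (u (s 0%N)))) -[X in _ \- X](Lfun_valP (lee1n 2) D).
  exact: LfunP (Lfun_Sub (lee1n 2) (LfunP (u (s 0%N))) - Lfun_Sub (lee1n 2) D).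
exists (Lfun_Sub (lee1n 2) gL).
apply/cvgrPdist_le => e e0.
have [M MP] := cu _ e0.
exists M => // n /= Mn; rewrite sub0r normrN ger0_norm ?L2norm_ge0//.
rewrite -(@ler_pXn2r _ 2) ?nnegrE ?L2norm_ge0 ?(ltW e0)// L2norm_sqr -lee_fin innerE.
under eq_integral do rewrite -expr2.
apply: (fat n e M) => k Mk; apply/ltW/MP => //.
by rewrite (leq_trans Mk)// leq_addr.
Qed.

End L2_completeness.

(** * Decreasing midpoint convex functions *)

Section decreasing_midpoint_convex.
Context (R : realType).
Variable psi : R -> R.
Hypothesis psi_ni : forall u s, 0 <= u -> 0 <= s -> psi (u + s) <= psi u.
Hypothesis psi_mid : forall u s, 0 <= u -> 0 <= s ->
  2 * psi (u + s) <= psi u + psi (u + s + s).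

Let drop_multiples u s (k n : nat) : 0 <= u -> 0 <= s -> (k <= n)%N ->
  k%:R * (psi u - psi (u + n%:R * s)) <= n%:R * (psi u - psi (u + k%:R * s)).
Proof.
move=> u0 s0.
have step (m : nat) : m%:R * (psi (u + m%:R * s) - psi (u + m.+1%:R * s)) <=
    psi u - psi (u + m%:R * s).
  elim: m => [|m IH]; first by rewrite !mul0r addr0 subrr.
  have := @psi_mid (u + m%:R * s) s (addr_ge0 u0 (mulr_ge0 (ler0n _ _) s0)) s0.
  rewrite (_ : u + m%:R * s + s = u + m.+1%:R * s); last by rewrite -natr1; ring.
  rewrite (_ : u + m.+1%:R * s + s = u + m.+2%:R * s); last by rewrite -(natr1 m.+1); ring.
  have M0 := ler0n R m; rewrite -[X in _ -> X * _ <= _]natr1.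
  move: IH M0; move: (psi u) (psi (u + m%:R * s)) (psi (u + m.+1%:R * s)) (psi (u + m.+2%:R * s)).
  move: m%:R => M a b c e IH M0 bce.
  have : 0 <= (M + 1) * (b + e - 2 * c) by rewrite mulr_ge0 ?subr_ge0 ?addr_ge0.
  by nra.
elim: n => [|n IH]; first by rewrite leqn0 => /eqP ->; rewrite !mul0r.
rewrite leq_eqVlt => /predU1P[->//|]; rewrite ltnS => kn.
have {}IH := IH kn; have := step n.
have [n0|n0] := posnP n.
  by move: kn; rewrite n0 leqn0 => /eqP ->; rewrite !mul0r addr0 subrr mulr0.
have n0' : 0 < n%:R :> R by rewrite ltr0n.
rewrite -[X in _ -> _ <= X * _]natr1.
move=> H; rewrite -(ler_pM2l n0'); move: IH H n0' (ler0n R k).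
move: (psi u) (psi (u + n%:R * s)) (psi (u + n.+1%:R * s)) (psi (u + k%:R * s)) => a b c e.
move: n%:R k%:R => N K IH H N0 K0.
have : K * (N * (b - c)) <= K * (a - b) by rewrite ler_wpM2l.
have : N * (K * (a - b)) <= N * (N * (a - e)) by rewrite ler_wpM2l// ltW.
nra.
Qed.

(** Midpoint convexity gives the inequality along an equidistant grid;
    monotonicity, in place of continuity, closes the gap between the grid and the
    given points as the mesh tends to 0. *)
Lemma decreasing_midpoint_chord u s r : 0 <= u -> 0 < s -> s <= r ->
  s * (psi u - psi (u + r)) <= r * (psi u - psi (u + s)).
Proof.
move=> u0 s0 sr; have r0 : 0 < r by exact: lt_le_trans sr.
set D := psi u - psi (u + r).
have D0 : 0 <= D by rewrite subr_ge0 psi_ni// ltW.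
apply/ler_addgt0Pr => e e0.
pose n := (Num.truncn (r * D / e)).+1.
have n0 : 0 < n%:R :> R by rewrite ltr0n.
have rDn : r * D <= e * n%:R.
  have /andP[_ /ltW] := truncn_itv (divr_ge0 (mulr_ge0 (ltW r0) D0) (ltW e0)).
  by rewrite ler_pdivrMr// [leRHS]mulrC.
pose k := Num.truncn (s * n%:R / r).
have /andP[k1 k2] := truncn_itv (divr_ge0 (mulr_ge0 (ltW s0) (ltW n0)) (ltW r0)).
move: k1 k2; rewrite -/k ler_pdivlMr// ltr_pdivrMr// => k1 k2.
have kn : (k <= n)%N.
  by rewrite -(ler_nat R) -(ler_pM2r r0) (le_trans k1)// mulrC ler_pM2l.
have h0 : 0 <= r / n%:R by rewrite divr_ge0// ltW.
have := drop_multiples u0 h0 kn.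
rewrite (_ : n%:R * (r / n%:R) = r); last by rewrite mulrC divfK// gt_eqF.
rewrite -/D => H.
have ks : k%:R * (r / n%:R) <= s by rewrite mulrA ler_pdivrMr.
have : psi (u + s) <= psi (u + k%:R * (r / n%:R)).
  rewrite -[s in psi (u + s)](subrK (k%:R * (r / n%:R))) (addrC (s - _)) addrA.
  by apply: psi_ni; [rewrite addr_ge0// mulr_ge0|rewrite subr_ge0].
move: H; move: (psi (u + k%:R * _)) => P H sP.
rewrite -(ler_pM2r n0).
have H1 : k%:R * D * r <= n%:R * (psi u - P) * r by rewrite ler_wpM2r// ltW.
have H2 : s * n%:R * D <= k.+1%:R * r * D by rewrite ler_wpM2r// ltW.
have H3 : n%:R * r * P >= n%:R * r * psi (u + s) by rewrite ler_wpM2l// mulr_ge0 ?ltW.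
move: H1 H2 H3 rDn; rewrite -natr1; nra.
Qed.

(** Sum of the chord inequalities for the two points that divide the
    interval from [u] to [u + h + s]. *)
Lemma decreasing_midpoint_shift u h s : 0 <= u -> 0 <= h -> 0 <= s ->
  psi (u + h) - psi (u + h + s) <= psi u - psi (u + s).
Proof.
move=> u0; rewrite le_eqVlt => /predU1P[<-|h0]; first by rewrite !addr0.
rewrite le_eqVlt => /predU1P[<-|s0]; first by rewrite !addr0 !subrr.
have hs : 0 < h + s by rewrite addr_gt0.
have := @decreasing_midpoint_chord u h (h + s) u0 h0 ltac:(by rewrite lerDl ltW).
have := @decreasing_midpoint_chord u s (h + s) u0 s0 ltac:(by rewrite lerDr ltW).
rewrite addrA => A B; rewrite -(ler_pM2l hs); move: A B.
by move: (psi u) (psi (u + h)) (psi (u + s)) (psi (u + h + s)) => a b c e; nra.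
Qed.

(** The chord inequality at the middle of three points, as a bound on a later
    drop by an earlier one. *)
Lemma decreasing_midpoint_slope u r s : 0 <= u -> 0 < r -> 0 < s ->
  r * (psi (u + r) - psi (u + r + s)) <= s * (psi u - psi (u + r)).
Proof.
move=> u0 r0 s0.
have := @decreasing_midpoint_chord u r (r + s) u0 r0 ltac:(by rewrite lerDl ltW).
by rewrite addrA; move: (psi u) (psi (u + r)) (psi (u + r + s)) => a b c; nra.
Qed.

End decreasing_midpoint_convex.

(** * Smoothing by a symmetric semigroup *)

Section semigroup_smoothing.
Context (R : realType) (d : nat).
Variable P : R -> L2 R d -> L2 R d.
Hypothesis hP : markovian_semigroup P.
Implicit Types (f g h k : L2 R d) (s t u v r : R).

Lemma sg_innerB t f g h : 0 <= t ->
  inner (P t (f - g)) h = inner (P t f) h - inner (P t g) h.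
Proof.
move=> t0; have := ae_eq_inner h (msg_linear hP (-1) g f t0).
by rewrite scaleN1r addrC => ->; rewrite innerDl innerZl; ring.
Qed.

Lemma sg_inner_comp s t f g : 0 <= s -> 0 <= t ->
  inner (P s (P t f)) g = inner (P (s + t) f) g.
Proof. by move=> s0 t0; apply/esym/ae_eq_inner/(msgD hP). Qed.

Lemma sg_inner_move s t f g : 0 <= s -> 0 <= t ->
  inner (P s f) (P t g) = inner (P (s + t) f) g.
Proof. by move=> s0 t0; rewrite -(msg_symmetric hP)// sg_inner_comp// addrC. Qed.

Let phi f t := inner (P t f) f.

Let phi_shift f v t : 0 <= v -> 0 <= t -> phi (P v f) t = phi f (v + v + t).
Proof.
move=> v0 t0; rewrite /phi sg_inner_comp// sg_inner_move ?addr_ge0//.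
by rewrite addrAC (addrC t) -addrA addrAC addrA.
Qed.

Let phi0 f : phi f 0 = inner f f.
Proof. by apply: ae_eq_inner; exact: (msg0 hP). Qed.

Let phi_ge0 f t : 0 <= t -> 0 <= phi f t.
Proof.
move=> t0; have t2 : 0 <= t / 2 by rewrite divr_ge0.
by have := inner_ge0 (P (t / 2) f); rewrite sg_inner_move// -splitr.
Qed.

Let phi_le0 f t : 0 <= t -> phi f t <= inner f f.
Proof.
move=> t0; apply: le_trans (ler_norm _) _.
apply: le_trans (inner_cauchy_schwarz _ _) _.
rewrite -L2norm_sqr expr2 ler_wpM2r ?L2norm_ge0//.
exact: (msg_contraction hP).
Qed.

Let phi_half f u t : 0 <= u -> 0 <= t -> phi f (u + t) = phi (P (u / 2) f) t.
Proof. by move=> u0 t0; rewrite phi_shift ?divr_ge0// -splitr. Qed.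

Let phi_half0 f u : 0 <= u -> phi f u = inner (P (u / 2) f) (P (u / 2) f).
Proof. by move=> u0; rewrite -[u in LHS]addr0 phi_half// phi0. Qed.

Let phi_ni f u s : 0 <= u -> 0 <= s -> phi f (u + s) <= phi f u.
Proof. by move=> u0 s0; rewrite phi_half//  (phi_half0 f u0); exact: phi_le0. Qed.

Let phi_mid f u s : 0 <= u -> 0 <= s ->
  2 * phi f (u + s) <= phi f u + phi f (u + s + s).
Proof.
move=> u0 s0; rewrite -(addrA u) !(phi_half f u0) ?addr_ge0//  (phi_half0 f u0).
move: (P (u / 2) f) => g; have := inner_ge0 (g - P s g).
rewrite innerBl !innerBr sg_inner_move// -/(phi g (s + s)) -/(phi g s).
by rewrite (innerC g (P s g)) -/(phi g s); lra.
Qed.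

(* The right side minus the left one is [<k, k> - <P r k, k>] for the vector
   [k = g - P s g], where [g = P (u / 2) f]. *)
Let phi_drop_mid f r u s : 0 <= r -> 0 <= u -> 0 <= s ->
  2 * (phi f (u + s) - phi f (u + s + r)) <=
  (phi f u - phi f (u + r)) + (phi f (u + s + s) - phi f (u + s + s + r)).
Proof.
move=> r0 u0 s0; rewrite -!(addrA u) !(phi_half f u0) ?addr_ge0//  (phi_half0 f u0).
move: (P (u / 2) f) => g; have := phi_le0 (g - P s g) r0.
rewrite /phi sg_innerB// !innerBr !innerBl !sg_inner_comp// !sg_inner_move ?addr_ge0//.
rewrite (innerC g (P s g)) (addrC r s) (_ : s + r + s = s + s + r); last by ring.
by lra.
Qed.

Lemma sg_diag0 f : inner (P 0 f) f = inner f f.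
Proof. exact: phi0. Qed.

Lemma sg_diag_ge0 f t : 0 <= t -> 0 <= inner (P t f) f.
Proof. exact: phi_ge0. Qed.

Lemma sg_diag_nonincreasing f u s : 0 <= u -> 0 <= s ->
  inner (P (u + s) f) f <= inner (P u f) f.
Proof. exact: phi_ni. Qed.

Lemma sg_diag_midconvex f u s : 0 <= u -> 0 <= s ->
  2 * inner (P (u + s) f) f <= inner (P u f) f + inner (P (u + s + s) f) f.
Proof. exact: phi_mid. Qed.

Let quot f s := s^-1 *: (P s f - f).

Let quotB f g s r : 0 < s -> 0 < r ->
  inner (quot f s) (quot f r) =
  (phi f 0 - phi f s - (phi f r - phi f (s + r))) / (s * r).
Proof.
move=> s0 r0; rewrite /quot innerZl innerZr innerBl !innerBr sg_inner_move ?ltW//.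
rewrite -/(phi f (s + r)) -/(phi f s) (innerC f (P r f)) -/(phi f r) phi0.
by field; rewrite !gt_eqF.
Qed.

Section quotient_of_smoothed.
Variables (f : L2 R d) (t : R).
Hypothesis t0 : 0 < t.
Let u := t + t.
Let u0 : 0 < u. Proof. by rewrite addr_gt0. Qed.
Let G s r := inner (quot (P t f) s) (quot (P t f) r).
(* The Gram matrix [G] of the difference quotients is itself a difference quotient
   of [psi r], which is decreasing and midpoint convex again. *)
Let psi r v := phi f v - phi f (v + r).

Let GE s r : 0 < s -> 0 < r -> G s r = (psi r u - psi r (u + s)) / (s * r).
Proof.
move=> s0 r0; have [t0' s0' r0'] := And3 (ltW t0) (ltW s0) (ltW r0).
rewrite /G quotB// !phi_shift ?addr_ge0//.
by rewrite addr0 /psi /u addrA; congr (_ / _); ring.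
Qed.

Let GC s r : G s r = G r s. Proof. exact: innerC. Qed.

Let psi_ni r v s : 0 <= r -> 0 <= v -> 0 <= s -> psi r (v + s) <= psi r v.
Proof.
by move=> r0 v0 s0; exact: (decreasing_midpoint_shift (@phi_ni f) (@phi_mid f)).
Qed.

Let psi_mid r v s : 0 <= r -> 0 <= v -> 0 <= s ->
  2 * psi r (v + s) <= psi r v + psi r (v + s + s).
Proof. by move=> r0 v0 s0; exact: phi_drop_mid. Qed.

Let psi_ge0 r v : 0 <= r -> 0 <= v -> 0 <= psi r v.
Proof. by move=> r0 v0; rewrite subr_ge0 phi_ni. Qed.

Let G_mono s s' r : 0 < s -> s <= s' -> 0 < r -> G s' r <= G s r.
Proof.
move=> s0 ss' r0; have s0' : 0 < s' by exact: lt_le_trans ss'.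
rewrite !GE// ler_pdivrMr ?mulr_gt0// mulrAC ler_pdivlMr ?mulr_gt0//.
have := decreasing_midpoint_chord (fun v s => psi_ni (ltW r0) (s := s))
   (fun v s => psi_mid (ltW r0) (s := s)) (ltW u0) s0 ss'.
move: (psi r u - _) (psi r u - _) => a b H.
have := ler_wpM2r (ltW r0) H; lra.
Qed.

Let G_bounded s r : 0 < s -> 0 < r -> G s r <= inner f f / (t * t).
Proof.
move=> s0 r0; rewrite GE//.
have := decreasing_midpoint_slope (fun v s => psi_ni (ltW r0) (s := s))
   (fun v s => psi_mid (ltW r0) (s := s)) (ltW t0) t0 s0.
have := decreasing_midpoint_slope (@phi_ni f) (@phi_mid f) (lexx 0) t0 r0.
rewrite add0r -/u -/(psi r t) phi0.
have := psi_ge0 (ltW r0) (ltW u0); have := phi_ge0 f (ltW t0).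
move: (psi r (u + s)) (psi r u) (psi r t) (phi f t) (inner f f).
move=> a b c e F e0 b0 H1 H2.
rewrite ler_pdivrMr ?mulr_gt0// mulrAC ler_pdivlMr ?mulr_gt0//.
have : t * (t * (b - a)) <= t * (s * (c - b)) by rewrite ler_wpM2l// ltW.
have : s * (t * c) <= s * (r * (F - e)) by rewrite ler_wpM2l// ltW.
have : 0 <= t * s * b by apply: mulr_ge0 b0; rewrite mulr_ge0 ?ltW.
have : 0 <= s * r * e by apply: mulr_ge0 e0; rewrite mulr_ge0 ?ltW.
by nra.
Qed.

(* [G] decreases in both steps and is bounded, so its entries near [(0, 0)] are
   all close to the supremum of the diagonal, and
   [|quot s - quot r|^2 = G s s - 2 G s r + G r r] is small. *)
Let quot_cauchy e : 0 < e -> exists2 b, 0 < b & forall s r, 0 < s <= b -> 0 < r <= b ->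
  L2norm (quot (P t f) s - quot (P t f) r) < e.
Proof.
move=> e0; pose S := [set G s s | s in [set s | 0 < s]].
have S0 : has_sup S.
  split; first by exists (G 1 1), 1 => /=.
  by exists (inner f f / (t * t)) => _ [s s0 <-]; exact: G_bounded.
have e20 : 0 < e ^+ 2 / 4 by rewrite divr_gt0 ?exprn_gt0.
have [_ [b b0 <-] Gb] := sup_adherent e20 S0.
exists b => // s r.
have lt_e s' r' : 0 < s' -> s' <= r' -> r' <= b ->
    L2norm (quot (P t f) s' - quot (P t f) r') < e.
  move=> s0 sr rb; have r0 : 0 < r' by exact: lt_le_trans sr.
  rewrite -(@ltr_pXn2r _ 2) ?nnegrE ?L2norm_ge0 ?(ltW e0)// L2norm_sqr.
  rewrite innerBl !innerBr -!/(G _ _) (GC r' s').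
  have U x : 0 < x -> G x x <= sup S by move=> x0; apply: ub_le_sup; [exact: S0.2|exists x].
  have H1 : G b b <= G b r' by rewrite (GC b r') G_mono.
  have H2 : G b r' <= G s' r' by rewrite G_mono// (le_trans sr).
  move: (U _ s0) (U _ r0) H1 H2 Gb e20.
  move: (G s' s') (G r' r') (G b r') (G s' r') (G b b) (sup S) (e ^+ 2) => a1 a2 a3 a4 a5 a6 a7.
  by move=> *; lra.
move=> /andP[s0 sb] /andP[r0 rb]; have [sr|/ltW rs] := leP s r; first exact: lt_e.
by rewrite L2norm_distC; exact: lt_e.
Qed.

(** A smoothed vector [P t f] is in the domain of the generator. This is where a
    spectral calculus would be used; monotonicity of the Gram matrix of the
    difference quotients is enough. *)
Lemma smoothed_quotient_cvg : exists h,
  L2norm (s^-1 *: (P s (P t f) - P t f) - h) @[s --> 0^'+] --> 0.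
Proof.
have h0 n : 0 < n.+1%:R^-1 :> R by rewrite invr_gt0.
have [|h hP'] := @L2_complete _ _ (fun n => quot (P t f) n.+1%:R^-1).
  move=> e /quot_cauchy[b b0 qb].
  have [N NP] : exists N : nat, N.+1%:R^-1 <= b.
    exists (Num.truncn b^-1); rewrite -[leRHS]invrK lef_pV2 ?posrE ?invr_gt0//.
    by have /andP[_ /ltW] := truncn_itv (ltW (ltac:(by rewrite invr_gt0) : 0 < b^-1)).
  exists N => m n Nm Nn; apply: qb; rewrite h0/=; apply: le_trans NP;
    by rewrite lef_pV2 ?posrE// ler_nat.
exists h; apply/cvgrPdist_lt => e e0.
have e2 : 0 < e / 2 by rewrite divr_gt0.
have [b b0 qb] := quot_cauchy e2.
near=> s; rewrite sub0r normrN ger0_norm ?L2norm_ge0//.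
have : exists n : nat, n.+1%:R^-1 <= b /\ L2norm (quot (P t f) n.+1%:R^-1 - h) < e / 2.
  near \oo => n; exists n; split.
    by rewrite ltW//; near: n; exact: (near_infty_natSinv_lt (PosNum b0)).
  have : `|0 - L2norm (quot (P t f) n.+1%:R^-1 - h)| < e / 2.
    by near: n; move/cvgrPdist_lt : hP'; exact.
  by rewrite sub0r normrN ger0_norm ?L2norm_ge0.
move=> [n [nb qn]]; rewrite [e]splitr.
rewrite -[X in L2norm X](_ : (quot (P t f) s - quot (P t f) n.+1%:R^-1) +
  (quot (P t f) n.+1%:R^-1 - h) = _); last by rewrite addrA subrK.
apply: le_lt_trans (L2normD _ _) _; apply: ltrD => //.
apply: qb; last by rewrite h0.
by apply/andP; split; near: s; [exact: nbhs_right_gt|exact: nbhs_right_le].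
Unshelve. all: by end_near. Qed.

End quotient_of_smoothed.
End semigroup_smoothing.

(** * The Euclidean norm and the jump energy *)

Section enorm_facts.
Context (R : realType) (d : nat).
Implicit Types x y : 'rV[R]_d.

Lemma enorm_ge0 x : 0 <= enorm x.
Proof. exact: sqrtr_ge0. Qed.

Lemma enormN x : enorm (- x) = enorm x.
Proof. by congr Num.sqrt; apply: eq_bigr => i _; rewrite mxE sqrrN. Qed.

Lemma enorm_distC x y : enorm (x - y) = enorm (y - x).
Proof. by rewrite -enormN opprB. Qed.

Lemma ler_coord_enorm x i : `|x ord0 i| <= enorm x.
Proof.
rewrite -sqrtr_sqr ler_wsqrtr// (bigD1 i)//= lerDl sumr_ge0// => j _.
exact: sqr_ge0.
Qed.

Lemma enorm_le_bound x (r : R) : 0 <= r -> (forall i, `|x ord0 i| <= r) -> enorm x <= d%:R * r.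
Proof.
move=> r0 xr; rewrite /enorm -[leRHS]ger0_norm ?mulr_ge0// -sqrtr_sqr ler_wsqrtr//.
apply: (@le_trans _ _ (\sum_(i < d) r ^+ 2)).
  by apply: ler_sum => i _; rewrite -real_normK ?num_real// lerXn2r.
rewrite sumr_const card_ord -[leLHS]mulr_natl exprMn ler_wpM2r ?sqr_ge0//.
by rewrite -natrX ler_nat; case: (d) => // n; rewrite leq_pmulr.
Qed.

Lemma enorm_eq0 x : enorm x = 0 -> x = 0.
Proof.
move=> x0; apply/rowP => i; rewrite mxE; apply/eqP; rewrite -normr_eq0.
by apply/eqP/le_anti; rewrite normr_ge0 -x0 ler_coord_enorm.
Qed.

Lemma measurable_fst_coord i :
  measurable_fun setT (fun z : 'rV[R]_d * 'rV[R]_d => z.1 ord0 i).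
Proof.
rewrite (_ : (fun _ => _) = (fun v : 'rV[R]_d => v ord0 i) \o fst)//.
by apply: measurableT_comp => //; exact: measurable_coord_rV.
Qed.

Lemma measurable_snd_coord i :
  measurable_fun setT (fun z : 'rV[R]_d * 'rV[R]_d => z.2 ord0 i).
Proof.
rewrite (_ : (fun _ => _) = (fun v : 'rV[R]_d => v ord0 i) \o snd)//.
by apply: measurableT_comp => //; exact: measurable_coord_rV.
Qed.

Lemma measurable_enorm_sub :
  measurable_fun setT (fun z : 'rV[R]_d * 'rV[R]_d => enorm (z.1 - z.2)).
Proof.
apply: (measurableT_comp (continuous_measurable_fun (@sqrt_continuous R))).
apply: measurable_sum => i; apply: measurable_funX.
rewrite (_ : (fun _ => _) = (fun z : 'rV[R]_d * 'rV[R]_d => z.1 ord0 i - z.2 ord0 i)).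
  by apply: measurable_funB; [exact: measurable_fst_coord|exact: measurable_snd_coord].
by apply/funext => z; rewrite !mxE.
Qed.

End enorm_facts.

Section energy_facts.
Context (R : realType) (d : nat) (alpha : R).
Variable W : 'rV[R]_d * 'rV[R]_d -> R.
Hypothesis mW : measurable_fun setT W.
Hypothesis W0 : forall z, 0 <= W z.
Local Notation leb := (lebesgue_rV R d).
Local Notation energy := (@energy R d alpha W).

Definition jump_kernel (z : 'rV[R]_d * 'rV[R]_d) :=
  W z / enorm (z.1 - z.2) `^ (d%:R + alpha).
Local Notation J := jump_kernel.

Lemma jump_kernel_ge0 z : 0 <= J z.
Proof. by rewrite divr_ge0// powR_ge0. Qed.

Lemma measurable_jump_kernel : measurable_fun setT J.
Proof.
rewrite /J; under eq_fun do rewrite -powRN.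
apply: measurable_funM => //.
apply: (measurableT_comp (measurable_powR _)); exact: measurable_enorm_sub.
Qed.

Lemma measurable_increment (f : 'rV[R]_d -> R) : measurable_fun setT f ->
  measurable_fun setT (fun z : 'rV[R]_d * 'rV[R]_d => f z.1 - f z.2).
Proof.
move=> mf; apply: measurable_funB.
  exact: (measurableT_comp mf).
exact: (measurableT_comp mf).
Qed.

Lemma energy_sqE f :
  energy f f = (\int[leb \x leb]_z ((f z.1 - f z.2) ^+ 2 * J z)%:E)%E.
Proof. by apply: eq_integral => z _; rewrite expr2. Qed.

Lemma energy_ge0 f : (0 <= energy f f)%E.
Proof.
by apply: integral_ge0 => z _; rewrite lee_fin -expr2 mulr_ge0 ?sqr_ge0 ?jump_kernel_ge0.
Qed.

Lemma measurable_energy_density (f g : 'rV[R]_d -> R) :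
  measurable_fun setT f -> measurable_fun setT g ->
  measurable_fun setT (fun z => ((f z.1 - f z.2) * (g z.1 - g z.2) * J z)%:E).
Proof.
move=> mf mg; apply/measurable_EFinP; apply: measurable_funM; last exact: measurable_jump_kernel.
by apply: measurable_funM; exact: measurable_increment.
Qed.

Lemma measurable_energy_sq (f : 'rV[R]_d -> R) :
  measurable_fun setT f -> measurable_fun setT (fun z => ((f z.1 - f z.2) ^+ 2 * J z)%:E).
Proof. by move=> mf; under eq_fun do rewrite expr2; exact: measurable_energy_density. Qed.

(** Pointwise [2 a b <= a^2 + b^2]; going through the absolute value of the mixed
    density makes the bound valid for every value the mixed integral may take. *)
Lemma energy_polarization (f g : 'rV[R]_d -> R) :
  measurable_fun setT f -> measurable_fun setT g ->
  (energy f g <= 2^-1%:E * energy f f + 2^-1%:E * energy g g)%E.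
Proof.
move=> mf mg; have h0 : 0 <= 2^-1 :> R by rewrite invr_ge0.
have E0 (k : 'rV[R]_d -> R) z : (0 <= ((k z.1 - k z.2) ^+ 2 * J z)%:E)%E.
  by rewrite lee_fin mulr_ge0 ?sqr_ge0 ?jump_kernel_ge0.
rewrite !energy_sqE -!ge0_integralZl//; try exact: measurable_energy_sq.
rewrite -ge0_integralD//; last 4 first.
- by move=> z _; apply: mule_ge0; [rewrite lee_fin|exact: E0].
- by apply: measurable_funeM; exact: measurable_energy_sq.
- by move=> z _; apply: mule_ge0; [rewrite lee_fin|exact: E0].
- by apply: measurable_funeM; exact: measurable_energy_sq.
apply: le_trans (lee_abs _) _.
apply: le_trans (le_abse_integral _ _ _) _ => //; first exact: measurable_energy_density.
apply: ge0_le_integral => //.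
- by apply: measurableT_comp => //; exact: measurable_energy_density.
- by apply: emeasurable_funD; apply: measurable_funeM; exact: measurable_energy_sq.
move=> z _; rewrite -!EFinM -EFinD lee_fin normrM (ger0_norm (jump_kernel_ge0 z)).
move: (J z) (jump_kernel_ge0 z) => j j0.
rewrite !mulrA -mulrDl ler_wpM2r// ler_norml.
move: (f z.1 - f z.2) (g z.1 - g z.2) => a b.
by have := sqr_ge0 (a - b); have := sqr_ge0 (a + b) => H1 H2; apply/andP; split; nra.
Qed.

Lemma energy_parallelogram_le (f g : 'rV[R]_d -> R) :
  measurable_fun setT f -> measurable_fun setT g ->
  (energy f f <= 2%:E * energy g g + 2%:E * energy (f \- g)%R (f \- g)%R)%E.
Proof.
move=> mf mg; have E0 (k : 'rV[R]_d -> R) z : (0 <= ((k z.1 - k z.2) ^+ 2 * J z)%:E)%E.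
  by rewrite lee_fin mulr_ge0 ?sqr_ge0 ?jump_kernel_ge0.
have mfg : measurable_fun setT (f \- g) by exact: measurable_funB.
rewrite !energy_sqE -!ge0_integralZl//; try exact: measurable_energy_sq.
rewrite -ge0_integralD//; last 4 first.
- by move=> z _; apply: mule_ge0; [rewrite lee_fin|exact: E0].
- by apply: measurable_funeM; exact: measurable_energy_sq.
- by move=> z _; apply: mule_ge0; [rewrite lee_fin|exact: E0].
- by apply: measurable_funeM; exact: measurable_energy_sq.
apply: ge0_le_integral => //.
- exact: measurable_energy_sq.
- by apply: emeasurable_funD; apply: measurable_funeM; exact: measurable_energy_sq.
move=> z _; rewrite -!EFinM -EFinD lee_fin.
move: (J z) (jump_kernel_ge0 z) => j j0; rewrite !mulrA -mulrDl ler_wpM2r//=.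
by move: (f z.1) (f z.2) (g z.1) (g z.2) => a b c e; have := sqr_ge0 ((c - e) - ((a - c) - (b - e))); nra.
Qed.

End energy_facts.

(** * The semigroup and its form *)

Section E1_norm.
Context (R : realType) (d : nat) (alpha : R).
Variable W : 'rV[R]_d * 'rV[R]_d -> R.
Hypothesis W0 : forall z, 0 <= W z.
Local Notation energy := (@energy R d alpha W).
Implicit Types f g : L2 R d.

Lemma E1norm_lt_bounds f (e : R) : 0 < e -> (E1norm alpha W f < e%:E)%E ->
  (energy f f <= (e ^+ 2)%:E)%E /\ L2norm f <= e.
Proof.
move=> e0; rewrite /E1norm L2norm_EFin -EFin_expe.
set X := (_ + _)%E => Xe.
have E0 : (0 <= energy f f)%E by exact: energy_ge0.
have n0 : (0 <= (L2norm f ^+ 2)%:E)%E by rewrite lee_fin sqr_ge0.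
have X0 : (0 <= X)%E by exact: adde_ge0.
have XX : (X <= (e ^+ 2)%:E)%E.
  rewrite leNgt; apply/negP => eX; move: Xe; rewrite ltNge => /negP; apply.
  have := @gt0_ler_poweR R 2^-1 _ (e ^+ 2)%:E X.
  rewrite invr_ge0 ler0n => /(_ isT).
  rewrite !in_itv/= !leey !andbT lee_fin sqr_ge0 X0 => /(_ isT isT (ltW eX)).
  by rewrite powR12_sqrt ?sqr_ge0// sqrtr_sqr ger0_norm// ltW.
split; first by apply: le_trans XX; rewrite leeDl.
rewrite -(@ler_pXn2r _ 2) ?nnegrE ?L2norm_ge0 ?(ltW e0)// -lee_fin.
by apply: le_trans XX; rewrite leeDr.
Qed.

Lemma form_closure_Cc_infty f : Cc_infty f -> (energy f f < +oo)%E ->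
  form_closure alpha W f.
Proof.
move=> Cf Ef; split => // e e0; exists f; split => //.
rewrite subrr /E1norm (_ : 'N[_]_ _[_] = 0)%E; last first.
  rewrite (_ : EFin \o _ = cst 0%E); last by apply/funext.
  by rewrite Lnorm0// eqe pnatr_eq0.
rewrite (_ : Defs.energy alpha W _ _ = 0%E); last first.
  by apply: integral0_eq => z _; rewrite /= subr0 mul0r mul0r.
by rewrite expe2 mule0 adde0 poweR0r// invr_neq0.
Qed.

End E1_norm.

Section semigroup_and_form.
Context (R : realType) (d : nat) (alpha : R).
Variable W : 'rV[R]_d * 'rV[R]_d -> R.
Hypothesis mW : measurable_fun setT W.
Hypothesis W0 : forall z, 0 <= W z.
Variable P : R -> L2 R d -> L2 R d.
Hypothesis hPW : semigroup_of_form alpha W P.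
Local Notation energy := (@energy R d alpha W).
Implicit Types (f g h k : L2 R d) (s t u : R).

Let hP : markovian_semigroup P := hPW.1.

Lemma L2norm_cvg_inner (q : R -> L2 R d) h k :
  L2norm (q s - h) @[s --> 0^'+] --> 0 -> inner (q s) k @[s --> 0^'+] --> inner h k.
Proof.
move=> qh; apply/subr_cvg0.
have bound : (L2norm (q s - h) * L2norm k) @[s --> 0^'+] --> 0.
  by rewrite -[X in _ --> X](mul0r (L2norm k)); exact: cvgM qh (cvg_cst _).
apply/norm_cvg0P; apply: (squeeze_cvgr _ (cvg_cst 0) bound).
by apply: nearW => s; rewrite normr_ge0/= -innerBl inner_cauchy_schwarz.
Qed.

(** The derivative is kept next to the operator, so that energies of smoothed
    vectors become slopes of [t |-> <P t f, k>]. *)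
Lemma smoothing t f : 0 < t -> exists h, form_operator alpha W (P t f) h /\
  forall k, (inner (P t f) k - inner (P (t + s) f) k) / s @[s --> 0^'+] --> inner h k.
Proof.
move=> t0; have [h hh] := smoothed_quotient_cvg hP f t0.
exists (- h); split; first exact/(hPW.2 _ _).
move=> k; have := L2norm_cvg_inner (k := k) hh; rewrite innerNl => /cvgN.
apply: cvg_trans; apply: near_eq_cvg; near=> s.
have s0 : 0 < s by near: s; exact: nbhs_right_gt.
rewrite -[LHS]/(- inner (s^-1 *: (P s (P t f) - P t f)) k).
rewrite innerZl innerBl sg_inner_comp ?ltW//.
by rewrite -mulrN opprB mulrC (addrC s t).
Unshelve. all: by end_near. Qed.

Let slope_le (x : R) (F : R -> R) l : F s / s @[s --> 0^'+] --> l ->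
  (forall s, 0 < s -> F s <= x * s) -> l <= x.
Proof.
move=> Fl Fx; apply: (closed_cvg (fun y => y <= x)) Fl; first exact: closed_le.
near=> s; have s0 : 0 < s by near: s; exact: nbhs_right_gt.
by rewrite ler_pdivrMr// Fx.
Unshelve. all: by end_near. Qed.

Let slope_ge (x : R) (F : R -> R) b l : 0 < b -> F s / s @[s --> 0^'+] --> l ->
  (forall s, 0 < s -> s <= b -> x * s <= F s) -> x <= l.
Proof.
move=> b0 Fl Fx; apply: (closed_cvg (fun y => x <= y)) Fl; first exact: closed_ge.
near=> s; have s0 : 0 < s by near: s; exact: nbhs_right_gt.
by rewrite ler_pdivlMr// Fx//; near: s; exact: nbhs_right_le.
Unshelve. all: by end_near. Qed.

(** [E(P t f, P t f)] is minus the slope of the convex decreasing function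
    [s |-> <P s f, f>] at [2 t], hence at most its mean slope between 0
    and [2 t]. *)
Lemma smoothing_energy t f : 0 < t ->
  form_closure alpha W (P t f) /\
  (energy (P t f) (P t f) <= (inner f f / (t + t))%:E)%E.
Proof.
move=> t0; have [h [[Fh Eh] hk]] := smoothing f t0.
split=> //; rewrite Eh// lee_fin.
apply: slope_le (hk (P t f)) _ => // s s0.
have tt0 : 0 < t + t by rewrite addr_gt0.
rewrite !sg_inner_move ?addr_ge0 ?(ltW t0) ?(ltW s0)// (addrAC t s).
have := @decreasing_midpoint_slope _ (fun u => inner (P u f) f) (sg_diag_nonincreasing hP f)
  (sg_diag_midconvex hP f) _ _ _ (lexx 0) tt0 s0.
rewrite add0r sg_diag0// => H; rewrite mulrAC ler_pdivlMr// mulrC.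
apply: (le_trans H); rewrite [leRHS]mulrC ler_wpM2l ?(ltW s0)// gerBl.
by apply: sg_diag_ge0; rewrite ?ltW.
Qed.

(** Put [g = P s f]. Then [E(g, f)] is minus the slope of the convex function
    [s |-> <P s f, f>] at [s], and [E(g, g)] is minus its slope at [2 s], hence not
    larger. As [E(g, f) <= (E(g, g) + E(f, f)) / 2], the slope never exceeds
    [E(f, f)] in absolute value. *)
Lemma form_displacement t f (e : R) : 0 <= t -> form_closure alpha W f ->
  (energy f f <= e%:E)%E -> inner (f - P t f) f <= t * e.
Proof.
rewrite le_eqVlt => /predU1P[<-|t0] Ff Ee.
  by rewrite mul0r innerBl sg_diag0// subrr.
have ni := sg_diag_nonincreasing hP f; have mid := sg_diag_midconvex hP f.
have main s : 0 < s -> s < t -> inner (P s f) f - inner (P t f) f <= (t - s) * e.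
  move=> s0 st; have ts0 : 0 < t - s by rewrite subr_gt0.
  have [h [[Fh Eh] hk]] := smoothing f s0.
  have X1 : inner h (P s f) <= inner h f.
    have c := hk (P s f); have c' := hk f.
    apply: ler_cvg_to c c' _; near=> r.
    have r0 : 0 < r by near: r; exact: nbhs_right_gt.
    rewrite ler_wpM2r ?invr_ge0 ?(ltW r0)//.
    rewrite !sg_inner_move ?addr_ge0 ?(ltW s0) ?(ltW r0)// (addrAC s r).
    by apply: (@decreasing_midpoint_shift _ (fun u => inner (P u f) f) ni mid); exact: ltW.
  have X2 : inner h f <= e.
    have := energy_polarization alpha mW W0 (measurable_L2 (P s f)) (measurable_L2 f).
    rewrite Eh// Eh// => H.
    have : ((inner h f)%:E <= 2^-1%:E * (inner h (P s f))%:E + 2^-1%:E * e%:E)%E.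
      by apply: (le_trans H); rewrite leeD2l// lee_wpmul2l// lee_fin invr_ge0.
    by rewrite -!EFinM -EFinD lee_fin; lra.
  apply: (@le_trans _ _ ((t - s) * inner h f)); last by rewrite ler_wpM2l// ltW.
  rewrite mulrC -ler_pdivrMr//.
  apply: slope_ge (hk f) _; first exact: ts0.
  move=> r r0 rts.
  have := @decreasing_midpoint_chord _ (fun u => inner (P u f) f) ni mid _ _ _ (ltW s0) r0 rts.
  by rewrite (addrC s (t - s)) subrK mulrAC ler_pdivrMr// mulrC [leRHS]mulrC.
have e0 : 0 <= e by rewrite -lee_fin; apply: le_trans Ee; exact: energy_ge0.
have c0 := L2norm_cvg_inner (k := f) (msg_continuous hP f).
rewrite innerBl lerBlDr; apply: (closed_cvg (fun y => y <= t * e + inner (P t f) f)) c0.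
  exact: closed_le.
near=> s; have s0 : 0 < s by near: s; exact: nbhs_right_gt.
have st : s < t by near: s; exact: nbhs_right_lt.
have := main _ s0 st; have := mulr_ge0 (ltW s0) e0; lra.
Unshelve. all: by end_near. Qed.

(** The square is [<f - P t f, f>] minus the drop of [s |-> <P s f, f>] between
    [t] and [2 t]. *)
Lemma form_displacement_sqr t f (e : R) : 0 <= t -> form_closure alpha W f ->
  (energy f f <= e%:E)%E -> L2norm (P t f - f) ^+ 2 <= t * e.
Proof.
move=> t0 Ff Ee; apply: le_trans (form_displacement t0 Ff Ee).
rewrite L2norm_sqr !innerBl !innerBr sg_inner_move// (innerC f (P t f)).
by have := sg_diag_nonincreasing hP f t0 t0; lra.
Qed.

End semigroup_and_form.

(** * Extraction of Cauchy subsequences *)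

Section ultrafilter_extraction.
Context (R : realType).

Lemma ultra_bounded_near_value (G : set_system nat) (a : nat -> R) (B : R) :
  UltraFilter G -> (forall n, `|a n| <= B) ->
  exists l, forall e, 0 < e -> G [set n | `|a n - l| < e].
Proof.
move=> UG aB.
have [//|l [_ cl]] := @segment_compact R (- B) B (a @ G) _.
  by rewrite /nbhs/=; apply: filterS (@filterT _ G _) => n _ /=; rewrite in_itv/= -ler_norml.
exists l => e e0; have [//|nG] := in_ultra_setVsetC [set n | `|a n - l| < e] UG.
have [y [/= ay ly]] := cl [set y | ~ (`|y - l| < e)] (ball l e) nG (nbhsx_ballx l e e0).
by case: ay; rewrite distrC.
Qed.

Lemma diagonal_extraction (G : set_system nat) (A : nat -> set nat) :
  UltraFilter G -> \oo `<=` G -> (forall k, G (A k)) ->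
  exists s : nat -> nat, increasing_seq s /\ forall k n, (k <= n)%N -> A k (s n).
Proof.
move=> UG ooG GA; pose B k := [set n | forall j, (j <= k)%N -> A j n].
have GB k : G (B k).
  elim: k => [|k IH]; first by apply: filterS (GA 0%N) => n An j; rewrite leqn0 => /eqP ->.
  apply: filterS (filterI IH (GA k.+1)) => n [/= Bn An] j.
  by rewrite leq_eqVlt => /predU1P[->//|]; rewrite ltnS; exact: Bn.
have /choice[f fP] (kN : nat * nat) : exists n, B kN.1 n /\ (kN.2 < n)%N.
  have GN : G [set n | (kN.2 < n)%N] by apply: ooG; exists kN.2.+1.
  have [n [Bn Nn]] := filter_ex (filterI (GB kN.1) GN).
  by exists n.
pose s := fix s n := if n is m.+1 then f (n, s m) else f (0, 0)%N.
have Bs n : B n (s n).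
  by case: n => [|n]; [exact: (fP (0, 0)%N).1|exact: (fP (n.+1, s n)).1].
exists s; split; last by move=> k n kn; exact: Bs kn.
by apply/increasing_seqP => n; rewrite /= ltEnat; exact: (fP (n.+1, s n)).2.
Qed.

End ultrafilter_extraction.

Section compactness_criterion.
Context (R : realType) (d : nat).
Implicit Types (u : nat -> L2 R d) (psi : seq (L2 R d)).

(** Along an ultrafilter every bounded scalar sequence stabilizes, so finitely
    many functionals become constant up to a small error on a common large set;
    a diagonal choice through these sets is a Cauchy subsequence. *)
Lemma cauchy_subsequence u (M : R) : (forall n, L2norm (u n) <= M) ->
  (forall e, 0 < e -> exists psi (C : R), forall m n,
     L2norm (u m - u n) ^+ 2 <= e + C * \sum_(p <- psi) inner p (u m - u n) ^+ 2) ->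
  exists s : nat -> nat, increasing_seq s /\ L2_cauchy (u \o s).
Proof.
move=> uM ufin.
have [G [UG ooG]] := ultraFilterLemma (@eventually_filter).
have near_psi psi (e : R) : 0 < e ->
    exists2 A, G A & forall m n, A m -> A n -> \sum_(p <- psi) inner p (u m - u n) ^+ 2 <= e.
  elim: psi e => [|p psi IH] e e0.
    by exists setT => [|m n _ _]; [exact: filterT|rewrite big_nil ltW].
  have e2 : 0 < e / 2 by rewrite divr_gt0.
  have [A GA AP] := IH _ e2.
  have [|l lP] := @ultra_bounded_near_value R G (fun n => inner p (u n)) (L2norm p * M) UG.
    move=> n; apply: le_trans (inner_cauchy_schwarz _ _) _.
    by rewrite ler_wpM2l ?L2norm_ge0.
  pose eta := Num.min 1 (e / 8).
  have eta0 : 0 < eta by rewrite lt_min ltr01/= divr_gt0.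
  exists (A `&` [set n | `|inner p (u n) - l| < eta]); first by apply: filterI => //; exact: lP.
  move=> m n [Am lm] [An ln]; rewrite big_cons [e]splitr lerD ?AP// innerBr.
  have eta1 : eta <= 1 by rewrite ge_min lexx.
  have etae : eta <= e / 8 by rewrite ge_min lexx orbT.
  move: lm ln => /=; move: (inner p (u m)) (inner p (u n)) => a b.
  rewrite !ltr_norml => /andP[? ?] /andP[? ?].
  have : `|a - b| <= 2 * eta by rewrite ler_norml; apply/andP; split; lra.
  rewrite -real_normK ?num_real//; move: (normr_ge0 (a - b)); nra.
have cauchy_set (e : R) : 0 < e -> exists2 A, G A &
    forall m n, A m -> A n -> L2norm (u m - u n) < e.
  move=> e0; have e2 : 0 < e ^+ 2 / 4 by rewrite divr_gt0 ?exprn_gt0.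
  have [psi [C H]] := ufin _ e2.
  have C0 : 0 < `|C| + 1 by rewrite ltr_wpDl.
  have [A GA AP] := near_psi psi (e ^+ 2 / 4 / (`|C| + 1)) (divr_gt0 e2 C0).
  exists A => // m n Am An; rewrite -(@ltr_pXn2r _ 2) ?nnegrE ?L2norm_ge0 ?(ltW e0)//.
  apply: le_lt_trans (H m n) _; have := AP m n Am An.
  rewrite ler_pdivlMr//; set S := \sum_(p <- _) _ => SC.
  have S0 : 0 <= S by rewrite sumr_ge0// => p _; rewrite sqr_ge0.
  have : C * S <= (`|C| + 1) * S by rewrite ler_wpM2r// ler_wpDr// ler_norm.
  by move: SC e2; move: (e ^+ 2) => E; nra.
have /choice[A AP] (k : nat) : exists A, G A /\
    forall m n, A m -> A n -> L2norm (u m - u n) < k.+1%:R^-1.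
  by have [|A ? ?] := cauchy_set k.+1%:R^-1; [rewrite invr_gt0|exists A].
have [s [si sA]] := diagonal_extraction UG ooG (fun k => (AP k).1).
exists s; split=> // e e0.
exists (Num.truncn e^-1) => m n km kn.
have := (AP _).2 _ _ (sA _ _ km) (sA _ _ kn); move/lt_le_trans; apply.
rewrite -[leRHS]invrK lef_pV2 ?posrE ?invr_gt0//.
by have /andP[_ /ltW] := truncn_itv (ltW (ltac:(by rewrite invr_gt0) : 0 < e^-1)).
Qed.

End compactness_criterion.

(** * Boxes and point reflections *)

Section boxes.
Context (R : realType) (d : nat).
Local Notation leb := (lebesgue_rV R d).
Implicit Types a b x y : 'rV[R]_d.

Definition rV_box a b : set 'rV[R]_d := [set x | forall i, x ord0 i \in `[a ord0 i, b ord0 i]].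

Lemma measurable_rV_box a b : measurable (rV_box a b).
Proof.
rewrite (_ : rV_box a b = \bigcap_(i in [set: 'I_d])
    ((fun x : 'rV[R]_d => x ord0 i) @^-1` `[a ord0 i, b ord0 i])).
  apply: fin_bigcap_measurable => // i _; rewrite -[X in measurable X]setTI.
  exact: measurable_coord_rV.
by apply/seteqP; split=> [x xab i _|x xab i]; exact: xab.
Qed.

Definition rV_boxes : set (set 'rV[R]_d) := [set A | exists a b, A = rV_box a b].

Lemma rV_boxI : setI_closed rV_boxes.
Proof.
move=> _ _ [a [b ->]] [a' [b' ->]].
exists (\row_i Num.max (a ord0 i) (a' ord0 i)), (\row_i Num.min (b ord0 i) (b' ord0 i)).
apply/seteqP; split=> [x [xab xab'] i|x xab].
  have := xab i; have := xab' i; rewrite !in_itv/= !mxE ge_max le_min.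
  by move=> /andP[-> ->] /andP[-> ->].
by split=> i; have := xab i; rewrite !in_itv/= !mxE ge_max le_min;
  move=> /andP[/andP[? ?] /andP[? ?]]; apply/andP.
Qed.

Let cube (n : nat) := rV_box (const_mx (- n%:R)) (const_mx n%:R).

Let nat_above (I : finType) (f : I -> R) : exists n : nat, forall i, `|f i| <= n%:R.
Proof.
exists (Num.truncn (\sum_i `|f i|)).+1 => i.
apply: (@le_trans _ _ (\sum_i `|f i|)).
  by rewrite (bigD1 i)//= lerDl sumr_ge0.
by have /andP[_ /ltW] := @truncn_itv _ (\sum_i `|f i|) (sumr_ge0 _ (fun _ _ => normr_ge0 _)).
Qed.

Lemma rV_box_generate : (measurable : set (set 'rV[R]_d)) = <<s rV_boxes >>.
Proof.
apply/seteqP; split; last first.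
  apply: smallest_sub; first exact: sigma_algebra_measurable.
  by move=> _ [a [b ->]]; exact: measurable_rV_box.
pose T := g_sigma_algebraType rV_boxes.
have mid : measurable_fun [set: T] (id : T -> 'rV[R]_d).
  apply: measurable_fun_rV => i.
  apply: (measurability _ (RGenCInfty.measurableE R)) => _ [_ [r ->] <-].
  rewrite setTI (_ : _ @^-1` _ = \bigcup_n rV_box
      (\row_j if j == i then r else - n%:R) (const_mx n%:R)).
    by apply: bigcupT_measurable => n; apply: sub_sigma_algebra; eexists; eexists.
  apply/seteqP; split=> [x /= |x [n _ /(_ i)]]; last first.
    by rewrite !in_itv/= mxE eqxx => /andP[rx _]; rewrite in_itv/= rx.
  rewrite in_itv/= ?andbT => rx; have [n nP] := nat_above (fun i => x ord0 i).
  exists n => // j; have := nP j; rewrite ler_norml in_itv/= !mxE => /andP[n1 n2].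
  by apply/andP; split=> //; case: eqP => [->|].
by move=> A mA; have := mid measurableT A mA; rewrite setTI.
Qed.

(** Turns the comparison of two measures into a comparison of side lengths; used
    for the invariance under point reflections. *)
Lemma lebesgue_rV_unique (mu : {measure set 'rV[R]_d -> \bar R}) :
  (forall a b, (forall i, a ord0 i <= b ord0 i) ->
    mu (rV_box a b) = (\prod_i (b ord0 i - a ord0 i))%:E) ->
  forall A, measurable A -> leb A = mu A.
Proof.
move=> mubox A mA.
apply: (measure_unique rV_boxes cube rV_box_generate rV_boxI) => //.
- by move=> n; exists (const_mx (- n%:R)), (const_mx n%:R).
- apply/seteqP; split=> // x _; have [n nP] := nat_above (fun i => x ord0 i).
  by exists n => // i; have := nP i; rewrite ler_norml in_itv/= !mxE.
- move=> _ [a [b ->]].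
  have [/forallP ab|/forallPn[i]] := boolP [forall i, a ord0 i <= b ord0 i].
    by rewrite mubox// -lebesgue_rV_box.
  rewrite -ltNge => ba; rewrite (_ : rV_box a b = set0) ?measure0//.
  apply/seteqP; split=> // x /(_ i); rewrite in_itv/= => /andP[/le_trans H /H].
  by rewrite leNgt ba.
- move=> n; have ab i : (const_mx (- n%:R) : 'rV[R]_d) ord0 i <= (const_mx n%:R : 'rV[R]_d) ord0 i.
    by rewrite !mxE; have := ler0n R n; lra.
  by apply: le_lt_trans (ltry _); rewrite le_eqVlt; apply/orP; left; apply/eqP; exact: lebesgue_rV_box ab.
Qed.

Definition reflection (c x : 'rV[R]_d) := c - x.

Lemma measurable_reflection c : measurable_fun setT (reflection c).
Proof.
apply: measurable_fun_rV => i; rewrite (_ : (fun _ => _) = (fun x => c ord0 i - x ord0 i)).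
  by apply: measurable_funB => //; exact: measurable_coord_rV.
by apply/funext => x; rewrite !mxE.
Qed.

Lemma lebesgue_rV_reflection c A : measurable A -> leb A = leb (reflection c @^-1` A).
Proof.
move=> mA; apply: (@lebesgue_rV_unique (pushforward leb (reflection c))) => //.
  exact: measurable_reflection.
move=> mr a b ab.
rewrite /= /pushforward (_ : _ @^-1` _ = rV_box (c - b) (c - a)).
  rewrite /rV_box lebesgue_rV_box => [|i]; last by rewrite !mxE lerB.
  by congr _%:E; apply: eq_bigr => i _; rewrite !mxE; ring.
apply/seteqP; split=> x xab i; have := xab i; rewrite !in_itv/= !mxE => /andP[? ?];
  apply/andP; split; lra.
Qed.

Lemma integral_reflection c (D : set 'rV[R]_d) (f : 'rV[R]_d -> \bar R) : measurable D ->
  measurable_fun D f -> (forall x, D x -> (0 <= f x)%E) ->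
  (\int[leb]_(x in D) f x = \int[leb]_(x in reflection c @^-1` D) f (c - x)%R)%E.
Proof.
move=> mD mf f0; rewrite -(ge0_integral_pushforward (measurable_reflection c))//; last first.
  by move=> x /set_mem; exact: f0.
apply: eq_measure_integral => [|mr A mA _]; first exact: measurable_reflection.
exact: lebesgue_rV_reflection.
Qed.

End boxes.

(** * Averages over boxes *)

Section product_integrals.
Context (R : realType) (d : nat).
Local Notation leb := (lebesgue_rV R d).
Local Notation V := 'rV[R]_d.

Lemma integral_swap (F : V * V -> \bar R) : measurable_fun setT F -> (forall z, 0 <= F z)%E ->
  (\int[leb \x leb]_z F (z.2, z.1) = \int[leb \x leb]_z F z)%E.
Proof.
move=> mF F0; rewrite fubini_tonelli1//; last first.
  by apply: (measurableT_comp mF); exact: measurable_fun_pair.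
by rewrite fubini_tonelli2.
Qed.

Lemma integral_mul_indic (D : set V) (g : V -> R) : measurable D ->
  (\int[leb]_x (g x * \1_D x)%:E = \int[leb]_(x in D) (g x)%:E)%E.
Proof.
move=> mD; rewrite [RHS]integral_mkcond; apply: eq_integral => x _.
by rewrite /patch indicE; case: ifPn => xD; rewrite ?mulr1 ?mulr0.
Qed.

End product_integrals.

Section box_averages.
Context (R : realType) (d : nat) (i : 'I_d) (r rho : R).
Hypotheses (r0 : 0 <= r) (rho0 : 0 < rho).
Local Notation leb := (lebesgue_rV R d).
Local Notation V := 'rV[R]_d.
Implicit Types x y : V.

Definition box_around x : set V := rV_box (x - const_mx rho) (x + const_mx rho).

Lemma box_aroundP x y : box_around x y <-> forall j, `|x ord0 j - y ord0 j| <= rho.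
Proof.
split=> H j; have := H j; rewrite in_itv/= !mxE ler_norml => /andP[? ?]; apply/andP; split; lra.
Qed.

Lemma measurable_box_around x : measurable (box_around x).
Proof. exact: measurable_rV_box. Qed.

Lemma lebesgue_box_around x : leb (box_around x) = ((2 * rho) ^+ d)%:E.
Proof.
transitivity (\prod_(j < d) ((x + const_mx rho) ord0 j - (x - const_mx rho) ord0 j))%:E.
  by apply: lebesgue_rV_box => j; rewrite !mxE; move: rho0; lra.
congr _%:E; rewrite (eq_bigr (fun=> 2 * rho)); first by rewrite prodr_const card_ord.
by move=> j _; rewrite !mxE; ring.
Qed.

(** Convex, of quadratic growth, and constant between [- r] and [r], where no
    quadratic lower bound on the weight is at hand. *)
Definition tail_profile (s : R) : R := Num.max (s ^+ 2 - r ^+ 2) 0.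
Local Notation h := tail_profile.

Definition tail_set : set V := [set x | r + rho <= `|x ord0 i|].

Lemma tail_profile_ge0 s : 0 <= h s.
Proof. by rewrite le_max lexx orbT. Qed.

Lemma measurable_tail_profile : measurable_fun setT h.
Proof. by apply: measurable_maxr => //; apply: measurable_funB => //; exact: measurable_funX. Qed.

(** The second difference of a convex function is nonnegative; for the square it
    is known exactly, and this gives the gain on the tail. *)
Lemma tail_profile_convex x y : box_around x y ->
  2 * h (x ord0 i) + 2 * \1_tail_set x * (y ord0 i - x ord0 i) ^+ 2 <=
  h (y ord0 i) + h (2 * x ord0 i - y ord0 i).
Proof.
have -> : \1_tail_set x = ((r + rho <= `|x ord0 i|)%R : nat)%:R :> R.
  by rewrite indicE; congr ((nat_of_bool _)%:R); apply/idP/idP; rewrite inE.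
move=> /box_aroundP/(_ i); move: (x ord0 i) (y ord0 i) => s t.
rewrite ler_norml => /andP[st1 st2].
have ht : t ^+ 2 - r ^+ 2 <= h t by rewrite le_max lexx.
have ht' : (2 * s - t) ^+ 2 - r ^+ 2 <= h (2 * s - t) by rewrite le_max lexx.
have t0 := tail_profile_ge0 t; have t0' := tail_profile_ge0 (2 * s - t).
have sq := sqr_ge0 (t - s).
have [rs|_] := leP (r + rho) `|s|; last first.
  rewrite /= mulr0 mul0r addr0.
  have [->|->] : h s = s ^+ 2 - r ^+ 2 \/ h s = 0; last by lra.
    by rewrite /h; case: (leP (s ^+ 2 - r ^+ 2) 0); [right|left].
  by nra.
have -> : h s = s ^+ 2 - r ^+ 2.
  apply/max_idPl; rewrite subr_ge0 -[leRHS]real_normK ?num_real// lerXn2r ?nnegrE//.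
  by apply: le_trans rs; rewrite lerDl ltW.
rewrite /= mulr1; nra.
Qed.

Lemma measurable_tail_set : measurable tail_set.
Proof.
rewrite (_ : tail_set = (fun x : V => `|x ord0 i|) @^-1` `[r + rho, +oo[).
  rewrite -[X in measurable X]setTI.
  have m : measurable_fun setT (fun x : V => `|x ord0 i|).
    by apply: measurableT_comp => //; exact: measurable_coord_rV.
  by apply: m.
by apply/seteqP; split=> x; rewrite /tail_set/= in_itv/= andbT.
Qed.

(** The average over a symmetric box of a convex function dominates its centre
    value; reflecting the box in its centre makes this a pointwise inequality. *)
Lemma box_average_profile x :
  (((2 * rho) ^+ d * h (x ord0 i) + (rho / 2) ^+ d.+2 * \1_tail_set x)%:E <=
   \int[leb]_(y in box_around x) (h (y ord0 i))%:E)%E.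
Proof.
set S := (\int[_]_(_ in _) _)%E.
have mh : measurable_fun (box_around x) (fun y : V => (h (y ord0 i))%:E).
  apply/measurable_EFinP; apply: measurable_funTS.
  by apply: (measurableT_comp measurable_tail_profile); exact: measurable_coord_rV.
have mh' : measurable_fun (box_around x) (fun y : V => (h (2 * x ord0 i - y ord0 i))%:E).
  apply/measurable_EFinP; apply: measurable_funTS.
  apply: (measurableT_comp measurable_tail_profile); apply: measurable_funB => //.
  exact: measurable_coord_rV.
have S' : S = (\int[leb]_(y in box_around x) (h (2 * x ord0 i - y ord0 i))%:E)%E.
  rewrite /S (integral_reflection (x + x)) //; last 2 first.
  - exact: measurable_box_around.
  - by move=> y _; rewrite lee_fin tail_profile_ge0.
  rewrite (_ : _ @^-1` _ = box_around x).
    by apply: eq_integral => y _; rewrite !mxE mulrDl mul1r.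
  apply/seteqP; split=> y /box_aroundP xy; apply/box_aroundP => j; have := xy j;
    by rewrite /reflection !mxE -normrN; congr (`|_| <= _); ring.
(* on this corner of the box, [y_i - x_i] is at least [rho / 2] *)
pose sub := rV_box (x + const_mx (rho / 2)) (x + const_mx rho).
have sub_around : sub `<=` box_around x.
  move=> y ys; apply/box_aroundP => j; have := ys j.
  by rewrite in_itv/= !mxE ler_norml => /andP[? ?]; apply/andP; split; move: rho0; lra.
have msub : measurable sub by exact: measurable_rV_box.
have lsub : leb sub = ((rho / 2) ^+ d)%:E.
  transitivity (\prod_(j < d) ((x + const_mx rho) ord0 j - (x + const_mx (rho / 2)) ord0 j))%:E.
    by apply: lebesgue_rV_box => j; rewrite !mxE; move: rho0; lra.
  congr _%:E; rewrite (eq_bigr (fun=> rho / 2)); first by rewrite prodr_const card_ord.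
  by move=> j _; rewrite !mxE; lra.
pose t := \1_tail_set x * (rho / 2) ^+ 2.
have t0 : 0 <= t by rewrite mulr_ge0 ?sqr_ge0.
have mB := measurable_box_around x.
have SS : ((2 * h (x ord0 i) * (2 * rho) ^+ d + 2 * t * (rho / 2) ^+ d)%:E <= S + S)%E.
  rewrite (_ : S + S = \int[leb]_(y in box_around x) (h (y ord0 i))%:E +
      \int[leb]_(y in box_around x) (h (2 * x ord0 i - y ord0 i))%:E)%E; last by rewrite -S'.
  rewrite -ge0_integralD//; last 2 first.
  - by move=> y _; rewrite lee_fin tail_profile_ge0.
  - by move=> y _; rewrite lee_fin tail_profile_ge0.
  have -> : ((2 * h (x ord0 i) * (2 * rho) ^+ d + 2 * t * (rho / 2) ^+ d)%:E =
      \int[leb]_(y in box_around x) ((2 * h (x ord0 i))%:E + (2 * t)%:E * (\1_sub y)%:E))%E.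
    rewrite ge0_integralD//; last 3 first.
    - by move=> y _; rewrite lee_fin mulr_ge0 ?tail_profile_ge0.
    - by move=> y _; rewrite -EFinM lee_fin; apply: mulr_ge0; [exact: mulr_ge0|rewrite indicE].
    - apply: measurable_funeM; apply/measurable_EFinP; exact: measurable_indic.
    rewrite integral_cst// ge0_integralZl//; last 2 first.
    - apply/measurable_EFinP; exact: measurable_indic.
    - by rewrite lee_fin mulr_ge0.
    rewrite integral_indic// (_ : sub `&` _ = sub); last exact/setIidPl.
    by rewrite [X in (_ * X + _)%E]lebesgue_box_around [X in (_ + _ * X)%E]lsub -!EFinM -EFinD.
  apply: ge0_le_integral => //.
  - move=> y _; apply: adde_ge0; first by rewrite lee_fin mulr_ge0 ?tail_profile_ge0.
    by rewrite -EFinM lee_fin; apply: mulr_ge0; [exact: mulr_ge0|rewrite indicE].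
  - apply: emeasurable_funD => //; apply: measurable_funeM; apply/measurable_EFinP.
    exact: measurable_indic.
  - exact: emeasurable_funD.
  move=> y By; rewrite -EFinM -!EFinD lee_fin; apply: le_trans (tail_profile_convex By).
  have T0 : 0 <= \1_tail_set x :> R by rewrite indicE.
  rewrite lerD2l /t -!mulrA ler_wpM2l// ler_wpM2l// indicE.
  case: (boolP (y \in sub)) => [|_]; rewrite ?mulr0 ?sqr_ge0// mulr1 inE => /(_ i).
  by rewrite in_itv/= !mxE => /andP[? ?]; move: rho0; nra.
move: SS; clear S'; case: S => [s| |]; rewrite ?leey// -EFinD !lee_fin.
rewrite (_ : (rho / 2) ^+ d.+2 = (rho / 2) ^+ 2 * (rho / 2) ^+ d); last by rewrite !exprS; ring.
by rewrite /t => H; lra.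
Qed.

End box_averages.

Section box_graph.
Context (R : realType) (d : nat).
Local Notation V := 'rV[R]_d.

Lemma measurable_box_graph (r : R) : measurable [set z : V * V | box_around r z.1 z.2].
Proof.
rewrite (_ : [set z | _] = \bigcap_(j in [set: 'I_d])
    ((fun z : V * V => z.1 ord0 j - z.2 ord0 j) @^-1` `[- r, r])).
  apply: fin_bigcap_measurable => // j _; rewrite -[X in measurable X]setTI.
  have m : measurable_fun setT (fun z : V * V => z.1 ord0 j - z.2 ord0 j).
    by apply: measurable_funB; [exact: measurable_fst_coord|exact: measurable_snd_coord].
  exact: m.
apply/seteqP; split=> [z /box_aroundP zD j _|z zD]; first by rewrite /= in_itv/= -ler_norml.
by apply/box_aroundP => j; have := zD j I; rewrite /= in_itv/= -ler_norml.
Qed.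

End box_graph.

(** * Mass far away from the origin *)

Section tail_estimate.
Context (R : realType) (d : nat) (alpha : R).
Variable W : 'rV[R]_d * 'rV[R]_d -> R.
Hypothesis mW : measurable_fun setT W.
Hypothesis W0 : forall z, 0 <= W z.
Hypothesis alpha0 : 0 < alpha.
Local Notation leb := (lebesgue_rV R d).
Local Notation V := 'rV[R]_d.
Local Notation J := (jump_kernel alpha W).
Local Notation energy := (@energy R d alpha W).

Lemma W_le_jump_kernel x y : x != y -> enorm (x - y) < 1 -> W (x, y) <= J (x, y).
Proof.
move=> xy xy1; rewrite /jump_kernel/= ler_pdivlMr.
  rewrite ler_piMr//.
  have E : 1 `^ (d%:R + alpha) = 1 :> R by rewrite powR1.
  rewrite -[leRHS]E.
  by rewrite ge0_ler_powR ?nnegrE ?enorm_ge0 ?(ltW xy1)// addr_ge0// ltW.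
apply: powR_gt0; rewrite lt_neqAle enorm_ge0 andbT eq_sym.
by apply: contra xy => /eqP/enorm_eq0/eqP; rewrite subr_eq0.
Qed.

Definition bounded_support (f : V -> R) :=
  exists B, forall x, f x != 0 -> forall j, `|x ord0 j| <= B.

Section coordinate_tail.
Variables (i : 'I_d) (r rho mu : R).
Hypotheses (r0 : 0 <= r) (rho0 : 0 < rho) (drho : d%:R * rho < 1) (mu0 : 0 <= mu).
Hypothesis Wquad : forall x y : V, enorm (x - y) < 1 -> r < `|x ord0 i| ->
  (mu * x ord0 i) ^+ 2 <= W (x, y) /\ (mu * x ord0 i) ^+ 2 <= W (y, x).
Local Notation h := (tail_profile r).
Local Notation box := (box_around rho).

Lemma box_enorm_lt1 (x y : V) : box x y -> enorm (x - y) < 1.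
Proof.
move/box_aroundP => xy; apply: le_lt_trans drho; apply: enorm_le_bound; first exact: ltW.
by move=> j; rewrite !mxE.
Qed.

Lemma tail_profile_increment_le s t : `|s| <= `|t| ->
  0 <= h t - h s <= t ^+ 2 - s ^+ 2.
Proof.
rewrite -(@ler_pXn2r _ 2) ?nnegrE// !real_normK ?num_real// /tail_profile => st.
by case: (leP (t ^+ 2 - r ^+ 2) 0); case: (leP (s ^+ 2 - r ^+ 2) 0) => ? ?;
  apply/andP; split; lra.
Qed.

(** Over a jump shorter than 1 the profile changes by at most twice the larger of
    the two coordinates, and the weight dominates its square. The factor [mu] is
    at one's disposal because the weight grows faster than quadratically. *)
Lemma tail_profile_increment_kernel (x y : V) : box x y ->
  (mu * (h (y ord0 i) - h (x ord0 i))) ^+ 2 <= 4 * J (x, y).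
Proof.
move=> xy; have xy1 := box_enorm_lt1 xy.
have [->|nxy] := eqVneq x y.
  by rewrite subrr mulr0 expr0n mulr_ge0//; exact: jump_kernel_ge0.
apply: (@le_trans _ _ (4 * W (x, y))); last by rewrite ler_pM2l// W_le_jump_kernel.
have c1 : `|x ord0 i - y ord0 i| <= 1.
  by apply/ltW/(le_lt_trans _ xy1); have := ler_coord_enorm (x - y) i; rewrite !mxE.
have h0 s : `|s| <= r -> h s = 0.
  rewrite -(@ler_pXn2r _ 2) ?nnegrE// real_normK ?num_real// => sr.
  by apply/max_idPr; rewrite subr_le0.
suff key (s t : R) : `|s| <= `|t| -> `|s - t| <= 1 -> (r < `|t| -> (mu * t) ^+ 2 <= W (x, y)) ->
    (mu * (h t - h s)) ^+ 2 <= 4 * W (x, y).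
  have [yx|/ltW xy'] := leP `|x ord0 i| `|y ord0 i|.
    by apply: key => // ry; apply: (@Wquad y x _ ry).2; rewrite enorm_distC.
  rewrite -sqrrN -mulrN opprB; apply: key => //; first by rewrite distrC.
  by move=> rx; exact: (Wquad xy1 rx).1.
move=> st st1 Wt; have [tr|/Wt {}Wt] := leP `|t| r.
  by rewrite !h0// ?(le_trans st)// subrr mulr0 expr0n mulr_ge0.
have /andP[k0 k1] := tail_profile_increment_le st.
have k2 : (h t - h s) ^+ 2 <= 4 * t ^+ 2.
  apply: (@le_trans _ _ ((t ^+ 2 - s ^+ 2) ^+ 2)); first by rewrite lerXn2r ?nnegrE// (le_trans k0).
  have -> : (t ^+ 2 - s ^+ 2) ^+ 2 = (s - t) ^+ 2 * (t + s) ^+ 2 by ring.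
  have a1 : (s - t) ^+ 2 <= 1 by rewrite -real_normK ?num_real// expr_le1.
  have a2 : (t + s) ^+ 2 <= 4 * t ^+ 2.
    have : s ^+ 2 <= t ^+ 2.
      by rewrite -[leLHS]real_normK ?num_real// -[leRHS]real_normK ?num_real// lerXn2r ?nnegrE.
    by have := sqr_ge0 (t - s); nra.
  by have := sqr_ge0 (s - t); have := sqr_ge0 (t + s); nra.
rewrite exprMn; move: Wt; rewrite exprMn; have := sqr_ge0 mu; nra.
Qed.

Let D : set (V * V) := [set z | box z.1 z.2].

Let mD : measurable D. Proof. exact: measurable_box_graph. Qed.

Let indicD (x y : V) : \1_D (x, y) = \1_(box x) y :> R.
Proof. by rewrite !indicE; congr ((nat_of_bool _)%:R); apply/idP/idP; rewrite !inE. Qed.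

Let indicD_sym z : \1_D (z.2, z.1) = \1_D z :> R.
Proof.
rewrite !indicE; congr ((nat_of_bool _)%:R).
by apply/idP/idP; rewrite !inE /D/= => /box_aroundP zD; apply/box_aroundP => j; rewrite distrC.
Qed.

(** With [a], [b] the values of [f] and [k] the increment of the profile, the
    inequality between arithmetic and geometric means is applied to
    [(a^2 - b^2) mu k = ((a - b) mu k) (a + b)]. *)
Lemma tail_pointwise (f : V -> R) (z : V * V) :
  mu * (f z.1 ^+ 2 * h (z.2 ord0 i) * \1_D z + f z.2 ^+ 2 * h (z.1 ord0 i) * \1_D z) <=
  mu * (f z.1 ^+ 2 * h (z.1 ord0 i) * \1_D z + f z.2 ^+ 2 * h (z.2 ord0 i) * \1_D z) +
  ((f z.1 - f z.2) ^+ 2 * J z + 2 * (f z.1 ^+ 2 * \1_D z + f z.2 ^+ 2 * \1_D z)).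
Proof.
have J0 := jump_kernel_ge0 alpha W0 z.
rewrite indicE; case: (boolP (z \in D)) => [|_] /=; last first.
  by rewrite !mulr0 !addr0 !mulr0 addr0 add0r mulr_ge0 ?sqr_ge0.
rewrite inE => zD; have := tail_profile_increment_kernel zD; rewrite -surjective_pairing.
move: J0; move: (J z) (f z.1) (f z.2) (h _) (h _) => j a b h1 h2 j0 H.
rewrite !mulr1 -subr_ge0.
set m := mu * (h2 - h1) in H *.
have ineq : (a ^+ 2 - b ^+ 2) * m <= (a - b) ^+ 2 * j + (a + b) ^+ 2.
  have H1 : (a - b) ^+ 2 * m ^+ 2 <= (a - b) ^+ 2 * (4 * j) by apply: ler_wpM2l H; exact: sqr_ge0.
  by have := sqr_ge0 ((a - b) * m / 2 - (a + b)); lra.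
by have := sqr_ge0 (a - b); rewrite /m in ineq; lra.
Qed.

Section integrated.
Variable f : L2 R d.
Hypothesis fB : bounded_support f.

Let mf2 : measurable_fun setT (fun x => f x ^+ 2).
Proof. by apply: measurable_funX; exact: measurable_L2. Qed.

Let mh : measurable_fun setT (fun x : V => h (x ord0 i)).
Proof. by apply: (measurableT_comp (measurable_tail_profile r)); exact: measurable_coord_rV. Qed.

Let mf21 : measurable_fun setT (fun z : V * V => f z.1 ^+ 2).
Proof. exact: (measurableT_comp mf2 measurable_fst). Qed.

Let mD1 : measurable_fun setT (\1_D : V * V -> R).
Proof. exact: measurable_indic. Qed.

Let F (z : V * V) := (f z.1 ^+ 2 * h (z.2 ord0 i) * \1_D z)%:E.
Let G (z : V * V) := (f z.1 ^+ 2 * h (z.1 ord0 i) * \1_D z)%:E.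
Let N (z : V * V) := (f z.1 ^+ 2 * \1_D z)%:E.

Let mF : measurable_fun setT F.
Proof.
apply/measurable_EFinP; apply: measurable_funM => //; apply: measurable_funM => //.
exact: (measurableT_comp mh measurable_snd).
Qed.

Let mG : measurable_fun setT G.
Proof.
apply/measurable_EFinP; apply: measurable_funM => //; apply: measurable_funM => //.
exact: (measurableT_comp mh measurable_fst).
Qed.

Let mN : measurable_fun setT N.
Proof. by apply/measurable_EFinP; apply: measurable_funM. Qed.

Let indic_ge0 (T : Type) (A : set T) (x : T) : 0 <= \1_A x :> R.
Proof. by rewrite indicE. Qed.

Let F0 z : (0 <= F z)%E.
Proof.
rewrite lee_fin; apply: mulr_ge0 => //; apply: mulr_ge0; first exact: sqr_ge0.
exact: tail_profile_ge0.
Qed.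

Let G0 z : (0 <= G z)%E.
Proof.
rewrite lee_fin; apply: mulr_ge0 => //; apply: mulr_ge0; first exact: sqr_ge0.
exact: tail_profile_ge0.
Qed.

Let N0 z : (0 <= N z)%E.
Proof. by rewrite lee_fin; apply: mulr_ge0 => //; exact: sqr_ge0. Qed.

Let vol := (2 * rho) ^+ d.
Let vol0 : 0 <= vol. Proof. by rewrite exprn_ge0// mulr_ge0// ltW. Qed.

Let box_integral (g : V -> R) x : measurable_fun setT g -> (forall y, 0 <= g y) ->
  (\int[leb]_y (f x ^+ 2 * g y * \1_D (x, y))%:E =
   (f x ^+ 2)%:E * \int[leb]_(y in box x) (g y)%:E)%E.
Proof.
move=> mg g0; rewrite -integral_mul_indic; last exact: measurable_box_around.
rewrite -ge0_integralZl//; last 3 first.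
- apply/measurable_EFinP; apply: measurable_funM => //; apply: measurable_indic.
  exact: measurable_box_around.
- by move=> y _; rewrite lee_fin mulr_ge0.
- by rewrite lee_fin sqr_ge0.
by apply: eq_integral => y _; rewrite indicD -EFinM mulrA.
Qed.

Let integralG : (\int[leb \x leb]_z G z = \int[leb]_x (vol * (f x ^+ 2 * h (x ord0 i)))%:E)%E.
Proof.
rewrite fubini_tonelli1//; apply: eq_integral => x _.
rewrite /fubini_F /G/= (box_integral (g := cst (h (x ord0 i))))//; last first.
  by move=> y; exact: tail_profile_ge0.
rewrite [X in (_ * X)%E](integral_cst leb (measurable_box_around rho x) (h (x ord0 i))%:E).
by rewrite [X in (_ * (_ * X))%E]lebesgue_box_around// -!EFinM mulrA mulrC.
Qed.

Let integralN : (\int[leb \x leb]_z N z = (vol * inner f f)%:E)%E.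
Proof.
rewrite EFinM innerE -ge0_integralZl//; last 2 first.
- by apply/measurable_EFinP; exact: mf2.
- by move=> x _; rewrite lee_fin -expr2 sqr_ge0.
rewrite fubini_tonelli1//; apply: eq_integral => x _.
rewrite /fubini_F /N/=; under eq_integral do rewrite -[f x ^+ 2]mulr1.
rewrite (box_integral (g := cst 1))//.
rewrite [X in (_ * X)%E](integral_cst leb (measurable_box_around rho x) 1%:E).
by rewrite [X in (_ * (_ * X))%E]lebesgue_box_around// mul1e muleC expr2.
Qed.

(* Bounded support makes this integral finite, so that it can be cancelled. *)
Let finiteG : (\int[leb \x leb]_z G z)%E \is a fin_num.
Proof.
have [B fB'] := fB.
rewrite ge0_fin_numE; last exact: integral_ge0.
apply: (@le_lt_trans _ _ ((B ^+ 2 + r ^+ 2)%:E * (vol * inner f f)%:E)%E); last first.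
  by rewrite -EFinM ltry.
rewrite -integralN -ge0_integralZl//; last by rewrite lee_fin addr_ge0 ?sqr_ge0.
apply: ge0_le_integral => //; first by apply: measurable_funeM.
move=> z _; rewrite -EFinM lee_fin mulrA ler_wpM2r// mulrC.
have [->|fz] := eqVneq (f z.1) 0; first by rewrite expr0n !mulr0.
rewrite ler_wpM2r ?sqr_ge0// /tail_profile ge_max addr_ge0 ?sqr_ge0// andbT.
have := fB' _ fz i => zB.
have : (z.1 ord0 i) ^+ 2 <= B ^+ 2.
  by rewrite -[leLHS]real_normK ?num_real// lerXn2r ?nnegrE// (le_trans (normr_ge0 _) zB).
by have := sqr_ge0 r; lra.
Qed.

Local Notation tail := (tail_set i r rho).
Let c := (rho / 2) ^+ d.+2.
Let c0 : 0 <= c. Proof. by rewrite exprn_ge0// divr_ge0// ltW. Qed.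

Let lowerF : (\int[leb \x leb]_z G z + c%:E * \int[leb]_(x in tail) (f x ^+ 2)%:E <=
  \int[leb \x leb]_z F z)%E.
Proof.
have mt := measurable_tail_set i r rho.
rewrite integralG -(integral_mul_indic (fun x => f x ^+ 2) mt) -ge0_integralZl//; last 2 first.
- by apply/measurable_EFinP; apply: measurable_funM; [exact: mf2|exact: measurable_indic].
- by move=> x _; rewrite lee_fin mulr_ge0 ?sqr_ge0.
have p0 (x : V) : (0 <= (vol * (f x ^+ 2 * h (x ord0 i)))%:E)%E.
  by rewrite lee_fin mulr_ge0// mulr_ge0 ?sqr_ge0 ?tail_profile_ge0.
have q0 (x : V) : (0 <= c%:E * (f x ^+ 2 * \1_tail x)%:E)%E.
  by rewrite -EFinM lee_fin mulr_ge0// mulr_ge0 ?sqr_ge0.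
have mp : measurable_fun setT (fun x : V => (vol * (f x ^+ 2 * h (x ord0 i)))%:E).
  by apply/measurable_EFinP; apply: measurable_funM => //; apply: measurable_funM; [exact: mf2|exact: mh].
have mq : measurable_fun setT (fun x : V => c%:E * (f x ^+ 2 * \1_tail x)%:E)%E.
  apply: measurable_funeM; apply/measurable_EFinP.
  by apply: measurable_funM; [exact: mf2|exact: measurable_indic].
rewrite -ge0_integralD// fubini_tonelli1//; apply: ge0_le_integral => //.
- by move=> x _; rewrite adde_ge0.
- exact: emeasurable_funD.
- exact: measurable_fun_fubini_tonelli_F.
move=> x _; rewrite /fubini_F /F/= box_integral//; last by move=> y; exact: tail_profile_ge0.
apply: le_trans (lee_wpmul2l _ (box_average_profile i r0 rho0 x)); last by rewrite lee_fin sqr_ge0.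
by rewrite -!EFinM -EFinD lee_fin /vol /c; lra.
Qed.

(** Hardy-type estimate. Exchanging [x] and [y], the double integral of
    [(f(x)^2 - f(y)^2) (h(y_i) - h(x_i))] over close pairs is twice that of
    [f(x)^2 (h(y_i) - h(x_i))], which is bounded below by the mass on the tail,
    because [h] lies below its averages. From above it is bounded by the energy
    plus a multiple of the mean square, divided by the large factor [mu]. *)
Theorem tail_estimate :
  ((2 * mu * (rho / 2) ^+ d.+2)%:E * \int[leb]_(x in tail) (f x ^+ 2)%:E <=
   energy f f + (4 * (2 * rho) ^+ d * inner f f)%:E)%E.
Proof.
have mswap (H : V * V -> \bar R) : measurable_fun setT H ->
    measurable_fun setT (fun z => H (z.2, z.1)).
  by move=> mH; apply: (measurableT_comp mH); exact: measurable_fun_pair.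
have mu0E : (0 <= mu%:E)%E by rewrite lee_fin.
have two0 : (0 <= 2%:E :> \bar R)%E by rewrite lee_fin.
have E0 z : (0 <= ((f z.1 - f z.2) ^+ 2 * J z)%:E)%E.
  by rewrite lee_fin mulr_ge0 ?sqr_ge0 ?jump_kernel_ge0.
have mE := measurable_energy_sq alpha mW (measurable_L2 f).
have sum2 (H : V * V -> \bar R) : measurable_fun setT H -> (forall z, 0 <= H z)%E ->
    (\int[leb \x leb]_z (H z + H (z.2, z.1)) =
     \int[leb \x leb]_z H z + \int[leb \x leb]_z H z)%E.
  by move=> mH H0; rewrite ge0_integralD ?integral_swap//; exact: mswap.
have : (mu%:E * (\int[leb \x leb]_z F z + \int[leb \x leb]_z F z) <=
    mu%:E * (\int[leb \x leb]_z G z + \int[leb \x leb]_z G z) +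
    (energy f f + 2%:E * (\int[leb \x leb]_z N z + \int[leb \x leb]_z N z)))%E.
  rewrite energy_sqE -!sum2// -!ge0_integralZl//; last 6 first.
  - by apply: emeasurable_funD => //; exact: mswap.
  - by move=> z _; rewrite adde_ge0.
  - by apply: emeasurable_funD => //; exact: mswap.
  - by move=> z _; rewrite adde_ge0.
  - by apply: emeasurable_funD => //; exact: mswap.
  - by move=> z _; rewrite adde_ge0.
  have mm (k : \bar R) (H : V * V -> \bar R) : measurable_fun setT H ->
      measurable_fun setT (fun z => k * (H z + H (z.2, z.1)))%E.
    by move=> mH; apply: measurable_funeM; apply: emeasurable_funD => //; exact: mswap.
  have pp (k : \bar R) (H : V * V -> \bar R) z : (0 <= k)%E -> (forall z, 0 <= H z)%E ->
      (0 <= k * (H z + H (z.2, z.1)))%E.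
    by move=> k0 H0; rewrite mule_ge0// adde_ge0.
  have mEN : measurable_fun setT (fun z => ((f z.1 - f z.2) ^+ 2 * J z)%:E +
      2%:E * (N z + N (z.2, z.1)))%E by apply: emeasurable_funD => //; exact: mm.
  have pEN z : (0 <= ((f z.1 - f z.2) ^+ 2 * J z)%:E + 2%:E * (N z + N (z.2, z.1)))%E.
    by apply: adde_ge0 => //; exact: pp.
  rewrite -ge0_integralD//; last 2 first.
  - by move=> z _; exact: pp.
  - exact: mm.
  rewrite -ge0_integralD//; last 2 first.
  - by move=> z _; exact: pp.
  - exact: mm.
  apply: ge0_le_integral => //.
  - by move=> z _; exact: pp.
  - exact: mm.
  - by apply: emeasurable_funD => //; exact: mm.
  move=> z _; rewrite /F /G /N/= !indicD_sym lee_fin.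
  exact: tail_pointwise.
have := lowerF; move: finiteG; rewrite integralN.
have Tfin : (\int[leb]_(x in tail) (f x ^+ 2)%:E)%E \is a fin_num.
  rewrite ge0_fin_numE; last by apply: integral_ge0 => x _; rewrite lee_fin sqr_ge0.
  apply: (@le_lt_trans _ _ (inner f f)%:E); last exact: ltry.
  rewrite innerE; under [leRHS]eq_integral do rewrite -expr2.
  apply: ge0_subset_integral => //; first exact: measurable_tail_set.
  - exact/measurable_EFinP.
  - by move=> x _; rewrite lee_fin sqr_ge0.
move: (energy_ge0 alpha W0 f) Tfin.
case: (\int[leb \x leb]_z G z)%E => [g| |]//; case: (\int[_]_(_ in _) _)%E => [t| |]//.
case: (energy f f) => [e| |]// e0 _ _; last by rewrite addye ?leey.
case: (\int[leb \x leb]_z F z)%E => [a| |].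
- rewrite /= !lee_fin -/vol -/c => H1 H2.
  have := ler_wpM2l mu0 H1; lra.
- move=> _ H; move: mu0; rewrite le_eqVlt => /predU1P[m0|m0].
    rewrite -m0 mulr0 mul0r mul0e lee_fin; apply: addr_ge0; first by rewrite -lee_fin.
    by rewrite mulr_ge0 ?inner_ge0// mulr_ge0.
  by move: H; rewrite addye// gt0_muley ?lte_fin// leye_eq.
- by move=> H; exfalso; move: H; rewrite /= leeNy_eq.
Qed.

End integrated.
End coordinate_tail.
End tail_estimate.

(** * Variance over a set of finite measure *)

Section poincare_on_a_set.
Context (R : realType) (d : nat) (Q : set 'rV[R]_d).
Local Notation leb := (lebesgue_rV R d).
Local Notation V := 'rV[R]_d.
Hypothesis mQ : measurable Q.
Hypothesis finQ : (leb Q < +oo)%E.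

Let indic_sqr (x : V) : (\1_Q x) ^+ 2 = \1_Q x :> R.
Proof. by rewrite indicE; case: (x \in Q); rewrite ?expr1n ?expr0n. Qed.

Lemma indic_Lfun2 : (\1_Q : V -> R) \in Lfun leb 2%:E.
Proof.
apply: square_integrable_Lfun; first exact: measurable_indic.
by under eq_integral do rewrite indic_sqr; rewrite integral_indic// setIT.
Qed.

Definition indic_L2 : L2 R d := Lfun_Sub (lee1n 2) indic_Lfun2.

Lemma restrict_Lfun2 (g : L2 R d) : (fun x => g x * \1_Q x) \in Lfun leb 2%:E.
Proof.
apply: square_integrable_Lfun.
  by apply: measurable_funM; [exact: measurable_L2|exact: measurable_indic].
apply: (@le_lt_trans _ _ (inner g g)%:E); last exact: ltry.
rewrite innerE; apply: ge0_le_integral => //.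
- by move=> x _; rewrite lee_fin sqr_ge0.
- apply/measurable_EFinP; apply: measurable_funX; apply: measurable_funM; first exact: measurable_L2.
  exact: measurable_indic.
- by apply/measurable_EFinP; apply: measurable_funM; exact: measurable_L2.
move=> x _; rewrite lee_fin exprMn indic_sqr -expr2 ler_piMr ?sqr_ge0// indicE.
Qed.

Definition restrict_L2 (g : L2 R d) : L2 R d := Lfun_Sub (lee1n 2) (restrict_Lfun2 g).

Lemma restrict_inner_indic g : inner (restrict_L2 g) indic_L2 = inner indic_L2 g.
Proof.
apply: eq_Rintegral => x _ /=; rewrite mulrAC -mulrA -expr2 indic_sqr.
exact: mulrC.
Qed.

Lemma restrict_inner g : (inner (restrict_L2 g) (restrict_L2 g))%:E =
  (\int[leb]_(x in Q) (g x ^+ 2)%:E)%E.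
Proof.
rewrite innerE -(integral_mul_indic (fun x => g x ^+ 2) mQ); apply: eq_integral => x _ /=.
by rewrite -expr2 exprMn indic_sqr.
Qed.

Lemma inner_indic : (inner indic_L2 indic_L2)%:E = leb Q.
Proof.
rewrite innerE; under eq_integral do rewrite /= -expr2 indic_sqr.
by rewrite integral_indic// setIT.
Qed.

(** For fixed [x], integrating in [y] gives the squared norm of the vector
    [g x *: p - u], so that the variance identity becomes the expansion of a
    square. *)
Lemma double_integral_variance (g : L2 R d) :
  (\int[leb \x leb]_z ((g z.1 - g z.2) ^+ 2 * (\1_Q z.1 * \1_Q z.2))%:E =
   (2 * (inner indic_L2 indic_L2 * inner (restrict_L2 g) (restrict_L2 g) -
         inner indic_L2 g ^+ 2))%:E)%E.
Proof.
set u := restrict_L2 g; set p := indic_L2.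
have mg : measurable_fun setT (fun z : V * V => (g z.1 - g z.2) ^+ 2 * (\1_Q z.1 * \1_Q z.2)).
  apply: measurable_funM.
    by apply: measurable_funX; apply: measurable_increment; exact: measurable_L2.
  have mi : measurable_fun setT (\1_Q : V -> R) by exact: measurable_indic.
  apply: measurable_funM; [exact: (measurableT_comp mi measurable_fst)|].
  exact: (measurableT_comp mi measurable_snd).
rewrite fubini_tonelli1/=; last 2 first.
- exact/measurable_EFinP.
- by move=> z; rewrite lee_fin mulr_ge0 ?sqr_ge0// !indicE mulr_ge0.
pose G := inner u u; pose S := inner p g; pose v := inner p p.
transitivity (\int[leb]_x ((v *: u + (- 2 * S) *: p) x * u x + (G *: p) x * p x)%:E)%E.
  apply: eq_integral => x _; rewrite /fubini_F/=.
  transitivity ((\1_Q x)%:E * (inner (g x *: p - u) (g x *: p - u))%:E)%E.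
    rewrite innerE -ge0_integralZl//; last 2 first.
    - by apply/measurable_EFinP; apply: measurable_funM; exact: measurable_L2.
    - by move=> y _; rewrite lee_fin -expr2 sqr_ge0.
    apply: eq_integral => y _; rewrite -EFinM; congr _%:E.
    rewrite -expr2 (_ : (g x *: p - u) y = (g x - g y) * \1_Q y); last by rewrite mulrBl.
    by rewrite exprMn indic_sqr; ring.
  rewrite -EFinM; congr _%:E; rewrite innerBl !innerBr !innerZl !innerZr (innerC u p).
  rewrite -/v -/G (innerC p u) restrict_inner_indic -/S.
  rewrite -[X in _ = X]/((v * (g x * \1_Q x) + (- 2 * S) * \1_Q x) * (g x * \1_Q x) + (G * \1_Q x) * \1_Q x).
  by have := indic_sqr x; move: (\1_Q x) (g x) => a b; rewrite expr2 => H; ring: H.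
have i1 : leb.-integrable setT (EFin \o ((v *: u + (- 2 * S) *: p) \* u)) by exact: L2_mul_integrable.
have i2 : leb.-integrable setT (EFin \o ((G *: p) \* p)) by exact: L2_mul_integrable.
under eq_integral do rewrite EFinD.
rewrite integralD//= -(innerE (v *: u + (- 2 * S) *: p) u) -(innerE (G *: p) p) -EFinD; congr _%:E.
rewrite innerDl !innerZl (innerC p u) restrict_inner_indic -/S -/v -/G; ring.
Qed.

End poincare_on_a_set.

(** * Oscillation on small cells *)

Section open_cube.
Context (R : realType) (d : nat) (r : R).

Definition open_cube : set 'rV[R]_d := [set x | forall i, `|x ord0 i| < r].

Lemma measurable_open_cube : measurable open_cube.
Proof.
rewrite (_ : open_cube = \bigcap_(i in [set: 'I_d])
    ((fun x : 'rV[R]_d => `|x ord0 i|) @^-1` `]-oo, r[)).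
  apply: fin_bigcap_measurable => // i _; rewrite -[X in measurable X]setTI.
  have m : measurable_fun setT (fun x : 'rV[R]_d => `|x ord0 i|).
    by apply: measurableT_comp => //; exact: measurable_coord_rV.
  exact: m.
by apply/seteqP; split=> [x xj i _|x xj i]; [rewrite /= in_itv; exact: xj|have := xj i I; rewrite /= in_itv].
Qed.

End open_cube.
Arguments open_cube {R} d r.
Arguments measurable_open_cube {R} d r.

Section cells.
Context (R : realType) (d : nat) (delta : R) (K : nat).
Hypothesis delta0 : 0 < delta.
Local Notation leb := (lebesgue_rV R d).
Local Notation V := 'rV[R]_d.
Local Notation cell_index := {ffun 'I_d -> 'I_(K + K)}.
Implicit Type j : cell_index.

(** Half-open, so that the cells partition the cube of half side [K * delta]; the
    shift by [K * delta] makes the indices natural numbers. *)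
Definition cell j : set V :=
  [set x | forall i, (j i)%:R * delta <= x ord0 i + K%:R * delta < (j i).+1%:R * delta].

Lemma measurable_cell j : measurable (cell j).
Proof.
rewrite (_ : cell j = \bigcap_(i in [set: 'I_d])
    ((fun x : V => x ord0 i + K%:R * delta) @^-1` `[(j i)%:R * delta, (j i).+1%:R * delta[)).
  apply: fin_bigcap_measurable => // i _; rewrite -[X in measurable X]setTI.
  have m : measurable_fun setT (fun x : V => x ord0 i + K%:R * delta).
    by apply: measurable_funD => //; exact: measurable_coord_rV.
  exact: m.
by apply/seteqP; split=> [x xj i _|x xj i]; [rewrite /= in_itv; exact: xj|have := xj i I; rewrite /= in_itv].
Qed.

Lemma cell_disjoint j k x : cell j x -> cell k x -> j = k.
Proof.
move=> jx kx; apply/ffunP => i; apply/val_inj => /=.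
have /andP[j1 j2] := jx i; have /andP[k1 k2] := kx i.
have jk := le_lt_trans j1 k2; have kj := le_lt_trans k1 j2.
move: jk kj; rewrite !(ltr_pM2r delta0) !ltr_nat !ltnS => jk kj.
by apply/eqP; rewrite eqn_leq jk kj.
Qed.

Lemma cell_cover (x : V) : (forall i, `|x ord0 i| < K%:R * delta) -> exists j, cell j x.
Proof.
move=> xK; have y0 i : 0 <= (x ord0 i + K%:R * delta) / delta.
  by rewrite divr_ge0 ?(ltW delta0)//; have := xK i; rewrite ltr_norml => /andP[]; lra.
have H i : (Num.truncn ((x ord0 i + K%:R * delta) / delta) < K + K)%N.
  rewrite -(ltr_nat R); have /andP[+ _] := truncn_itv (y0 i).
  move=> /le_lt_trans; apply; rewrite ltr_pdivrMr// natrD mulrDl.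
  by have := xK i; rewrite ltr_norml => /andP[]; lra.
exists [ffun i => Ordinal (H i)] => i; rewrite ffunE/=.
have /andP[] := truncn_itv (y0 i).
by rewrite ler_pdivlMr// ltr_pdivrMr// => -> ->.
Qed.

Lemma cell_diameter j x y : cell j x -> cell j y -> enorm (x - y) <= d%:R * delta.
Proof.
move=> jx jy; apply: enorm_le_bound; first exact: ltW.
move=> i; rewrite !mxE ler_norml; have /andP[j1 j2] := jx i; have /andP[k1 k2] := jy i.
by move: j2 k2; rewrite -natr1 => j2 k2; apply/andP; split; lra.
Qed.

Lemma cell_subset_box j : cell j `<=`
  rV_box (\row_i ((j i)%:R * delta - K%:R * delta)) (\row_i ((j i).+1%:R * delta - K%:R * delta)).
Proof.
by move=> x jx i; rewrite in_itv/= !mxE; have /andP[j1 j2] := jx i; apply/andP; split; lra.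
Qed.

Lemma lebesgue_cell_lty j : (leb (cell j) < +oo)%E.
Proof.
apply: (@le_lt_trans _ _ (leb (rV_box (\row_i ((j i)%:R * delta - K%:R * delta))
   (\row_i ((j i).+1%:R * delta - K%:R * delta))))).
  apply: le_measure; rewrite ?inE; [exact: measurable_cell|exact: measurable_rV_box|].
  exact: cell_subset_box.
rewrite [X in (X < _)%E]lebesgue_rV_box ?ltry// => i; rewrite !mxE -(natr1 (j i)).
by move: delta0; lra.
Qed.

Lemma lebesgue_cell_ge j : (((delta / 2) ^+ d)%:E <= leb (cell j))%E.
Proof.
pose a : V := \row_i ((j i)%:R * delta - K%:R * delta).
apply: (@le_trans _ _ (leb (rV_box a (a + const_mx (delta / 2))))).
  rewrite [X in (_ <= X)%E]lebesgue_rV_box => [|i]; last by rewrite !mxE; move: delta0; lra.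
  rewrite lee_fin (eq_bigr (fun=> delta / 2)); first by rewrite prodr_const card_ord.
  by move=> i _; rewrite !mxE; ring.
apply: le_measure; rewrite ?inE; [exact: measurable_rV_box|exact: measurable_cell|].
move=> x ax i; have := ax i; rewrite in_itv/= !mxE -(natr1 (j i)) => /andP[? ?].
by apply/andP; split; move: delta0; lra.
Qed.

Lemma sum_indic_cell_le1 x : \sum_j \1_(cell j) x <= 1 :> R.
Proof.
have [[k kx]|nk] := pselect (exists k, cell k x).
  rewrite (bigD1 k)//= big1 ?addr0 => [|j jk]; first by rewrite indicE mem_set.
  rewrite indicE memNset// => jx; by move: jk; rewrite (cell_disjoint jx kx) eqxx.
rewrite big1// => j _; rewrite indicE memNset// => jx; apply: nk; by exists j.
Qed.

End cells.

Section local_estimate.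
Context (R : realType) (d : nat) (alpha : R).
Variable W : 'rV[R]_d * 'rV[R]_d -> R.
Hypothesis mW : measurable_fun setT W.
Hypothesis W0 : forall z, 0 <= W z.
Hypothesis alpha0 : 0 < alpha.
Hypothesis d_gt0 : (0 < d)%N.
Variables (c0 delta : R) (K : nat).
Hypothesis c0_gt0 : 0 < c0.
Hypothesis delta0 : 0 < delta.
Hypothesis ddelta : d%:R * delta < 1.
Hypothesis Wc0 : forall x y : 'rV[R]_d, enorm (x - y) < 1 -> c0 <= W (x, y).
Local Notation leb := (lebesgue_rV R d).
Local Notation V := 'rV[R]_d.
Local Notation J := (jump_kernel alpha W).
Local Notation energy := (@energy R d alpha W).
Local Notation cell := (@cell R d delta K).
Local Notation cell_L2 j := (indic_L2 (measurable_cell delta j) (lebesgue_cell_lty delta0 j)).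

Let A := (d%:R * delta) `^ (d%:R + alpha) / c0.
Let A_gt0 : 0 < A. Proof. by rewrite divr_gt0// powR_gt0// mulr_gt0// ltr0n. Qed.
Let A0 : 0 <= A. Proof. exact: ltW. Qed.

Let P0 : 0 < d%:R + alpha. Proof. by rewrite ltr_wpDl. Qed.

Lemma increment_le_kernel (f : V -> R) j x y : cell j x -> cell j y ->
  (f x - f y) ^+ 2 <= A * ((f x - f y) ^+ 2 * J (x, y)).
Proof.
move=> jx jy; have [->|xy] := eqVneq x y; first by rewrite subrr expr0n mul0r mulr0.
rewrite mulrCA -[leLHS]mulr1 ler_wpM2l ?sqr_ge0//.
have xyd := cell_diameter delta0 jx jy.
have e0 : 0 < enorm (x - y).
  rewrite lt_neqAle enorm_ge0 andbT eq_sym.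
  by apply: contra xy => /eqP/enorm_eq0/eqP; rewrite subr_eq0.
have p0 := powR_gt0 (d%:R + alpha) e0.
have w1 : 1 <= W (x, y) / c0 by rewrite ler_pdivlMr// mul1r Wc0// (le_lt_trans xyd).
have w2 : 1 <= (d%:R * delta) `^ (d%:R + alpha) / enorm (x - y) `^ (d%:R + alpha).
  rewrite ler_pdivlMr// mul1r ge0_ler_powR ?nnegrE ?(ltW P0) ?(ltW e0)//.
  by rewrite (le_trans (ltW e0)).
rewrite /A /jump_kernel/= mulrACA (mulrC (_ `^ _)) -mulrACA.
by rewrite mulr_ege1.
Qed.

Let I j (f : V -> R) :=
  (\int[leb \x leb]_z ((f z.1 - f z.2) ^+ 2 * J z * (\1_(cell j) z.1 * \1_(cell j) z.2))%:E)%E.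

(** Poincare inequality on each cell: the mean square of [f] splits into the
    square of its average, which comes from one of the functionals [inner p f], and
    its variance, a double integral over pairs of points that short jumps connect. As [A] is of order
    [delta^(d + alpha)], the factor of the energy is of order [delta^alpha]. *)
Theorem local_estimate (f : L2 R d) :
  (\int[leb]_(x in open_cube d (K%:R * delta)%R) (f x ^+ 2)%:E <=
   ((2 / delta) ^+ d * A)%:E * energy f f +
   ((2 / delta) ^+ d * \sum_(p <- [seq cell_L2 j | j <- index_enum {ffun 'I_d -> 'I_(K + K)}])
      inner p f ^+ 2)%:E)%E.
Proof.
have r0 : 0 < (2 / delta) ^+ d by rewrite exprn_gt0// divr_gt0.
have mf := measurable_L2 f.
have i0 (B : set V) x : 0 <= \1_B x :> R by rewrite indicE.
have D0 j z : 0 <= (f z.1 - f z.2) ^+ 2 * J z * (\1_(cell j) z.1 * \1_(cell j) z.2).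
  apply: mulr_ge0; last by apply: mulr_ge0; exact: i0.
  by apply: mulr_ge0; [exact: sqr_ge0|exact: jump_kernel_ge0].
have mi j : measurable_fun setT (\1_(cell j) : V -> R).
  by apply: measurable_indic; exact: measurable_cell.
have mii j : measurable_fun setT (fun z : V * V => \1_(cell j) z.1 * \1_(cell j) z.2 : R).
  apply: measurable_funM; [exact: (measurableT_comp (mi j) measurable_fst)|].
  exact: (measurableT_comp (mi j) measurable_snd).
have mJ : measurable_fun setT (fun z : V * V => (f z.1 - f z.2) ^+ 2 * J z).
  by apply/measurable_EFinP; exact: measurable_energy_sq.
have mD j : measurable_fun setT
    (fun z => ((f z.1 - f z.2) ^+ 2 * J z * (\1_(cell j) z.1 * \1_(cell j) z.2))%:E).
  by apply/measurable_EFinP; apply: measurable_funM.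
have I0 j : (0 <= I j f)%E by apply: integral_ge0 => z _; rewrite lee_fin.
have sumI : (\sum_j I j f <= energy f f)%E.
  rewrite energy_sqE /I -ge0_integral_sum//; last by move=> j z _; rewrite lee_fin.
  apply: ge0_le_integral => //.
  - by move=> z _; apply: sume_ge0 => j _; rewrite lee_fin.
  - by apply: emeasurable_sum.
  - exact/measurable_EFinP.
  move=> z _; rewrite sumEFin lee_fin -mulr_sumr ler_piMr//.
    by rewrite mulr_ge0 ?sqr_ge0 ?jump_kernel_ge0.
  apply: le_trans (sum_indic_cell_le1 K delta0 z.1); apply: ler_sum => j _.
  by rewrite ler_piMr// indicE; case: (_ \in _).
have one j : (\int[leb]_(x in cell j) (f x ^+ 2)%:E <=
    ((2 / delta) ^+ d)%:E * ((inner (cell_L2 j) f ^+ 2)%:E + A%:E * I j f))%E.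
  rewrite -(restrict_inner (measurable_cell delta j)).
  have := double_integral_variance (measurable_cell delta j) (lebesgue_cell_lty delta0 j) f.
  set v := inner _ _; set G := inner _ _; set S := inner _ _ => dv.
  have dI : ((2 * (v * G - S ^+ 2))%:E <= A%:E * I j f)%E.
    rewrite -dv -ge0_integralZl//; last by move=> z _; rewrite lee_fin.
    apply: ge0_le_integral => //.
    - by move=> z _; rewrite lee_fin mulr_ge0 ?sqr_ge0// mulr_ge0.
    - apply/measurable_EFinP; apply: measurable_funM => //; apply: measurable_funX.
      exact: measurable_increment.
    - exact: measurable_funeM.
    move=> z _; rewrite -EFinM lee_fin !indicE.
    case: (boolP (z.1 \in cell j)) => [/set_mem j1|_]; last by rewrite mul0r !mulr0.
    case: (boolP (z.2 \in cell j)) => [/set_mem j2|_]; last by rewrite !mulr0.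
    rewrite !mulr1; apply: le_trans (increment_le_kernel f j1 j2) _.
    by rewrite -surjective_pairing.
  have v1 : (delta / 2) ^+ d <= v by rewrite -lee_fin inner_indic; exact: lebesgue_cell_ge.
  have G0 : 0 <= G by exact: inner_ge0.
  have dd : (2 / delta) ^+ d * (delta / 2) ^+ d = 1.
    by rewrite -exprMn mulrA divfK ?gt_eqF// divff ?expr1n.
  move: dI (I0 j); case: (I j f) => [t| |]//.
    rewrite -EFinM lee_fin => dI; rewrite lee_fin => t0; rewrite -EFinD -EFinM lee_fin.
    have At : 0 <= A * t by rewrite mulr_ge0.
    have H : (delta / 2) ^+ d * G <= S ^+ 2 + A * t.
      have : (delta / 2) ^+ d * G <= v * G by rewrite ler_wpM2r.
      by have := sqr_ge0 S; lra.
    rewrite (_ : G = (2 / delta) ^+ d * ((delta / 2) ^+ d * G)); last by rewrite mulrA dd mul1r.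
    by apply: ler_wpM2l H; exact: ltW.
  move=> _ _.
  by rewrite gt0_muley ?lte_fin// addey// gt0_muley ?lte_fin// leey.
have cov : (\int[leb]_(x in open_cube d (K%:R * delta)%R) (f x ^+ 2)%:E <=
    \sum_j \int[leb]_(x in cell j) (f x ^+ 2)%:E)%E.
  have mB := measurable_open_cube d (K%:R * delta).
  have mf2 : measurable_fun setT (fun x => f x ^+ 2) by exact: measurable_funX.
  rewrite -(integral_mul_indic (fun x => f x ^+ 2) mB).
  under eq_bigr => j _ do rewrite -(integral_mul_indic (fun x => f x ^+ 2) (measurable_cell delta j)).
  rewrite -ge0_integral_sum//; last 2 first.
  - by move=> j; apply/measurable_EFinP; apply: measurable_funM.
  - by move=> j x _; rewrite lee_fin mulr_ge0 ?sqr_ge0.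
  apply: ge0_le_integral => //.
  - by move=> x _; rewrite lee_fin mulr_ge0 ?sqr_ge0.
  - by apply/measurable_EFinP; apply: measurable_funM => //; exact: measurable_indic.
  - by apply: emeasurable_sum => j; apply/measurable_EFinP; apply: measurable_funM.
  move=> x _; rewrite sumEFin lee_fin -mulr_sumr ler_wpM2l ?sqr_ge0//.
  rewrite [leLHS]indicE; case: (boolP (x \in _)) => [|_]; last by rewrite sumr_ge0.
  rewrite inE => /(cell_cover delta0)[k kx].
  by rewrite (bigD1 k)//= indicE mem_set//= lerDl sumr_ge0.
apply: (le_trans cov); apply: le_trans (lee_sum _ (fun j _ => one j)) _.
rewrite -ge0_sume_distrr; last by move=> j _; rewrite adde_ge0 ?lee_fin ?sqr_ge0// mule_ge0// lee_fin.
rewrite big_split/= sumEFin -ge0_sume_distrr; last by move=> j _; exact: I0.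
rewrite big_map addeC ge0_muleDr; last 2 first.
- by rewrite mule_ge0 ?lee_fin// sume_ge0.
- by rewrite lee_fin sumr_ge0// => j _; rewrite sqr_ge0.
rewrite muleA -!EFinM leeD2r// lee_wpmul2l// lee_fin mulr_ge0//.
exact: ltW.
Qed.

End local_estimate.

(** * Compactness of energy balls *)

Section compact_embedding.
Context (R : realType) (d : nat) (alpha : R).
Variable W : 'rV[R]_d * 'rV[R]_d -> R.
Hypothesis mW : measurable_fun setT W.
Hypothesis W0 : forall z, 0 <= W z.
Hypothesis alpha0 : 0 < alpha.
Hypothesis d_gt0 : (0 < d)%N.
Local Notation leb := (lebesgue_rV R d).
Local Notation V := 'rV[R]_d.
Local Notation energy := (@energy R d alpha W).
Variable c0 : R.
Hypothesis c0_gt0 : 0 < c0.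
Hypothesis Wc0 : forall x y : V, enorm (x - y) < 1 -> c0 <= W (x, y).
Hypothesis Wquad : forall mu : R, 0 <= mu -> exists2 r : R, 0 <= r &
  forall (i : 'I_d) (x y : V), enorm (x - y) < 1 -> r < `|x ord0 i| ->
  (mu * x ord0 i) ^+ 2 <= W (x, y) /\ (mu * x ord0 i) ^+ 2 <= W (y, x).

Lemma inner_le_cube_tails (f : L2 R d) (r rho s : R) : r + rho <= s ->
  ((inner f f)%:E <= \int[leb]_(x in open_cube d s) (f x ^+ 2)%:E +
     \sum_(i < d) \int[leb]_(x in tail_set i r rho) (f x ^+ 2)%:E)%E.
Proof.
move=> rs; have mB := measurable_open_cube d s; have mT (i : 'I_d) := measurable_tail_set i r rho.
have mf2 : measurable_fun setT (fun x => f x ^+ 2) by apply: measurable_funX; exact: measurable_L2.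
have i0 (B : set V) x : 0 <= \1_B x :> R by rewrite indicE.
have mfi (B : set V) : measurable B -> measurable_fun setT (fun x => (f x ^+ 2 * \1_B x)%:E).
  move=> mB'; apply/measurable_EFinP; apply: measurable_funM; first exact: mf2.
  exact: measurable_indic.
have p0 (B : set V) x : (0 <= (f x ^+ 2 * \1_B x)%:E)%E by rewrite lee_fin mulr_ge0 ?sqr_ge0.
rewrite innerE -(integral_mul_indic (fun x => f x ^+ 2) mB).
under eq_bigr => i _ do rewrite -(integral_mul_indic (fun x => f x ^+ 2) (mT i)).
rewrite -ge0_integral_sum//; last by move=> i; exact: mfi.
rewrite -ge0_integralD//; last 3 first.
- exact: mfi.
- by move=> x _; apply: sume_ge0.
- by apply: emeasurable_sum => i; exact: mfi.
apply: ge0_le_integral => //.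
- by move=> x _; rewrite lee_fin -expr2 sqr_ge0.
- by apply/measurable_EFinP; exact: mf2.
- by apply: emeasurable_funD; [exact: mfi|apply: emeasurable_sum => i; exact: mfi].
move=> x _; rewrite sumEFin -EFinD lee_fin -mulr_sumr -mulrDr -expr2 ler_peMr ?sqr_ge0//.
have [xB|/existsNP[i /negP]] := pselect (open_cube d s x).
  by rewrite indicE mem_set//= lerDl sumr_ge0.
rewrite -leNgt => xi; have -> : \sum_(k < d) \1_(tail_set k r rho) x =
    1 + \sum_(k < d | k != i) \1_(tail_set k r rho) x :> R.
  by rewrite (bigD1 i)//= indicE mem_set//; exact: le_trans xi.
by rewrite addrCA lerDl addr_ge0// sumr_ge0.
Qed.

(** The energy controls the mass far away (by the quadratic growth of the
    weight) and the oscillation on small cells (by its positivity); what is left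
    are the finitely many cell averages. *)
Theorem energy_compactness (e : R) : 0 < e -> exists (psi : seq (L2 R d)) (C : R),
  forall (f : L2 R d) (E : R), bounded_support f -> (energy f f <= E%:E)%E ->
  inner f f <= e * (E + inner f f) + C * \sum_(p <- psi) inner p f ^+ 2.
Proof.
move=> e0; pose rho : R := d.+1%:R^-1.
have dR : 0 < d%:R :> R by rewrite ltr0n.
have rho0 : 0 < rho by rewrite invr_gt0.
have drho : d%:R * rho < 1 by rewrite ltr_pdivrMr// mul1r ltr_nat.
pose k0 := 2 * (rho / 2) ^+ d.+2.
have k00 : 0 < k0 by rewrite mulr_gt0// exprn_gt0// divr_gt0.
pose L := 4 * (2 * rho) ^+ d + 1.
have L0 : 0 < L by rewrite ltr_wpDl// mulr_ge0// exprn_ge0// mulr_ge0// ltW.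
have L1 : 1 <= L by rewrite lerDr mulr_ge0// exprn_ge0// mulr_ge0// ltW.
have L4 : 4 * (2 * rho) ^+ d <= L by rewrite lerDl.
(* each of the [d] tails may contribute [e / (2 d)], and the cells [e / 2] *)
pose mu := 2 * d%:R * L / (k0 * e).
have mu0 : 0 < mu.
  by apply: divr_gt0; [apply: mulr_gt0 => //; exact: mulr_gt0|exact: mulr_gt0].
have [r r0 rW] := Wquad (ltW mu0).
pose kappa := 2 ^+ d * d%:R `^ (d%:R + alpha) / c0.
have kappa0 : 0 < kappa by rewrite divr_gt0// mulr_gt0 ?exprn_gt0 ?powR_gt0.
have ekappa : 0 < e / (2 * kappa) by rewrite divr_gt0// mulr_gt0.
pose delta := Num.min ((e / (2 * kappa)) `^ alpha^-1) rho.
have delta0 : 0 < delta by rewrite lt_min rho0 andbT powR_gt0.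
have ddelta : d%:R * delta < 1.
  by apply: le_lt_trans drho; rewrite ler_pM2l// ge_min lexx orbT.
have delta_alpha : kappa * delta `^ alpha <= e / 2.
  have : delta `^ alpha <= e / (2 * kappa).
    rewrite (_ : e / (2 * kappa) = ((e / (2 * kappa)) `^ alpha^-1) `^ alpha); last first.
      by rewrite -powRrM mulVf ?gt_eqF// powRr1// ltW.
    rewrite ge0_ler_powR ?nnegrE ?powR_ge0 ?(ltW alpha0) ?(ltW delta0)//.
    by rewrite ge_min lexx.
  rewrite -(ler_pM2l kappa0) => /le_trans; apply.
  by rewrite le_eqVlt; apply/orP; left; apply/eqP; field; rewrite gt_eqF.
pose K := (Num.truncn ((r + rho) / delta)).+1.
have rK : r + rho <= K%:R * delta.
  have s0 : 0 <= (r + rho) / delta by rewrite divr_ge0 ?addr_ge0 ?(ltW rho0) ?(ltW delta0).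
  by have /andP[_ /ltW] := truncn_itv s0; rewrite ler_pdivrMr.
exists [seq indic_L2 (measurable_cell delta j) (lebesgue_cell_lty delta0 j) |
          j <- index_enum {ffun 'I_d -> 'I_(K + K)}], ((2 / delta) ^+ d).
move=> f E fB fE.
have loc := local_estimate mW W0 alpha0 d_gt0 K c0_gt0 delta0 ddelta Wc0 f.
set S := \sum_(p <- _) _ in loc *.
have E0 : 0 <= E by rewrite -lee_fin (le_trans _ fE)// energy_ge0.
have n0 : 0 <= inner f f by exact: inner_ge0.
have tails (i : 'I_d) : (\int[leb]_(x in tail_set i r rho) (f x ^+ 2)%:E <=
    (e / (2 * d%:R) * (E + inner f f))%:E)%E.
  have := @tail_estimate R d alpha W mW W0 alpha0 i r rho mu r0 rho0 drho (ltW mu0) (rW i) f fB.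
  set T := (\int[_]_(_ in _) _)%E => H.
  have T0 : (0 <= T)%E by apply: integral_ge0 => x _; rewrite lee_fin sqr_ge0.
  have {}H : ((mu * k0)%:E * T <= (L * (E + inner f f))%:E)%E.
    rewrite (_ : mu * k0 = 2 * mu * (rho / 2) ^+ d.+2); last by rewrite /k0; ring.
    apply: (le_trans H); apply: (@le_trans _ _ (E%:E + (4 * (2 * rho) ^+ d * inner f f)%:E)%E).
      by rewrite leeD2r.
    by rewrite -EFinD lee_fin mulrDr lerD ?ler_peMl// ler_wpM2r.
  have mk : 0 < mu * k0 by rewrite mulr_gt0.
  rewrite -(@lee_pmul2l _ (mu * k0)%:E)//.
  apply: (le_trans H); rewrite -EFinM lee_fin le_eqVlt; apply/orP; left; apply/eqP.
  by rewrite /mu; field; rewrite !gt_eqF.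
have := inner_le_cube_tails f rK.
have sumT : (\sum_(i < d) \int[leb]_(x in tail_set i r rho) (f x ^+ 2)%:E <=
    (e / 2 * (E + inner f f))%:E)%E.
  apply: (le_trans (lee_sum _ (fun i _ => tails i))).
  rewrite sumEFin lee_fin sumr_const card_ord -mulr_natl le_eqVlt; apply/orP; left; apply/eqP.
  by field; rewrite gt_eqF.
have locE : (\int[leb]_(x in open_cube d (K%:R * delta)) (f x ^+ 2)%:E <=
    (e / 2 * E + (2 / delta) ^+ d * S)%:E)%E.
  apply: (le_trans loc); rewrite (EFinD (e / 2 * E)) leeD2r//.
  have -> : (2 / delta) ^+ d * ((d%:R * delta) `^ (d%:R + alpha) / c0) = kappa * delta `^ alpha.
    rewrite powRM ?(ltW dR) ?(ltW delta0)// (@powRD _ delta); last by rewrite (gt_eqF delta0) implybT.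
    rewrite powR_mulrn ?(ltW delta0)// /kappa exprMn exprVn.
    by field; rewrite !gt_eqF ?exprn_gt0.
  apply: (@le_trans _ _ ((kappa * delta `^ alpha)%:E * E%:E)%E).
    by rewrite lee_wpmul2l// lee_fin mulr_ge0 ?powR_ge0 ?(ltW kappa0).
  by rewrite -EFinM lee_fin ler_wpM2r.
move=> /le_trans/(_ (leeD locE sumT)); rewrite -EFinD lee_fin.
move=> /le_trans; apply; have := mulr_ge0 (ltW e0) n0; lra.
Qed.

End compact_embedding.

(** * Compactness of the semigroup *)

Section bounded_support_facts.
Context (R : realType) (d : nat).
Local Notation V := 'rV[R]_d.

Lemma compact_coord_bounded (A : set V) : compact A ->
  exists B, forall x, A x -> forall i, `|x ord0 i| <= B.
Proof.
move=> cA.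
have /choice[B HB] (i : 'I_d) : exists B, forall x, A x -> `|x ord0 i| <= B.
  have cc : {within A, continuous (fun x : V => x ord0 i)}.
    by apply: continuous_subspaceT; exact: coord_continuous.
  have /compact_bounded[B [_ HB]] := continuous_compact cc cA.
  by exists (B + 1) => x Ax; apply: HB; [rewrite ltrDl|exists x].
exists (\sum_i `|B i|) => x Ax i; apply: le_trans (HB i x Ax) _.
rewrite (bigD1 i)//=; apply: le_trans (ler_norm _) _.
by rewrite lerDl sumr_ge0.
Qed.

Lemma Cc_infty_bounded_support (f : V -> R) : Cc_infty f -> bounded_support f.
Proof.
move=> [_ /compact_coord_bounded[B HB]]; exists B => x fx i; apply: HB.
exact: subset_closure.
Qed.

Lemma bounded_supportB (f g : V -> R) :
  bounded_support f -> bounded_support g -> bounded_support (f \- g).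
Proof.
move=> [B HB] [C HC]; exists (Num.max B C) => x fgx i; rewrite le_max.
have [fx|fx] := eqVneq (f x) 0; last by rewrite HB.
by rewrite HC ?orbT//; apply: contra fgx => /eqP gx; rewrite /= fx gx subrr.
Qed.

End bounded_support_facts.

Section compact_semigroup.
Context (R : realType) (d : nat) (alpha : R).
Variable W : 'rV[R]_d * 'rV[R]_d -> R.
Hypothesis mW : measurable_fun setT W.
Hypothesis W0 : forall z, 0 <= W z.
Variable P : R -> L2 R d -> L2 R d.
Hypothesis hPW : semigroup_of_form alpha W P.
Local Notation energy := (@energy R d alpha W).

Lemma energy_distC (f g : 'rV[R]_d -> R) : energy (f \- g) (f \- g) = energy (g \- f) (g \- f).
Proof.
by rewrite !energy_sqE; apply: eq_integral => z _; congr (_ * _)%:E; rewrite /=; ring.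
Qed.

Hypothesis compact_energy : forall e : R, 0 < e -> exists (psi : seq (L2 R d)) (C : R),
  forall (f : L2 R d) (E : R), bounded_support f -> (energy f f <= E%:E)%E ->
  inner f f <= e * (E + inner f f) + C * \sum_(p <- psi) inner p f ^+ 2.

(** By smoothing, [P t] maps bounded sequences to sequences bounded in energy;
    these are replaced by nearby test functions, to which the compactness of the
    energy balls applies. *)
Theorem compact_energy_compact_semigroup : compact_semigroup P.
Proof.
move=> t t0 u [M uM]; pose v n := P t (u n).
have hP := hPW.1.
have M0 : 0 <= M by apply: le_trans (uM 0%N); exact: L2norm_ge0.
pose E0 := M ^+ 2 / (t + t).
have tt0 : 0 < t + t by rewrite addr_gt0.
have E00 : 0 <= E0 by rewrite divr_ge0 ?sqr_ge0 ?ltW.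
have vF n : form_closure alpha W (v n) /\ (energy (v n) (v n) <= E0%:E)%E.
  have [vF vE] := smoothing_energy hPW (u n) t0.
  split=> //; apply: (le_trans vE); rewrite lee_fin ler_wpM2r ?invr_ge0 ?(ltW tt0)//.
  by rewrite -L2norm_sqr lerXn2r ?nnegrE ?L2norm_ge0.
have vM n : L2norm (v n) <= M.
  by apply: le_trans (uM n); apply: (msg_contraction hP); exact: ltW.
have n0 n : 0 < n.+1%:R^-1 :> R by rewrite invr_gt0.
have /choice[phi phiP] n : exists phi : L2 R d, Cc_infty phi /\
    (E1norm alpha W (v n - phi)%R < (n.+1%:R^-1)%:E)%E by exact: (vF n).1.2 (n0 n).
have close n := E1norm_lt_bounds W0 (n0 n) (phiP n).2.
have n1 n : n.+1%:R^-1 <= 1 :> R by rewrite invf_le1 ?ler1n.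
pose E1 := 2 * E0 + 2.
have phiE n : (energy (phi n) (phi n) <= E1%:E)%E.
  apply: le_trans (energy_parallelogram_le alpha mW W0 (measurable_L2 (phi n)) (measurable_L2 (v n))) _.
  rewrite energy_distC /E1 (EFinD (2 * E0)) EFinM.
  have two0 : (0 <= 2%:E :> \bar R)%E by rewrite lee_fin.
  apply: leeD; first by apply: lee_wpmul2l => //; exact: (vF n).2.
  apply: (@le_trans _ _ (2%:E * 1%:E)%E); last by rewrite -EFinM mulr1.
  apply: lee_wpmul2l => //; apply: le_trans (close n).1 _.
  by rewrite lee_fin expr_le1// ltW.
have phiM n : L2norm (phi n) <= M + 1.
  have -> : phi n = v n - (v n - phi n) by rewrite subKr.
  apply: le_trans (L2normB _ _) _; apply: lerD => //.
  exact: le_trans (close n).2 (n1 n).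
have dE m n : (energy (phi m - phi n)%R (phi m - phi n)%R <= (4 * E1)%:E)%E.
  apply: le_trans (energy_parallelogram_le alpha mW W0
    (measurable_L2 (phi m - phi n)%R) (measurable_L2 (phi m))) _.
  have -> : energy ((phi m - phi n)%R \- phi m) ((phi m - phi n)%R \- phi m) =
      energy (phi n) (phi n).
    rewrite !energy_sqE; apply: eq_integral => z _; congr (_ * _)%:E.
    rewrite -[LHS]/((phi m z.1 - phi n z.1 - phi m z.1 -
      (phi m z.2 - phi n z.2 - phi m z.2)) ^+ 2); ring.
  rewrite (_ : 4 * E1 = 2 * E1 + 2 * E1); last by ring.
  rewrite (EFinD (2 * E1)) EFinM.
  by apply: leeD; apply: lee_wpmul2l => //; rewrite lee_fin.
have E10 : 0 <= E1 by rewrite addr_ge0// mulr_ge0.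
have [|s [si sC]] := cauchy_subsequence phiM.
  move=> e e0; pose N := 4 * E1 + (2 * (M + 1)) ^+ 2.
  have N0 : 0 <= N by rewrite addr_ge0 ?sqr_ge0// mulr_ge0.
  have e'0 : 0 < e / (N + 1) by rewrite divr_gt0// ltr_wpDl.
  have [psi [C H]] := compact_energy e'0.
  exists psi, C => m n; rewrite L2norm_sqr.
  have bs : bounded_support (phi m - phi n).
    by apply: bounded_supportB; apply: Cc_infty_bounded_support; exact: (phiP _).1.
  apply: le_trans (H _ _ bs (dE m n)) _; rewrite lerD2r.
  rewrite mulrAC ler_pdivrMr ?ltr_wpDl// ler_wpM2l ?(ltW e0)//.
  apply: (@le_trans _ _ N); last by rewrite lerDl.
  rewrite lerD2l -L2norm_sqr lerXn2r ?nnegrE ?L2norm_ge0//.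
    by rewrite mulr_ge0// addr_ge0.
  by apply: le_trans (L2normB _ _) _; rewrite mulr_natl mulr2n lerD.
exists s; split => //; apply: L2_complete => e e0.
have e3 : 0 < e / 3 by rewrite divr_gt0.
have [N1 H1] := sC _ e3.
exists (maxn N1 (Num.truncn (3 / e))) => m n.
have small k : (maxn N1 (Num.truncn (3 / e)) <= k)%N -> L2norm (v (s k) - phi (s k)) < e / 3.
  rewrite geq_max => /andP[_ Nk]; apply: le_lt_trans (close _).2 _.
  have sk : (k <= s k)%N.
    elim: k {Nk} => // k /leq_ltn_trans; apply.
    by move/increasing_seqP : si => /(_ k); rewrite ltEnat.
  rewrite -[ltRHS]invrK ltf_pV2 ?posrE ?invr_gt0// invf_div.
  have e30 : 0 <= 3 / e by rewrite divr_ge0// ltW.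
  have /andP[_ ] := truncn_itv e30; move/lt_le_trans; apply.
  by rewrite ler_nat ltnS (leq_trans Nk).
move=> Nm Nn; have Hm := small _ Nm; have Hn := small _ Nn.
move: Nm Nn; rewrite !geq_max => /andP[Nm _] /andP[Nn _].
have Hmn := H1 _ _ Nm Nn.
rewrite -/(v (s m)) -/(v (s n)).
have -> : v (s m) - v (s n) = (v (s m) - phi (s m)) + ((phi (s m) - phi (s n)) - (v (s n) - phi (s n))).
  by rewrite opprB [X in _ = _ + X]addrA subrK addrA subrK.
apply: le_lt_trans (L2normD _ _) _.
apply: le_lt_trans (lerD (lexx _) (L2normB _ _)) _.
by move: Hmn Hm Hn => /=; lra.
Qed.

End compact_semigroup.

(** * Smooth functions flat at zero *)

Section flat_exponential.
Context (R : realType).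
Implicit Types (n : nat) (t u : R).

(** The derivative of such a function is a combination of two others, so that one
    formula shows that all of them are smooth; only [flat 0] enters the bumps. *)
Definition flat n t : R := if 0 < t then t^-1 ^+ n * expR (- t^-1) else 0.

Lemma exp_power_bound n u : 0 <= u -> u ^+ n * expR (- u) <= n`!%:R.
Proof.
move=> u0; have f0 : 0 < n`!%:R :> R by rewrite ltr0n fact_gt0.
case: n f0 => [|n] f0; first by rewrite mul1r expR_le1 oppr_le0.
rewrite expRN ler_pdivrMr ?expR_gt0// mulrC -ler_pdivrMr//.
by apply: le_trans (expR_ge1Dxn n u0); rewrite lerDr.
Qed.

Lemma flat_ge0 n t : 0 <= flat n t.
Proof.
by rewrite /flat; case: ifP => // t0; rewrite mulr_ge0 ?expR_ge0// exprn_ge0// invr_ge0 ltW.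
Qed.

Lemma flat_le n t : flat n t <= n`!%:R.
Proof. by rewrite /flat; case: ifP => // t0; rewrite exp_power_bound// invr_ge0 ltW. Qed.

(** Makes [flat n] differentiable at 0, where no formula is available. *)
Lemma flat_le_sqr n t : flat n t <= n.+2`!%:R * t ^+ 2.
Proof.
rewrite /flat; case: ifP => [t0|_]; last by rewrite mulr_ge0 ?sqr_ge0.
have := exp_power_bound n.+2 (ltW (ltac:(by rewrite invr_gt0) : 0 < t^-1)).
move=> /(ler_wpM2r (sqr_ge0 t)); apply: le_trans.
rewrite le_eqVlt; apply/orP; left; apply/eqP.
by rewrite !exprS expr0; field; rewrite gt_eqF.
Qed.

Lemma is_derive_flat n t : is_derive t 1 (flat n) (flat n.+2 t - n%:R * flat n.+1 t).
Proof.
have [t0|t0|->] := ltgtP t 0.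
- have -> : flat n.+2 t - n%:R * flat n.+1 t = 0.
    by rewrite /flat !ltNge (ltW t0)/= mulr0 subr0.
  apply: (@near_eq_is_derive _ _ _ (cst 0)).
  near=> s; rewrite /flat ifF//; apply/negbTE; rewrite -leNgt ltW//.
  by near: s; exact: lt_nbhsl.
- have dV : is_derive t 1 (fun s : R => s^-1) (- t ^- 2 *: 1).
    by apply: is_deriveV; rewrite gt_eqF.
  have dE : is_derive t 1 (fun s => expR (- s^-1)) (expR (- t^-1) * (- (- t ^- 2 *: 1))).
    exact: (@is_derive1_comp _ expR (fun s => - s^-1) _ _ _ (is_derive_expR _) (is_deriveN dV)).
  have dM := is_deriveM (is_deriveX n dV) dE.
  have nE : \near t, ((fun s : R => s^-1) ^+ n * (fun s => expR (- s^-1))) t = flat n t.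
    near=> s; rewrite /flat ifT; last by near: s; exact: lt_nbhsr.
    by rewrite fctE; congr (_ * _); rewrite fctE.
  apply: is_derive_eq (near_eq_is_derive nE dM) _.
  rewrite /flat t0 fctE /GRing.scale/=.
  case: n {dM nE} => [|n] /=; rewrite ?mulr0n ?expr0 !exprS ?expr0.
    by field; rewrite gt_eqF.
  by field; rewrite gt_eqF.
rewrite (_ : _ - _ = 0); last by rewrite /flat ltxx mulr0 subr0.
have F0 : flat n 0 = 0 by rewrite /flat ltxx.
have c : h^-1 *: (flat n (h *: 1 + 0) - flat n 0) @[h --> 0^'] --> (0 : R).
  apply/cvgrPdist_le => e e0; have C0 : 0 < n.+2`!%:R :> R by rewrite ltr0n fact_gt0.
  near=> h; rewrite sub0r normrN F0 subr0 addr0 /GRing.scale/= mulr1 normrM normfV.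
  have h0 : h != 0 by near: h; exact: nbhs_dnbhs_neq.
  rewrite mulrC ler_pdivrMr ?normr_gt0// (ger0_norm (flat_ge0 _ _)).
  apply: le_trans (flat_le_sqr n h) _; rewrite -real_normK ?num_real// expr2 mulrA.
  rewrite ler_wpM2r// -ler_pdivlMl//.
  near: h; apply: dnbhs0_le; rewrite mulr_gt0// invr_gt0.
apply: DeriveDef; first by apply/cvg_ex; exists 0.
exact/cvg_lim.
Unshelve. all: by end_near. Qed.

Lemma continuous_flat n : continuous (flat n).
Proof.
move=> t; apply: differentiable_continuous; apply/derivable1_diffP.
by have [] := is_derive_flat n t.
Qed.

Lemma flat0_lipschitz s t : `|flat 0 s - flat 0 t| <= 2 * `|s - t|.
Proof.
wlog st : s t / s <= t => [H|].
  by have [/H//|/ltW/H] := leP s t; rewrite distrC (distrC t).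
have [c _ E] := MVT_segment st (fun x _ => is_derive_flat 0 x)
  (continuous_subspaceT (@continuous_flat 0)).
rewrite distrC (distrC s) E normrM ler_wpM2r// mul0r subr0 ger0_norm ?flat_ge0//.
exact: flat_le.
Qed.

End flat_exponential.

Section smooth_algebra.
Context (R : realType) (d : nat).
Local Notation V := 'rV[R]_d.
Implicit Types (f g : V -> R).

Lemma Ck_continuous k f : Ck k f -> continuous f.
Proof. by case: k => [|k] []. Qed.

Lemma CkS k f : Ck k.+1 f -> Ck k f.
Proof.
elim: k f => [|k IH] f [cf df]; first by split.
by split=> // i; have [d1 d2] := df i; split=> //; exact: IH.
Qed.

Lemma Ck_cst k (a : R) : Ck k (cst a : V -> R).
Proof.
have cc (b : R) : continuous (cst b : V -> R) by exact: cst_continuous.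
elim: k a => [|k IH] a; split=> // i; split=> [x|]; first exact: derivable_cst.
by rewrite (_ : (fun x => _) = cst 0)//; apply/funext => x; exact: derive_cst.
Qed.

Lemma Ck_add k f g : Ck k f -> Ck k g -> Ck k (f \+ g).
Proof.
elim: k f g => [|k IH] f g [cf df] [cg dg].
  by split=> // x; exact: (cvgD (cf x) (cg x)).
split=> [x|i]; first by exact: (cvgD (cf x) (cg x)).
have [f1 f2] := df i; have [g1 g2] := dg i.
split=> [x|]; first exact: derivableD.
by rewrite (_ : (fun x => _) = 'D_(delta_mx ord0 i) f \+ 'D_(delta_mx ord0 i) g);
  [exact: IH|apply/funext => x; rewrite deriveD].
Qed.

Lemma Ck_mul k f g : Ck k f -> Ck k g -> Ck k (f \* g).
Proof.
elim: k f g => [|k IH] f g Cf Cg.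
  by split=> // x; apply: (@continuousM _ _ f g x); [exact: (Ck_continuous Cf)|exact: (Ck_continuous Cg)].
split=> [x|i].
  by apply: (@continuousM _ _ f g x); [exact: (Ck_continuous Cf)|exact: (Ck_continuous Cg)].
have [f1 f2] := Cf.2 i; have [g1 g2] := Cg.2 i.
split=> [x|]; first exact: derivableM.
rewrite (_ : (fun x => _) = (f \* 'D_(delta_mx ord0 i) g) \+ (g \* 'D_(delta_mx ord0 i) f)).
  by apply: Ck_add; apply: IH => //; exact: CkS.
by apply/funext => x; rewrite deriveM.
Qed.

Lemma Ck_prod k (I : Type) (r : seq I) (F : I -> V -> R) :
  (forall i, Ck k (F i)) -> Ck k (fun x => \prod_(i <- r) F i x).
Proof.
move=> CF; elim: r => [|i r IH].
  by rewrite (_ : (fun _ => _) = cst 1); [exact: Ck_cst|apply/funext => x; rewrite big_nil].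
rewrite (_ : (fun _ => _) = F i \* (fun x => \prod_(j <- r) F j x)); first exact: Ck_mul.
by apply/funext => x; rewrite big_cons.
Qed.

Lemma is_derive_along f (x v : V) df :
  is_derive (0 : R) 1 (fun h => f (h *: v + x)) df -> is_derive x v f df.
Proof.
have E : (fun h : R => h^-1 *: (((fun h => f (h *: v + x)) \o shift 0) (h *: 1) - f (0 *: v + x))) =
    (fun h => h^-1 *: ((f \o shift x) (h *: v) - f x)).
  by apply/funext => h; rewrite /= addr0 scale0r add0r /GRing.scale/= mulr1.
move=> [d1 d2]; apply: DeriveDef.
  by move: d1; rewrite /derivable E.
by rewrite -d2 /derive E.
Qed.

Lemma continuous_flat_affine n (j : 'I_d) (a b : R) :
  continuous (fun x : V => flat n (a * x ord0 j + b)).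
Proof.
move=> x; apply: (@continuous_comp _ _ _ (fun x : V => a * x ord0 j + b) (flat n)); last first.
  exact: continuous_flat.
apply: (@continuousD _ _ _ (fun x : V => a * x ord0 j) (cst b)); last exact: cst_continuous.
apply: (@continuousM _ _ (cst a) (fun x : V => x ord0 j)); first exact: cst_continuous.
exact: coord_continuous.
Qed.

Lemma is_derive_flat_affine n (i j : 'I_d) (a b : R) (x : V) :
  is_derive x (delta_mx ord0 i : V) (fun x : V => flat n (a * x ord0 j + b))
    ((flat n.+2 (a * x ord0 j + b) - n%:R * flat n.+1 (a * x ord0 j + b)) * (a * (j == i)%:R)).
Proof.
apply: is_derive_along.
pose c := a * (j == i)%:R; pose l (h : R) := c * h + (a * x ord0 j + b).
rewrite (_ : (fun h => _) = flat n \o l); last first.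
  by apply/funext => h; rewrite /= /l /c !mxE eqxx/=; congr flat; ring.
have l0 : l 0 = a * x ord0 j + b by rewrite /l mulr0 add0r.
rewrite -l0; apply: is_derive1_comp; first exact: is_derive_flat.
have := is_deriveD (is_deriveM (is_derive_cst c (0 : R) 1) (is_derive_id (0 : R) 1))
  (is_derive_cst (a * x ord0 j + b) (0 : R) 1).
by move/is_derive_eq; apply; rewrite scaler0 !addr0 /GRing.scale/= mulr1.
Qed.

Lemma Ck_flat k n (j : 'I_d) (a b : R) : Ck k (fun x : V => flat n (a * x ord0 j + b)).
Proof.
elim: k n => [|k IH] n; split=> //; try exact: continuous_flat_affine.
move=> i; split=> [x|]; first by have [] := is_derive_flat_affine n i j a b x.
rewrite (_ : (fun x => _) = (fun x : V => flat n.+2 (a * x ord0 j + b)) \*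
    (cst (a * (j == i)%:R)) \+
  (fun x : V => flat n.+1 (a * x ord0 j + b)) \* (cst (- n%:R * (a * (j == i)%:R)))).
  by apply: Ck_add; apply: Ck_mul => //; exact: Ck_cst.
apply/funext => x; have [_ ->] := is_derive_flat_affine n i j a b x.
by rewrite /=; ring.
Qed.

End smooth_algebra.

(** * Scaled bump functions *)

Section bump.
Context (R : realType).
Implicit Types s t : R.

Definition bump s : R := flat 0 (s - 1) * flat 0 (2 - s).

Lemma flat0_le1 t : flat 0 t <= 1.
Proof. by apply: le_trans (flat_le 0 t) _; rewrite fact0. Qed.

Lemma bump_ge0 s : 0 <= bump s.
Proof. by rewrite mulr_ge0 ?flat_ge0. Qed.

Lemma bump_le1 s : bump s <= 1.
Proof. by rewrite mulr_ile1 ?flat_ge0 ?flat0_le1. Qed.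

Lemma bump_support s : bump s != 0 -> 1 < s < 2.
Proof.
rewrite mulf_eq0 negb_or /flat; case: ifP => [s1|]; last by rewrite eqxx.
case: ifP => [s2|]; last by rewrite eqxx andbF.
by move=> _; apply/andP; split; lra.
Qed.

Lemma bump_lipschitz s t : `|bump s - bump t| <= 4 * `|s - t|.
Proof.
have -> : bump s - bump t = (flat 0 (s - 1) - flat 0 (t - 1)) * flat 0 (2 - s) +
    flat 0 (t - 1) * (flat 0 (2 - s) - flat 0 (2 - t)) by rewrite /bump; ring.
apply: le_trans (ler_normD _ _) _; rewrite !normrM.
have h1 := flat0_lipschitz (s - 1) (t - 1); have h2 := flat0_lipschitz (2 - s) (2 - t).
rewrite (_ : s - 1 - (t - 1) = s - t) in h1; last by ring.
rewrite (_ : 2 - s - (2 - t) = - (s - t)) in h2; last by ring.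
rewrite normrN in h2.
rewrite (ger0_norm (flat_ge0 0 (2 - s))) (ger0_norm (flat_ge0 0 (t - 1))).
have := flat_ge0 0 (2 - s); have := flat0_le1 (2 - s).
have := flat_ge0 0 (t - 1); have := flat0_le1 (t - 1).
have := normr_ge0 (flat 0 (s - 1) - flat 0 (t - 1)).
have := normr_ge0 (flat 0 (2 - s) - flat 0 (2 - t)).
move: h1 h2; set A := `|flat 0 (s - 1) - _|; set B := `|flat 0 (2 - s) - _|; set z := `|s - t|.
move: (flat 0 (2 - s)) (flat 0 (t - 1)) A B z => a b A B z.
by nra.
Qed.

Lemma bump_lower s : 5 / 4 <= s -> s <= 7 / 4 -> expR (- 8) <= bump s.
Proof.
(* on the middle half of the support, both arguments of [flat 0] are at least [1 / 4] *)
move=> s1 s2; have h t : 4^-1 <= t -> expR (- 4) <= flat 0 t.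
  move=> t4; have t0 : 0 < t by apply: lt_le_trans t4.
  rewrite /flat t0 mul1r ler_expR lerN2 -[leRHS]invrK lef_pV2 ?posrE//.
have -> : expR (- 8) = expR (- 4) * expR (- 4) :> R by rewrite -expRD; congr expR; lra.
by apply: ler_pM; rewrite ?expR_ge0//; apply: h; lra.
Qed.

End bump.

Section bump_product.
Context (R : realType) (d : nat) (lam : R).
Hypothesis lam0 : 0 < lam.
Local Notation leb := (lebesgue_rV R d).
Local Notation V := 'rV[R]_d.
Implicit Types x y : V.

Definition bump_prod x : R := \prod_i bump (x ord0 i / lam).

Lemma bump_prod_ge0 x : 0 <= bump_prod x.
Proof. by apply: prodr_ge0 => i _; exact: bump_ge0. Qed.

Lemma bump_prod_le1 x : bump_prod x <= 1.
Proof. by apply: prodr_ile1 => i _; rewrite bump_ge0 bump_le1. Qed.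

Lemma bump_prod_support x : bump_prod x != 0 -> forall i, lam < x ord0 i < 2 * lam.
Proof.
move=> /prodf_neq0 H i; have := bump_support (H i isT).
by rewrite ltr_pdivlMr// ltr_pdivrMr// mul1r.
Qed.

Lemma prod_lipschitz (I : Type) (r : seq I) (F G : I -> R) :
  (forall i, 0 <= F i <= 1) -> (forall i, 0 <= G i <= 1) ->
  `|\prod_(i <- r) F i - \prod_(i <- r) G i| <= \sum_(i <- r) `|F i - G i|.
Proof.
move=> F01 G01; elim: r => [|i r IH]; first by rewrite !big_nil subrr normr0.
rewrite !big_cons; set p := \prod_(_ <- _) F _ in IH *; set q := \prod_(_ <- _) G _ in IH *.
have -> : F i * p - G i * q = (F i - G i) * p + G i * (p - q) by ring.
apply: le_trans (ler_normD _ _) _; rewrite !normrM.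
have p0 : 0 <= p by apply: prodr_ge0 => j _; have /andP[] := F01 j.
have p1 : p <= 1 by apply: prodr_ile1 => j _; exact: F01.
have /andP[g0 g1] := G01 i; rewrite (ger0_norm p0) (ger0_norm g0).
apply: lerD; first by rewrite ler_piMr.
by apply: le_trans IH; rewrite ler_piMl.
Qed.

Lemma bump_prod_lipschitz x y :
  `|bump_prod x - bump_prod y| <= 4 * d%:R * (enorm (x - y) / lam).
Proof.
have b01 (z : V) (i : 'I_d) : 0 <= bump (z ord0 i / lam : R) <= 1 by rewrite bump_ge0 bump_le1.
have H := @prod_lipschitz 'I_d (index_enum 'I_d) (fun i => bump (x ord0 i / lam))
  (fun i => bump (y ord0 i / lam)) (b01 x) (b01 y).
apply: (le_trans H).
apply: (@le_trans _ _ (\sum_(i < d) 4 * (enorm (x - y) / lam))).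
  apply: ler_sum => i _; apply: le_trans (bump_lipschitz _ _) _.
  rewrite ler_wpM2l// -mulrBl normrM (gtr0_norm (ltac:(by rewrite invr_gt0) : 0 < lam^-1)).
  rewrite ler_wpM2r ?invr_ge0 ?(ltW lam0)//.
  by have := ler_coord_enorm (x - y) i; rewrite !mxE.
rewrite sumr_const card_ord -mulr_natl le_eqVlt; apply/orP; left; apply/eqP; ring.
Qed.

Lemma measurable_bump_prod : measurable_fun setT bump_prod.
Proof.
apply: measurable_prod => i _.
have mflat (a b : R) : measurable_fun setT (fun x : V => flat 0 (a * x ord0 i + b)).
  apply: (measurableT_comp (continuous_measurable_fun (@continuous_flat R 0))).
  by apply: measurable_funD => //; apply: measurable_funM => //; exact: measurable_coord_rV.
apply: measurable_funM.
  by under eq_fun do rewrite mulrC; exact: mflat.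
rewrite (_ : (fun x => _) = (fun x : V => flat 0 (- lam^-1 * x ord0 i + 2))); first exact: mflat.
by apply/funext => x; congr flat; ring.
Qed.

Definition bump_box : set V := rV_box (const_mx lam) (const_mx (2 * lam)).

Lemma bump_prod_box x : bump_prod x != 0 -> bump_box x.
Proof.
by move=> /bump_prod_support H i; have /andP[? ?] := H i; rewrite in_itv/= !mxE !ltW.
Qed.

Lemma lebesgue_bump_box : leb bump_box = (lam ^+ d)%:E.
Proof.
transitivity (\prod_(j < d) ((const_mx (2 * lam) : V) ord0 j - (const_mx lam : V) ord0 j))%:E.
  by apply: lebesgue_rV_box => j; rewrite !mxE; have := lam0; lra.
congr _%:E; rewrite (eq_bigr (fun=> lam)); first by rewrite prodr_const card_ord.
by move=> j _; rewrite !mxE; lra.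
Qed.

Lemma measurable_scaled_bump (c : R) : measurable_fun setT (fun x => c * bump_prod x).
Proof. by apply: measurable_funM => //; exact: measurable_bump_prod. Qed.

Lemma integral_scaled_bump_le (c : R) :
  (\int[leb]_x ((c * bump_prod x) ^+ 2)%:E <= (c ^+ 2 * lam ^+ d)%:E)%E.
Proof.
apply: (@le_trans _ _ (\int[leb]_x (c ^+ 2 * \1_bump_box x)%:E)%E); last first.
  rewrite (integral_mul_indic (cst (c ^+ 2))); last exact: measurable_rV_box.
  rewrite (integral_cst leb (measurable_rV_box _ _) (c ^+ 2)%:E).
  by rewrite [X in (_ * X)%E]lebesgue_bump_box -EFinM.
apply: ge0_le_integral => //.
- by move=> x _; rewrite lee_fin sqr_ge0.
- by apply/measurable_EFinP; apply: measurable_funX; exact: measurable_scaled_bump.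
- apply/measurable_EFinP; apply: measurable_funM => //; apply: measurable_indic.
  exact: measurable_rV_box.
move=> x _; rewrite lee_fin exprMn; have [->|x0] := eqVneq (bump_prod x) 0.
  by rewrite expr0n mulr0 mulr_ge0 ?sqr_ge0// indicE.
rewrite indicE mem_set ?mulr1; last exact: bump_prod_box.
by rewrite ler_piMr ?sqr_ge0// expr_le1 ?bump_prod_ge0 ?bump_prod_le1.
Qed.

Lemma scaled_bump_Lfun2 (c : R) : (fun x => c * bump_prod x) \in Lfun leb 2%:E.
Proof.
apply: square_integrable_Lfun; first exact: measurable_scaled_bump.
by apply: le_lt_trans (integral_scaled_bump_le c) _; rewrite ltry.
Qed.

Definition bump_L2 (c : R) : L2 R d := Lfun_Sub (lee1n 2) (scaled_bump_Lfun2 c).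

Lemma bump_Cc_infty c : Cc_infty (bump_L2 c).
Proof.
split=> [k|].
  rewrite (_ : (bump_L2 c : V -> R) = cst c \* (fun x => \prod_i bump (x ord0 i / lam)))//.
  apply: Ck_mul; first exact: Ck_cst.
  apply: Ck_prod => i.
  rewrite (_ : (fun x => _) = (fun x : V => flat 0 (lam^-1 * x ord0 i - 1)) \*
      (fun x : V => flat 0 (- lam^-1 * x ord0 i + 2))).
    by apply: Ck_mul; exact: Ck_flat.
  by apply/funext => x; rewrite /= /bump; congr (flat _ _ * flat _ _); ring.
have cb : compact bump_box.
  by apply: (@rV_compact R d (fun i => `[(const_mx lam : V) ord0 i,
    (const_mx (2 * lam) : V) ord0 i]%classic)) => i; exact: segment_compact.
have clb : closed bump_box by apply: compact_closed => //; exact: norm_hausdorff.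
apply: (subclosed_compact _ cb); first exact: closed_closure.
rewrite [X in _ `<=` X]((closure_id _).1 clb); apply: closureS => x /= fx.
by apply: bump_prod_box; apply: contra fx => /eqP ->; rewrite mulr0.
Qed.

Lemma bump_L2_norm_le c : inner (bump_L2 c) (bump_L2 c) <= c ^+ 2 * lam ^+ d.
Proof. by rewrite -lee_fin innerE; exact: integral_scaled_bump_le. Qed.

Lemma bump_L2_norm_ge c : (c ^+ 2 * (expR (- 8) ^+ 2 * (lam / 2)) ^+ d <= inner (bump_L2 c) (bump_L2 c)).
Proof.
pose core := rV_box (const_mx (5 / 4 * lam) : V) (const_mx (7 / 4 * lam)).
have mc : measurable core by exact: measurable_rV_box.
have lc : leb core = ((lam / 2) ^+ d)%:E.
  transitivity (\prod_(j < d) ((const_mx (7 / 4 * lam) : V) ord0 j - (const_mx (5 / 4 * lam) : V) ord0 j))%:E.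
    by apply: lebesgue_rV_box => j; rewrite !mxE; have := lam0; lra.
  congr _%:E; rewrite (eq_bigr (fun=> lam / 2)); first by rewrite prodr_const card_ord.
  by move=> j _; rewrite !mxE; lra.
rewrite -lee_fin innerE.
apply: (@le_trans _ _ (\int[leb]_x ((c ^+ 2 * (expR (- 8) ^+ 2) ^+ d) * \1_core x)%:E)%E).
  rewrite (integral_mul_indic (cst (c ^+ 2 * (expR (- 8) ^+ 2) ^+ d)))//.
  rewrite (integral_cst leb mc (c ^+ 2 * (expR (- 8) ^+ 2) ^+ d)%:E).
  by rewrite [X in (_ <= _ * X)%E]lc -EFinM lee_fin exprMn mulrA.
apply: ge0_le_integral => //.
- move=> x _; rewrite lee_fin indicE; apply: mulr_ge0 => //; apply: mulr_ge0; first exact: sqr_ge0.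
  by apply: exprn_ge0; exact: sqr_ge0.
- apply/measurable_EFinP; apply: measurable_funM => //; exact: measurable_indic.
- by apply/measurable_EFinP; apply: measurable_funM; exact: measurable_L2.
move=> x _; rewrite lee_fin [leRHS](_ : _ = c ^+ 2 * bump_prod x ^+ 2); last by rewrite /=; ring.
rewrite -mulrA ler_wpM2l ?sqr_ge0//.
rewrite indicE; case: (boolP (x \in core)) => [|_]; last by rewrite mulr0 sqr_ge0.
rewrite inE mulr1 => xc; rewrite -exprM mulnC exprM lerXn2r ?nnegrE ?bump_prod_ge0 ?exprn_ge0 ?expR_ge0//.
have -> : expR (- 8) ^+ d = \prod_(i < d) expR (- 8) :> R by rewrite prodr_const card_ord.
apply: ler_prod => i _; rewrite expR_ge0/=.
have := xc i; rewrite in_itv/= !mxE => /andP[x1 x2].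
by apply: bump_lower; [rewrite ler_pdivlMr|rewrite ler_pdivrMr].
Qed.

End bump_product.

(** * Dyadic majorants of the jump kernel *)

Section dyadic_majorant.
Context (R : realType) (d : nat).
Local Notation leb := (lebesgue_rV R d).
Local Notation V := 'rV[R]_d.

Lemma term_le_nneseries (f : nat -> \bar R) k : (forall n, 0 <= f n)%E ->
  (f k <= \sum_(0 <= n <oo) f n)%E.
Proof.
move=> f0; apply: le_trans (nneseries_lim_ge k.+1 (fun n _ _ => f0 n)).
by rewrite big_nat_recr//= leeDr// sume_ge0.
Qed.

Section weights.
Variables (a rad : nat -> R).
Hypotheses (a0 : forall k, 0 <= a k) (rad0 : forall k, 0 < rad k).

(** A step function on nested boxes around the diagonal. Its integrals are sums of
    volumes of boxes, and this takes the place of polar coordinates. *)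
Definition box_series (z : V * V) : \bar R :=
  (\sum_(0 <= k <oo) (a k * \1_[set z | box_around (rad k) z.1 z.2] z)%:E)%E.

Let term_ge0 k z : (0 <= (a k * \1_[set z : V * V | box_around (rad k) z.1 z.2] z)%:E)%E.
Proof. by rewrite lee_fin mulr_ge0// indicE. Qed.

Lemma box_series_ge0 z : (0 <= box_series z)%E.
Proof. by apply: nneseries_ge0 => k _ _; exact: term_ge0. Qed.

Lemma measurable_box_series : measurable_fun setT box_series.
Proof.
apply: ge0_emeasurable_sum => [k z _ _|k _]; first exact: term_ge0.
apply/measurable_EFinP; apply: measurable_funM => //; apply: measurable_indic.
exact: measurable_box_graph.
Qed.

Lemma box_series_ge k x y : box_around (rad k) x y -> ((a k)%:E <= box_series (x, y))%E.
Proof.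
move=> xy; apply: le_trans (term_le_nneseries k (fun n => term_ge0 n (x, y))).
by rewrite indicE mem_set// mulr1.
Qed.

Lemma integral_box_series x :
  (\int[leb]_y box_series (x, y) = \sum_(0 <= k <oo) (a k * (2 * rad k) ^+ d)%:E)%E.
Proof.
have indE k y : \1_[set z : V * V | box_around (rad k) z.1 z.2] (x, y) =
    \1_(box_around (rad k) x) y :> R.
  by rewrite !indicE; congr ((nat_of_bool _)%:R); apply/idP/idP; rewrite !inE.
rewrite (eq_integral (fun y => \sum_(0 <= k <oo) (a k * \1_(box_around (rad k) x) y)%:E)%E);
  last by move=> y _; apply: eq_eseriesr => k _; rewrite indE.
rewrite integral_nneseries//.
- apply: eq_eseriesr => k _; rewrite (integral_mul_indic (cst (a k))); last exact: measurable_box_around.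
  rewrite (integral_cst leb (measurable_box_around (rad k) x) (a k)%:E).
  by rewrite [X in (_ * X)%E]lebesgue_box_around// -EFinM.
- move=> k; apply/measurable_EFinP; apply: measurable_funM => //; apply: measurable_indic.
  exact: measurable_box_around.
- by move=> k y _; rewrite lee_fin mulr_ge0// indicE.
Qed.

End weights.

Section dyadic.
Variable gamma : R.
Hypothesis gamma0 : 0 < gamma.

Definition dyadic_ratio : R := 2^-1 `^ gamma.
Local Notation theta := dyadic_ratio.

Lemma dyadic_ratio_gt0 : 0 < theta.
Proof. by rewrite powR_gt0// invr_gt0. Qed.

Lemma dyadic_ratio_lt1 : theta < 1.
Proof.
have -> : 1 = 1 `^ gamma :> R by rewrite powR1.
by rewrite gt0_ltr_powR ?nnegrE// ?invr_ge0// invf_lt1// ltr1n.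
Qed.

Lemma dyadic_ratioX k : (2^-1 ^+ k) `^ gamma = theta ^+ k.
Proof.
rewrite /dyadic_ratio -[in RHS]powR_mulrn ?powR_ge0// -powRrM mulrC powRrM.
by rewrite powR_mulrn// invr_ge0.
Qed.

Lemma dyadic_geometric : (\sum_(0 <= k <oo) (4 ^+ d * theta ^+ k)%:E = (4 ^+ d / (1 - theta))%:E)%E.
Proof.
have t1 : `|theta| < 1 by rewrite gtr0_norm ?dyadic_ratio_gt0 ?dyadic_ratio_lt1.
have := @cvg_geometric_series R (4 ^+ d) theta t1 => c.
apply/cvg_lim => //.
have -> : (fun n => \sum_(0 <= k < n) (4 ^+ d * theta ^+ k)%:E)%E =
    EFin \o series (geometric (4 ^+ d) theta).
  by apply/funext => n; rewrite /= sumEFin.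
by apply: cvg_EFin => //; exact: nearW.
Qed.

(** With [near], the series dominates [s^(gamma - d)] for [s < 1], and with [far]
    it dominates [s^(- gamma - d)] for [1 <= s], where [s] is the distance to the
    diagonal: the [k]-th weight is the size of the function on the [k]-th dyadic
    shell, and the [k]-th box contains this shell. *)
Definition near_weight k : R := 2 ^+ (d * k.+1) * theta ^+ k.
Definition near_radius k : R := 2^-1 ^+ k.
Definition far_weight k : R := 2^-1 ^+ (d * k) * theta ^+ k.
Definition far_radius k : R := 2 ^+ k.+1.

Lemma near_weight_ge0 k : 0 <= near_weight k.
Proof. by rewrite mulr_ge0 ?exprn_ge0// ltW// dyadic_ratio_gt0. Qed.
Lemma far_weight_ge0 k : 0 <= far_weight k.
Proof. by rewrite mulr_ge0 ?exprn_ge0 ?invr_ge0// ltW// dyadic_ratio_gt0. Qed.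
Lemma near_radius_gt0 k : 0 < near_radius k.
Proof. by rewrite exprn_gt0// invr_gt0. Qed.
Lemma far_radius_gt0 k : 0 < far_radius k.
Proof. by rewrite exprn_gt0. Qed.

Let half2 k : 2 ^+ k * 2^-1 ^+ k = 1 :> R.
Proof. by rewrite -exprMn divff ?expr1n. Qed.

Lemma integral_near_series x :
  (\int[leb]_y box_series near_weight near_radius (x, y) = (4 ^+ d / (1 - theta))%:E)%E.
Proof.
rewrite integral_box_series//; [|exact: near_weight_ge0|exact: near_radius_gt0].
rewrite -dyadic_geometric; apply: eq_eseriesr => k _; congr _%:E.
rewrite /near_weight /near_radius mulnC exprM mulrAC; congr (_ * _).
rewrite -exprMn; congr (_ ^+ _); rewrite exprS.
by transitivity (4 * (2 ^+ k * 2^-1 ^+ k) : R); [ring|rewrite half2 mulr1].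
Qed.

Lemma integral_far_series x :
  (\int[leb]_y box_series far_weight far_radius (x, y) = (4 ^+ d / (1 - theta))%:E)%E.
Proof.
rewrite integral_box_series//; [|exact: far_weight_ge0|exact: far_radius_gt0].
rewrite -dyadic_geometric; apply: eq_eseriesr => k _; congr _%:E.
rewrite /far_weight /far_radius mulnC exprM mulrAC; congr (_ * _).
rewrite -exprMn; congr (_ ^+ _); rewrite exprS.
by transitivity (4 * (2 ^+ k * 2^-1 ^+ k) : R); [ring|rewrite half2 mulr1].
Qed.

Lemma box_around_enorm (r : R) (x y : V) : enorm (x - y) <= r -> box_around r x y.
Proof.
move=> xy; apply/box_aroundP => j; apply: le_trans xy.
by have := ler_coord_enorm (x - y) j; rewrite !mxE.
Qed.

Let cvg_half : (2^-1 ^+ n : R) @[n --> \oo] --> 0.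
Proof. by apply: cvg_expr; rewrite ger0_norm ?invr_ge0// invf_lt1// ltr1n. Qed.

Lemma near_series_ge (x y : V) : 0 < enorm (x - y) -> enorm (x - y) < 1 ->
  ((enorm (x - y) `^ gamma / enorm (x - y) ^+ d)%:E <= box_series near_weight near_radius (x, y))%E.
Proof.
set s := enorm _ => s0 s1.
have ex : exists k : nat, near_radius k.+1 <= s.
  have /cvgrPdist_le/(_ _ s0)[N _ NP] := cvg_half.
  exists N; have := NP N.+1 (leqnSn N).
  by rewrite sub0r normrN ger0_norm// exprn_ge0// invr_ge0.
have [k k1 kmin] := ex_minnP ex.
have k2 : s <= near_radius k.
  case: k k1 kmin => [|k] _ kmin; first by rewrite /near_radius expr0 ltW.
  by rewrite leNgt; apply/negP => /ltW/kmin; rewrite ltnn.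
apply: (@le_trans _ _ (near_weight k)%:E); last first.
  by apply: box_series_ge; [exact: near_weight_ge0|exact: box_around_enorm].
rewrite lee_fin /near_weight mulrC ler_pM ?powR_ge0 ?invr_ge0 ?exprn_ge0 ?(ltW s0)//.
  rewrite mulnC exprM -[leRHS]invrK lef_pV2 ?posrE ?invr_gt0 ?exprn_gt0//.
  by rewrite -exprVn lerXn2r ?nnegrE ?exprn_ge0 ?invr_ge0 ?(ltW s0)// -exprVn.
rewrite -dyadic_ratioX; apply: ge0_ler_powR; rewrite ?nnegrE ?(ltW gamma0) ?(ltW s0)//.
Qed.

Lemma far_series_ge (x y : V) : 1 <= enorm (x - y) ->
  (((enorm (x - y) `^ gamma)^-1 / enorm (x - y) ^+ d)%:E <= box_series far_weight far_radius (x, y))%E.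
Proof.
set s := enorm _ => s1; have s0 : 0 < s by apply: lt_le_trans s1.
have ex : exists k : nat, s <= far_radius k.
  have si : 0 < s^-1 by rewrite invr_gt0.
  have /cvgrPdist_le/(_ _ si)[N _ NP] := cvg_half.
  exists N; have := NP N.+1 (leqnSn N).
  rewrite sub0r normrN ger0_norm; last by rewrite exprn_ge0// invr_ge0.
  by rewrite exprVn lef_pV2 ?posrE ?exprn_gt0.
have [k k1 kmin] := ex_minnP ex.
have k2 : 2 ^+ k <= s.
  case: k k1 kmin => [|k] _ kmin; first by rewrite expr0.
  by rewrite leNgt; apply/negP => /ltW/kmin; rewrite ltnn.
apply: (@le_trans _ _ (far_weight k)%:E); last first.
  by apply: box_series_ge; [exact: far_weight_ge0|exact: box_around_enorm].
have p0 : 0 < (2 ^+ k : R) `^ gamma by rewrite powR_gt0// exprn_gt0.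
have g1 : (s `^ gamma)^-1 <= theta ^+ k.
  have -> : theta ^+ k = ((2 ^+ k : R) `^ gamma)^-1.
    apply: (mulIf (lt0r_neq0 p0)); rewrite mulVf ?gt_eqF// -dyadic_ratioX -powRM ?exprn_ge0 ?invr_ge0//.
    by rewrite mulrC half2 powR1.
  rewrite lef_pV2 ?posrE ?powR_gt0//.
  by apply: ge0_ler_powR; rewrite ?nnegrE ?(ltW gamma0) ?(ltW s0) ?exprn_ge0.
have g2 : (s ^+ d)^-1 <= 2^-1 ^+ (d * k).
  rewrite mulnC exprM exprVn exprVn lef_pV2 ?posrE ?exprn_gt0//.
  by rewrite lerXn2r ?nnegrE ?exprn_ge0 ?(ltW s0).
rewrite lee_fin /far_weight mulrC; apply: ler_pM => //; first by rewrite invr_ge0 exprn_ge0// ltW.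
by rewrite invr_ge0 powR_ge0.
Qed.

End dyadic.
End dyadic_majorant.

(** * Energy of the scaled bumps *)

Section bump_energy.
Context (R : realType) (d : nat) (alpha q : R).
Variable W : 'rV[R]_d * 'rV[R]_d -> R.
Hypothesis mW : measurable_fun setT W.
Hypothesis W0 : forall z, 0 <= W z.
Hypothesis Wsym : forall x y, W (x, y) = W (y, x).
Hypothesis d_gt0 : (0 < d)%N.
Hypotheses (qalpha : q < alpha) (alpha2 : alpha < 2).
Local Notation leb := (lebesgue_rV R d).
Local Notation V := 'rV[R]_d.
Local Notation J := (jump_kernel alpha W).
Local Notation energy := (@energy R d alpha W).
Variables (K1 K2 lam c : R).
Hypotheses (K10 : 0 <= K1) (K20 : 0 <= K2) (lam0 : 0 < lam).
Hypothesis Wnear : forall x y : V, bump_box lam x -> enorm (x - y) < 1 -> W (x, y) <= K1 * lam ^+ 2.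
Hypothesis Wfar : forall x y : V, bump_box lam x -> 1 <= enorm (x - y) ->
  W (x, y) <= K2 * Num.max lam (enorm (x - y)) `^ q.

Let near0 : 0 < 2 - alpha. Proof. by rewrite subr_gt0. Qed.
Let far0 : 0 < alpha - q. Proof. by rewrite subr_gt0. Qed.

Let M (z : V * V) := (box_series (near_weight d (2 - alpha)) (near_radius R) z +
  box_series (far_weight d (alpha - q)) (far_radius R) z)%E.

Let f := bump_L2 d lam0 c.
Let K := 16 * d%:R ^+ 2 * (K1 + K2).

Let K0 : 0 <= K. Proof. by rewrite mulr_ge0 ?addr_ge0// mulr_ge0 ?sqr_ge0. Qed.

Let N0 (z : V * V) : (0 <= box_series (near_weight d (2 - alpha)) (near_radius R) z)%E.
Proof. by apply: box_series_ge0 => k; exact: near_weight_ge0. Qed.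

Let F0 (z : V * V) : (0 <= box_series (far_weight d (alpha - q)) (far_radius R) z)%E.
Proof. by apply: box_series_ge0 => k; exact: far_weight_ge0. Qed.

Let M0 (z : V * V) : (0 <= M z)%E. Proof. exact: adde_ge0. Qed.

Let mM : measurable_fun setT M.
Proof.
apply: emeasurable_funD; apply: measurable_box_series => k; [exact: near_weight_ge0|exact: far_weight_ge0].
Qed.

Lemma jump_kernel_sym x y : J (x, y) = J (y, x).
Proof. by rewrite /jump_kernel /= enorm_distC Wsym. Qed.

(** For jumps of length [s < 1], the Lipschitz bound [(s / lam)^2] meets a weight
    of order [lam^2]. For [1 <= s <= lam], it meets [lam^q], and
    [(s / lam)^2 lam^q <= s^q] because [q <= 2]. For [lam < s], boundedness is
    enough. *)
Lemma bump_increment_pointwise x y : bump_box lam x ->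
  (((f x - f y) ^+ 2 * J (x, y))%:E <= (c ^+ 2 * K)%:E * M (x, y))%E.
Proof.
move=> Sx; have cK : 0 <= c ^+ 2 * K by rewrite mulr_ge0 ?sqr_ge0.
have [->|xy] := eqVneq x y.
  by rewrite subrr expr0n mul0r mule_ge0.
have s0 : 0 < enorm (x - y).
  rewrite lt_neqAle enorm_ge0 andbT eq_sym.
  by apply: contra xy => /eqP/enorm_eq0/eqP; rewrite subr_eq0.
have fxy : (f x - f y) ^+ 2 = c ^+ 2 * (bump_prod lam x - bump_prod lam y) ^+ 2.
  by rewrite -[LHS]/((c * bump_prod lam x - c * bump_prod lam y) ^+ 2); ring.
have lip : (bump_prod lam x - bump_prod lam y) ^+ 2 <= 16 * d%:R ^+ 2 * (enorm (x - y) / lam) ^+ 2.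
  rewrite -real_normK ?num_real//.
  have -> : 16 * d%:R ^+ 2 * (enorm (x - y) / lam) ^+ 2 =
      (4 * d%:R * (enorm (x - y) / lam)) ^+ 2 :> R by ring.
  rewrite lerXn2r ?nnegrE//; last exact: bump_prod_lipschitz.
  by rewrite !mulr_ge0// ?invr_ge0 ltW.
have d2 : 1 <= 16 * d%:R ^+ 2 :> R.
  have : 1 <= d%:R ^+ 2 :> R by rewrite exprn_ege1// ler1n.
  lra.
have bd : (bump_prod lam x - bump_prod lam y) ^+ 2 <= 16 * d%:R ^+ 2.
  apply: le_trans d2; rewrite -real_normK ?num_real// expr_le1// ler_norml.
  have := bump_prod_ge0 lam x; have := bump_prod_le1 lam x.
  have := bump_prod_ge0 lam y; have := bump_prod_le1 lam y.
  by move=> ? ? ? ?; apply/andP; split; lra.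
have sd : enorm (x - y) `^ (d%:R + alpha) = enorm (x - y) ^+ d * enorm (x - y) `^ alpha.
  by rewrite powRD ?powR_mulrn ?(ltW s0)// (gt_eqF s0) implybT.
have sa0 : 0 < enorm (x - y) `^ alpha by exact: powR_gt0.
have sd0 : 0 < enorm (x - y) ^+ d by exact: exprn_gt0.
set s := enorm (x - y) in s0 lip sd sa0 sd0 *.
have P0 : 0 <= (s ^+ d * s `^ alpha)^-1 by rewrite invr_ge0 mulr_ge0 ?ltW.
have [s1|s1] := ltP s 1.
  apply: (@le_trans _ _ ((c ^+ 2 * K)%:E * (s `^ (2 - alpha) / s ^+ d)%:E)%E); last first.
    apply: lee_wpmul2l; first by rewrite lee_fin.
    by apply: le_trans (near_series_ge near0 s0 s1) _; rewrite leeDl.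
  have sp : s ^+ 2 = s `^ (2 - alpha) * s `^ alpha.
    by rewrite -powRD ?subrK ?powR_mulrn ?(ltW s0)// (gt_eqF s0) implybT.
  rewrite -EFinM lee_fin fxy -[leLHS]mulrA -[leRHS]mulrA ler_wpM2l ?sqr_ge0// /jump_kernel/= -/s sd.
  apply: (@le_trans _ _ (16 * d%:R ^+ 2 * (s / lam) ^+ 2 * (K1 * lam ^+ 2 / (s ^+ d * s `^ alpha)))).
    apply: ler_pM => //; first exact: sqr_ge0.
      by rewrite mulr_ge0.
    by rewrite ler_wpM2r// Wnear.
  rewrite (_ : 16 * _ * _ * _ = 16 * d%:R ^+ 2 * K1 * (s `^ (2 - alpha) / s ^+ d)); last first.
    rewrite expr_div_n sp; field.
    by rewrite !gt_eqF.
  rewrite /K !mulrA ler_wpM2r ?invr_ge0 ?(ltW sd0)// ler_wpM2r ?powR_ge0//.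
  by rewrite ler_wpM2l ?lerDl// mulr_ge0 ?sqr_ge0.
apply: (@le_trans _ _ ((c ^+ 2 * K)%:E * ((s `^ (alpha - q))^-1 / s ^+ d)%:E)%E); last first.
  apply: lee_wpmul2l; first by rewrite lee_fin.
  by apply: le_trans (far_series_ge far0 s1) _; rewrite leeDr.
have sp : s `^ alpha = s `^ (alpha - q) * s `^ q.
  by rewrite -powRD ?subrK// (gt_eqF s0) implybT.
have key : (bump_prod lam x - bump_prod lam y) ^+ 2 * Num.max lam s `^ q <= 16 * d%:R ^+ 2 * s `^ q.
  have [sl|ls] := leP s lam; last by rewrite ler_wpM2r ?powR_ge0.
  apply: (@le_trans _ _ (16 * d%:R ^+ 2 * (s / lam) ^+ 2 * lam `^ q)).
    by rewrite ler_wpM2r ?powR_ge0.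
  rewrite -mulrA ler_wpM2l ?mulr_ge0 ?sqr_ge0//.
  have u0 : 0 < s / lam by rewrite divr_gt0.
  have u1 : s / lam <= 1 by rewrite ler_pdivrMr// mul1r.
  have -> : s `^ q = (s / lam) `^ q * lam `^ q.
    by rewrite -powRM ?divfK ?gt_eqF// ltW.
  rewrite ler_wpM2r ?powR_ge0// -powR_mulrn ?(ltW u0)//.
  by rewrite ger_powR ?u0// ltW// (lt_trans qalpha).
rewrite -EFinM lee_fin fxy -[leLHS]mulrA -[leRHS]mulrA ler_wpM2l ?sqr_ge0// /jump_kernel/= -/s sd.
apply: (@le_trans _ _ ((bump_prod lam x - bump_prod lam y) ^+ 2 *
    (K2 * Num.max lam s `^ q / (s ^+ d * s `^ alpha)))).
  by rewrite ler_wpM2l ?sqr_ge0// ler_wpM2r// Wfar.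
apply: (@le_trans _ _ (K2 * (16 * d%:R ^+ 2 * s `^ q) / (s ^+ d * s `^ alpha))).
  by rewrite mulrA ler_wpM2r// mulrCA ler_wpM2l.
have sq0 : 0 < s `^ q by exact: powR_gt0.
have saq0 : 0 < s `^ (alpha - q) by exact: powR_gt0.
rewrite sp (_ : K2 * _ / _ = 16 * d%:R ^+ 2 * K2 * ((s `^ (alpha - q))^-1 / s ^+ d)); last first.
  by field; rewrite !gt_eqF.
rewrite /K !mulrA ler_wpM2r ?invr_ge0 ?(ltW sd0)// ler_wpM2r ?invr_ge0 ?powR_ge0//.
by rewrite ler_wpM2l ?lerDr// mulr_ge0 ?sqr_ge0.
Qed.

Definition bump_energy_const : R :=
  2 * K * (4 ^+ d / (1 - dyadic_ratio (2 - alpha)) + 4 ^+ d / (1 - dyadic_ratio (alpha - q))).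

(** The increment vanishes unless one of its two points lies in the box that
    carries the bump. Fixing this point and integrating over the other one gives a
    factor independent of the scale, and the box contributes its volume
    [lam ^+ d]. *)
Theorem bump_energy : (energy f f <= (c ^+ 2 * lam ^+ d * bump_energy_const)%:E)%E.
Proof.
have mS : measurable (bump_box lam : set V) by exact: measurable_rV_box.
have [G GE] : exists G : V * V -> \bar R,
    forall z, G z = ((c ^+ 2 * K)%:E * ((\1_(bump_box lam) z.1)%:E * M z))%E by eexists.
have i0 (x : V) : (0 <= (\1_(bump_box lam) x : R)%:E)%E by rewrite lee_fin indicE.
have cK : (0 <= (c ^+ 2 * K)%:E)%E by rewrite lee_fin mulr_ge0 ?sqr_ge0.
have G0 z : (0 <= G z)%E by rewrite GE; apply: mule_ge0 => //; exact: mule_ge0.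
have mi : measurable_fun setT (fun z : V * V => (\1_(bump_box lam) z.1 : R)%:E).
  by apply/measurable_EFinP; apply: (measurableT_comp _ measurable_fst); exact: measurable_indic.
have mG : measurable_fun setT G.
  by rewrite (funext GE); apply: measurable_funeM; exact: emeasurable_funM.
have mGs : measurable_fun setT (fun z => G (z.2, z.1)).
  by apply: (measurableT_comp mG); exact: measurable_fun_pair.
apply: (@le_trans _ _ (\int[leb \x leb]_z (G z + G (z.2, z.1)))%E).
  rewrite energy_sqE; apply: ge0_le_integral => //.
  - by move=> z _; rewrite lee_fin mulr_ge0 ?sqr_ge0 ?jump_kernel_ge0.
  - by apply: measurable_energy_sq => //; exact: measurable_L2.
  - exact: emeasurable_funD.
  move=> [x y] _; have [Sx|Sx] := pselect (bump_box lam x).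
    apply: (@le_trans _ _ (G (x, y))); last by rewrite leeDl.
    by rewrite GE /= indicE mem_set// mul1e; exact: bump_increment_pointwise.
  have [Sy|Sy] := pselect (bump_box lam y).
    apply: (@le_trans _ _ (G (y, x))); last by rewrite leeDr.
    rewrite GE /= indicE mem_set// mul1e jump_kernel_sym -sqrrN opprB.
    exact: bump_increment_pointwise.
  have z0 (x' : V) : ~ bump_box lam x' -> f x' = 0.
    move=> Sx'; rewrite -[LHS]/(c * bump_prod lam x').
    have [->|/bump_prod_box Sx''] := eqVneq (bump_prod lam x') 0; first exact: mulr0.
    by case: (Sx' (Sx'' lam0)).
  change (((f x - f y) ^+ 2 * J (x, y))%:E <= G (x, y) + G (y, x))%E.
  by rewrite (z0 x)// (z0 y)// subrr expr0n mul0r adde_ge0.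
rewrite ge0_integralD// integral_swap// (_ : \int[_]_z G z = (c ^+ 2 * K * lam ^+ d *
    (4 ^+ d / (1 - dyadic_ratio (2 - alpha)) + 4 ^+ d / (1 - dyadic_ratio (alpha - q))))%:E)%E.
  by rewrite -EFinD lee_fin /bump_energy_const le_eqVlt; apply/orP; left; apply/eqP; ring.
rewrite fubini_tonelli1//.
transitivity (\int[leb]_x ((c ^+ 2 * K * (4 ^+ d / (1 - dyadic_ratio (2 - alpha)) +
    4 ^+ d / (1 - dyadic_ratio (alpha - q)))) * \1_(bump_box lam) x)%:E)%E.
  apply: eq_integral => x _; rewrite /fubini_F; under eq_integral do rewrite GE /=.
  have mMx : measurable_fun setT (fun y => M (x, y)).
    by apply: (measurableT_comp mM); exact: measurable_fun_pair.
  rewrite ge0_integralZl//; last 2 first.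
  - by apply: measurable_funeM.
  - by move=> y _; exact: mule_ge0.
  rewrite ge0_integralZl// /M ge0_integralD//; last 2 first.
  - apply: (measurableT_comp (measurable_box_series _ _)); last exact: measurable_fun_pair.
    by move=> k; exact: near_weight_ge0.
  - apply: (measurableT_comp (measurable_box_series _ _)); last exact: measurable_fun_pair.
    by move=> k; exact: far_weight_ge0.
  by rewrite integral_near_series// integral_far_series// -EFinD -!EFinM [X in (_ * X)%:E]mulrC mulrA.
rewrite (integral_mul_indic (cst _))// (integral_cst leb mS (_)%:E).
by rewrite [X in (_ * X)%E]lebesgue_bump_box// -EFinM mulrAC.
Qed.

End bump_energy.

(** * A criterion against compactness *)

Section not_compact.
Context (R : realType) (d : nat) (alpha : R).
Variable W : 'rV[R]_d * 'rV[R]_d -> R.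
Hypothesis mW : measurable_fun setT W.
Hypothesis W0 : forall z, 0 <= W z.
Variable P : R -> L2 R d -> L2 R d.
Hypothesis hPW : semigroup_of_form alpha W P.
Local Notation energy := (@energy R d alpha W).

(** For small [t], [P t] moves each [phi n] by at most [sqrt nu / 4], while any two
    of them are at distance at least [sqrt (2 * nu)]; so no subsequence of
    [P t (phi n)] is Cauchy. *)
Theorem orthogonal_bounded_energy_not_compact (phi : nat -> L2 R d) (e nu : R) :
  0 <= e -> 0 < nu ->
  (forall n, form_closure alpha W (phi n)) ->
  (forall n, (energy (phi n) (phi n) <= e%:E)%E) ->
  L2_bounded phi ->
  (forall n, nu <= inner (phi n) (phi n)) ->
  (forall n m, n != m -> inner (phi n) (phi m) = 0) ->
  ~ compact_semigroup P.
Proof.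
move=> e0 nu0 Fphi Ephi bphi nuphi ophi cP.
pose t := nu / (16 * (e + 1)); pose r := Num.sqrt nu / 4.
have e1 : 0 < e + 1 by lra.
have t0 : 0 < t by rewrite divr_gt0// mulr_gt0.
have r0 : 0 < r by rewrite divr_gt0// sqrtr_gt0.
have r2 : r ^+ 2 = nu / 16 by rewrite expr_div_n sqr_sqrtr ?ltW//; congr (_ / _); ring.
have small n : L2norm (phi n - P t (phi n)) <= r.
  rewrite -(ler_pXn2r (isT : (0 < 2)%N)) ?nnegrE ?L2norm_ge0 ?(ltW r0)// L2norm_distC.
  apply: le_trans (form_displacement_sqr mW W0 hPW (ltW t0) (Fphi n) (Ephi n)) _.
  rewrite r2 /t -mulrA ler_wpM2l ?(ltW nu0)// invfM -mulrA ler_piMr ?invr_ge0//.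
  by rewrite ler_pdivrMl// mulr1; lra.
have far n m : n != m -> 2 * nu <= L2norm (phi n - phi m) ^+ 2.
  move=> nm; rewrite L2norm_sqr innerBl !innerBr (ophi n m)// (ophi m n) 1?eq_sym//.
  by have := nuphi n; have := nuphi m; lra.
have [s [incs [g cg]]] := cP t t0 phi bphi.
have r20 : 0 < r / 2 by lra.
have /cvgrPdist_le/(_ _ r20)[N _ NP] := cg.
have near n : (N <= n)%N -> L2norm (P t (phi (s n)) - g) <= r / 2.
  by move=> /NP; rewrite /= sub0r normrN ger0_norm ?L2norm_ge0.
have sn : s N != s N.+1 by rewrite neq_lt !(leW_mono incs) ltEnat/= ltnSn.
have := far _ _ sn; apply/negP; rewrite -ltNge.
apply: (@le_lt_trans _ _ ((3 * r) ^+ 2)); last by rewrite exprMn r2; lra.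
rewrite lerXn2r ?nnegrE ?L2norm_ge0 ?mulr_ge0 ?(ltW r0)//.
set a := s N; set b := s N.+1.
have -> : phi a - phi b = (phi a - P t (phi a)) + (P t (phi a) - g) -
    ((phi b - P t (phi b)) + (P t (phi b) - g)).
  by rewrite !addrA !subrK opprB addrA subrK.
apply: le_trans (L2normB _ _) _.
have := L2normD (phi a - P t (phi a)) (P t (phi a) - g).
have := L2normD (phi b - P t (phi b)) (P t (phi b) - g).
have := small a; have := small b.
have := near N (leqnn N); have := near N.+1 (leqnSn N); rewrite -/a -/b.
lra.
Qed.

End not_compact.

(** * Growth of the weight *)

Section growth.
Context (R : realType) (d : nat).
Local Notation V := 'rV[R]_d.
Implicit Types U : V -> R.

Lemma locally_bounded_compact U (K : set V) : locally_bounded U -> compact K ->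
  exists A : R, forall x, K x -> U x <= A.
Proof.
move=> lU /compact_near_coveringP cK.
have [|A [_ HA]] := cK R (+oo : set_system R) (fun M x => `|U x| <= M) _.
  move=> x _; have [B [Br BP]] := lU x.
  exists ([set y | `|U y| <= B + 1], [set M | B + 1 <= M]) => /=.
    by split; [apply: BP; rewrite ltrDl|exact/nbhs_pinfty_ge/num_real].
  by move=> [y M] /= [] => /le_trans; exact.
exists (A + 1) => x Kx; apply: le_trans (ler_norm _) _.
by apply: (HA (A + 1)) => //; rewrite ltrDl.
Qed.

Lemma quadratic_lower_growth U :
  limf_einf (fun x => (U x / enorm x ^+ 2)%:E) (@enorm_infty R d) = +oo%E ->
  forall A : R, exists2 r : R, 0 <= r & forall x, r < enorm x -> A * enorm x ^+ 2 <= U x.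
Proof.
move=> Uoo A.
have : (limf_esup (fun x => - (U x / enorm x ^+ 2)%:E) (@enorm_infty R d) < (- A)%:E)%E.
  by move: Uoo; rewrite /limf_einf; case: limf_esup => //= _; rewrite ltNyr.
move=> /ereal_inf_lt[_ [S [M _ MS] <-]] SA.
exists (Num.max M 0) => [|x]; first by rewrite le_max lexx orbT.
rewrite gt_max => /andP[Mx x0].
have : (- (U x / enorm x ^+ 2)%:E <= (- A)%:E)%E.
  by apply: le_trans (ltW SA); apply: ereal_sup_ubound; exists x => //; exact: MS.
by rewrite -EFinN lee_fin lerN2 ler_pdivlMr// exprn_gt0.
Qed.

(** Beyond some radius the upper limit bounds the quotient; inside, local
    boundedness and compactness bound the function itself. *)
Lemma quadratic_upper_growth U : locally_bounded U ->
  (limf_esup (fun x => (U x / enorm x ^+ 2)%:E) (@enorm_infty R d) < +oo)%E ->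
  exists2 A : R, 0 <= A & forall x, U x <= A * (1 + enorm x ^+ 2).
Proof.
move=> lU /ereal_inf_lt[_ [S [M _ MS] <-]] Soo.
have [A SA] : exists A : R, (ereal_sup [set (U x / enorm x ^+ 2)%:E | x in S] <= A%:E)%E.
  by move: Soo; case: (ereal_sup _) => [A _|//|_]; [exists A|exists 0; rewrite leNye].
pose r := Num.max M 0.
have [B UB] : exists B : R, forall x : V, (forall i, x ord0 i \in `[- r, r]) -> U x <= B.
  apply: (locally_bounded_compact (K := [set x | _]) lU).
  by apply: (@rV_compact R d (fun=> `[- r, r]%classic)) => i; exact: segment_compact.
exists (`|A| + `|B|) => [|x]; first by rewrite addr_ge0.
have [xr|rx] := leP (enorm x) r.
  apply: (@le_trans _ _ `|B|).
    apply: le_trans (ler_norm _); apply: UB => i.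
    by rewrite in_itv/= -ler_norml (le_trans (ler_coord_enorm x i)).
  have x0 : 0 <= enorm x ^+ 2 by exact: sqr_ge0.
  by have := normr_ge0 A; have := normr_ge0 B; nra.
move: rx; rewrite gt_max => /andP[Mx x0].
have x20 : 0 < enorm x ^+ 2 by exact: exprn_gt0.
have : ((U x / enorm x ^+ 2)%:E <= A%:E)%E.
  by apply: le_trans SA; apply: ereal_sup_ubound; exists x => //; exact: MS.
rewrite lee_fin ler_pdivrMr// => Ux; apply: le_trans Ux _.
by have := ler_norm A; have := normr_ge0 A; have := normr_ge0 B; nra.
Qed.

End growth.

(** * The sequence of scaled bumps *)

Section bump_sequence.
Context (R : realType) (d : nat).
Hypothesis d_gt0 : (0 < d)%N.
Local Notation V := 'rV[R]_d.

Lemma bump_prod_disjoint (lam mu : R) (x : V) : 0 < lam -> 0 < mu ->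
  2 * lam <= mu -> bump_prod lam x * bump_prod mu x = 0.
Proof.
move=> lam0 mu0 lm.
have [->|x1] := eqVneq (bump_prod lam x) 0; first exact: mul0r.
have [->|x2] := eqVneq (bump_prod mu x) 0; first exact: mulr0.
have := bump_prod_support lam0 x1 (Ordinal d_gt0) => /andP[_ h1].
have := bump_prod_support mu0 x2 (Ordinal d_gt0) => /andP[h2 _].
by have := lt_trans h2 h1; rewrite ltNge lm.
Qed.

Let lam n : R := 4 ^+ n.
Let lam_gt0 n : 0 < lam n. Proof. exact: exprn_gt0. Qed.

(** The ratio 4 of consecutive scales separates the supports, and the factor makes
    the norms independent of the scale. *)
Definition spread_bump n : L2 R d := bump_L2 d (lam_gt0 n) (Num.sqrt (lam n ^+ d))^-1.

Lemma spread_bump_scale n : (Num.sqrt (lam n ^+ d))^-1 ^+ 2 * lam n ^+ d = 1.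
Proof.
by rewrite exprVn sqr_sqrtr ?mulVf ?gt_eqF ?exprn_ge0 ?exprn_gt0// ltW.
Qed.

Lemma spread_bump_bounded : L2_bounded spread_bump.
Proof.
exists 1 => n; rewrite -(ler_pXn2r (isT : (0 < 2)%N)) ?nnegrE ?L2norm_ge0// expr1n.
by rewrite L2norm_sqr -(spread_bump_scale n); exact: bump_L2_norm_le.
Qed.

Lemma spread_bump_norm_ge n :
  (expR (- 8) ^+ 2 / 2) ^+ d <= inner (spread_bump n) (spread_bump n).
Proof.
have := bump_L2_norm_ge d (lam_gt0 n) (Num.sqrt (lam n ^+ d))^-1.
by rewrite [X in _ * X ^+ d <= _]mulrCA exprMn mulrA spread_bump_scale mul1r.
Qed.

Lemma spread_bump_orthogonal n m : n != m -> inner (spread_bump n) (spread_bump m) = 0.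
Proof.
have ortho_lt a b : (a < b)%N -> inner (spread_bump a) (spread_bump b) = 0.
  move=> ab; apply: EFin_inj; rewrite innerE; apply: integral0_eq => x _; congr EFin.
  change ((Num.sqrt (lam a ^+ d))^-1 * bump_prod (lam a) x *
    ((Num.sqrt (lam b ^+ d))^-1 * bump_prod (lam b) x) = 0).
  rewrite mulrACA bump_prod_disjoint ?mulr0//.
  rewrite /lam -(subnKC ab) exprD exprS mulrAC ler_wpM2r ?exprn_ge0//.
  have : 1 <= 4 ^+ (b - a.+1) :> R by rewrite exprn_ege1// ler1n.
  lra.
by rewrite neq_ltn => /orP[nm|mn]; [exact: ortho_lt|rewrite innerC; exact: ortho_lt].
Qed.

End bump_sequence.

(** * The two-scale weight *)

Section two_scale.
Context (R : realType) (d : nat) (q c1 : R).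
Variables U1 U2 : 'rV[R]_d -> R.
Local Notation W := (two_scale_weight U1 U2).
Local Notation V := 'rV[R]_d.
Hypothesis U10 : forall x, 0 <= U1 x.
Hypothesis U20 : forall x, 0 <= U2 x.

Lemma two_scale_weight_ge0 z : 0 <= W z.
Proof. by rewrite /two_scale_weight; case: ifP => _; rewrite addr_ge0. Qed.

Lemma two_scale_weight_sym (x y : V) : W (x, y) = W (y, x).
Proof. by rewrite /two_scale_weight /= enorm_distC [U1 x + _]addrC [U2 x + _]addrC. Qed.

Lemma two_scale_weight_near (x y : V) : enorm (x - y) < 1 -> W (x, y) = U1 x + U1 y.
Proof. by rewrite /two_scale_weight /= => ->. Qed.

Lemma two_scale_weight_far (x y : V) : 1 <= enorm (x - y) -> W (x, y) = U2 x + U2 y.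
Proof. by rewrite /two_scale_weight /= leNgt => /negbTE ->. Qed.

Lemma two_scale_weight_near_ge (x y : V) : enorm (x - y) < 1 ->
  inf (range U1) <= W (x, y).
Proof.
move=> xy; rewrite two_scale_weight_near//.
have lb : has_lbound (range U1) by exists 0 => _ [z _ <-].
by rewrite -[leLHS]addr0 lerD//; apply: ge_inf => //; exists x.
Qed.

Lemma two_scale_weight_quadratic :
  limf_einf (fun x => (U1 x / enorm x ^+ 2)%:E) (@enorm_infty R d) = +oo%E ->
  forall mu : R, 0 <= mu -> exists2 r : R, 0 <= r &
  forall (i : 'I_d) (x y : V), enorm (x - y) < 1 -> r < `|x ord0 i| ->
  (mu * x ord0 i) ^+ 2 <= W (x, y) /\ (mu * x ord0 i) ^+ 2 <= W (y, x).
Proof.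
move=> Uoo mu mu0; have [r r0 rP] := quadratic_lower_growth Uoo (mu ^+ 2).
exists r => // i x y xy rx; rewrite (two_scale_weight_sym y x).
suff : (mu * x ord0 i) ^+ 2 <= W (x, y) by [].
rewrite two_scale_weight_near// -[leLHS]addr0 lerD//.
apply: le_trans (rP x (lt_le_trans rx (ler_coord_enorm x i))).
rewrite exprMn ler_wpM2l ?sqr_ge0// -(real_normK (num_real (x ord0 i))).
by rewrite lerXn2r ?nnegrE ?enorm_ge0// ler_coord_enorm.
Qed.

Lemma bump_box_enorm (lam : R) (x : V) : 0 < lam -> bump_box lam x -> enorm x <= d%:R * (2 * lam).
Proof.
move=> lam0 xb; apply: enorm_le_bound => [|i]; first by lra.
by have := xb i; rewrite in_itv/= !mxE ler_norml => /andP[? ?]; apply/andP; split; lra.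
Qed.

Lemma bump_box_enorm_dist (lam s : R) (x y : V) : 0 < lam -> bump_box lam x ->
  enorm (x - y) <= s -> enorm y <= d%:R * (2 * lam + s).
Proof.
move=> lam0 xb xy; apply: enorm_le_bound => [|i].
  by have := enorm_ge0 (x - y); lra.
have := ler_coord_enorm (x - y) i; rewrite !mxE ler_norml => /andP[? ?].
by have := xb i; rewrite in_itv/= !mxE ler_norml => /andP[? ?]; apply/andP; split; lra.
Qed.

Lemma two_scale_weight_near_le (A lam : R) : 0 <= A -> 1 <= lam ->
  (forall x, U1 x <= A * (1 + enorm x ^+ 2)) ->
  forall x y : V, bump_box lam x -> enorm (x - y) < 1 ->
  W (x, y) <= A * (2 + 13 * d%:R ^+ 2) * lam ^+ 2.
Proof.
move=> A0 lam1 UA x y xb xy; have lam0 : 0 < lam by lra.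
rewrite two_scale_weight_near//; apply: le_trans (lerD (UA x) (UA y)) _.
rewrite -mulrDr -mulrA ler_wpM2l//.
have x2 : enorm x ^+ 2 <= (d%:R * (2 * lam)) ^+ 2.
  by rewrite lerXn2r ?nnegrE ?enorm_ge0 ?mulr_ge0 ?(ltW lam0)//; exact: bump_box_enorm.
have y2 : enorm y ^+ 2 <= (d%:R * (3 * lam)) ^+ 2.
  rewrite lerXn2r ?nnegrE ?enorm_ge0 ?mulr_ge0 ?(ltW lam0)//.
  apply: le_trans (bump_box_enorm_dist lam0 xb (ltW xy)) _.
  by rewrite ler_wpM2l//; lra.
have l2 : 1 <= lam ^+ 2 by rewrite exprn_ege1.
move: x2 y2; rewrite !exprMn => x2 y2; lra.
Qed.

Lemma two_scale_weight_far_le (lam : R) : 0 <= c1 -> 0 <= q -> 1 <= lam ->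
  (forall x, U2 x <= c1 * (1 + enorm x) `^ q) ->
  forall x y : V, bump_box lam x -> 1 <= enorm (x - y) ->
  W (x, y) <= 2 * c1 * (1 + 3 * d%:R) `^ q * Num.max lam (enorm (x - y)) `^ q.
Proof.
move=> c10 q0 lam1 Uq x y xb xy; have lam0 : 0 < lam by lra.
rewrite two_scale_weight_far//; set m := Num.max _ _.
have lm : lam <= m by rewrite /m le_max lexx.
have sm : enorm (x - y) <= m by rewrite /m le_max lexx orbT.
have d0 : 0 <= d%:R :> R by [].
have m0 : 0 <= m by lra.
have dm : 0 <= d%:R * m by exact: mulr_ge0.
have dlm : d%:R * lam <= d%:R * m by rewrite ler_wpM2l.
have bound z : enorm z <= d%:R * (3 * m) -> U2 z <= c1 * ((1 + 3 * d%:R) `^ q * m `^ q).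
  move=> zm; apply: le_trans (Uq z) _; rewrite ler_wpM2l// -powRM//.
  by apply: ge0_ler_powR => //; rewrite ?nnegrE; have := enorm_ge0 z; lra.
have xm : enorm x <= d%:R * (3 * m).
  by apply: le_trans (bump_box_enorm lam0 xb) _; lra.
have ym : enorm y <= d%:R * (3 * m).
  apply: le_trans (bump_box_enorm_dist lam0 xb sm) _.
  by lra.
by have := bound x xm; have := bound y ym; lra.
Qed.

End two_scale.

Theorem theorem1p1 (R : realType) (d : nat) (alpha q c1 : R)
  (U1 U2 : 'rV[R]_d -> R) (P : R -> L2 R d -> L2 R d) :
  (1 <= d)%N ->
  0 < alpha < 2 ->
  measurable_fun [set: 'rV[R]_d * 'rV[R]_d] (two_scale_weight U1 U2) ->
  (forall x, 0 <= U1 x) -> (forall x, 0 <= U2 x) ->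
  locally_bounded U1 -> locally_bounded U2 ->
  0 < c1 -> 0 <= q < alpha ->
  (forall x, U2 x <= c1 * (1 + enorm x) `^ q) ->
  semigroup_of_form alpha (two_scale_weight U1 U2) P ->
  (0 < inf (range U1) ->
   limf_einf (fun x => (U1 x / enorm x ^+ 2)%:E) (@enorm_infty R d) = +oo%E ->
   compact_semigroup P) /\
  ((limf_esup (fun x => (U1 x / enorm x ^+ 2)%:E) (@enorm_infty R d) < +oo)%E ->
   ~ compact_semigroup P).
Proof.
move=> d1 /andP[alpha0 alpha2] mW U10 U20 lU1 _ c10 /andP[q0 qalpha] U2q hP.
have W0 := two_scale_weight_ge0 U10 U20.
split=> [infU Uoo|/(quadratic_upper_growth lU1)[A A0 UA]].
  apply: (compact_energy_compact_semigroup mW W0 hP) => e e0.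
  apply: (energy_compactness mW W0 alpha0 d1 infU) => //.
  - exact: two_scale_weight_near_ge.
  - exact: two_scale_weight_quadratic.
have d0 : 0 <= d%:R :> R by [].
pose K1 := A * (2 + 13 * d%:R ^+ 2); pose K2 := 2 * c1 * (1 + 3 * d%:R) `^ q.
have K10 : 0 <= K1 by rewrite mulr_ge0// addr_ge0// mulr_ge0// sqr_ge0.
have K20 : 0 <= K2 by rewrite mulr_ge0 ?powR_ge0// mulr_ge0// ltW.
have lam1 n : 1 <= 4 ^+ n :> R by rewrite exprn_ege1// ler1n.
have Ebump n : (energy alpha (two_scale_weight U1 U2) (spread_bump R d n) (spread_bump R d n) <=
    `|bump_energy_const d alpha q K1 K2|%:E)%E.
  have Wsym := two_scale_weight_sym U1 U2.
  apply: le_trans (bump_energy mW W0 Wsym d1 qalpha alpha2 _ K10 K20 _ _ _) _.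
  - exact: two_scale_weight_near_le.
  - exact: (two_scale_weight_far_le _ (ltW c10)).
  by rewrite spread_bump_scale mul1r lee_fin ler_norm.
apply: (orthogonal_bounded_energy_not_compact mW W0 hP (normr_ge0 _) _ _ Ebump).
- exact: (exprn_gt0 d (divr_gt0 (exprn_gt0 2 (expR_gt0 (- 8))) (ltr0n R 2))).
- move=> n; apply: form_closure_Cc_infty; first exact: bump_Cc_infty.
  by apply: le_lt_trans (Ebump n) _; rewrite ltry.
- exact: spread_bump_bounded.
- exact: spread_bump_norm_ge.
- exact: spread_bump_orthogonal.
Qed.
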